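(* Let $\gamma>1$ and let $T:\mathbb{T}\to\mathbb{T}$ be the circle map with parameter $\gamma$ defined in the context, with its invariant normalized Lebesgue measure $\lambda$. Then $T$ enjoys polynomial decay of correlations with respect to $\lambda$: for every $\varphi\in L^\infty(\mathbb{T},\lambda)$ and every Hölder continuous $\psi:\mathbb{T}\to\mathbb{R}$, $$\left|\int (\varphi\circ T^n)\,\psi\,d\lambda-\int\varphi\,d\lambda\int\psi\,d\lambda\right|=\mathcal{O}\left(\frac{1}{n^{\frac{1}{\gamma-1}}}\right)\qquad (n\to\infty).$$
   Context: Let $\mathbb{T}=[-1,1]/\!\sim$ be the circle obtained by identifying $-1$ and $1$. For a parameter $\gamma>1$, the continuous map $T:\mathbb{T}\to\mathbb{T}$ is defined implicitly by $$x=\frac{1}{2\gamma}(1+T(x))^{\gamma}\ \text{ if } 0\le x\le \frac1{2\gamma},\qquad x=T(x)+\frac{1}{2\gamma}(1-T(x))^{\gamma}\ \text{ if } \frac1{2\gamma}\le x\le 1,$$ and, for negative values of $x$, by $T(-x)=-T(x)$. The map is $C^1$ on $\mathbb{T}\setminus\{0\}$ and $C^2$ on $\mathbb{T}\setminus\{0,1\}$; the point $1$ is a fixed point with derivative $1$ and the derivative is infinite at $0$. The normalized (probability) Lebesgue measure $\lambda$ on $\mathbb{T}$ is $T$-invariant. *)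

(* Defs.v *)
From HB Require Import structures.
From mathcomp Require Import all_boot all_order all_algebra generic_quotient.
From mathcomp Require Import all_classical all_reals all_analysis.
From mathcomp Require Import ring lra.

Set Implicit Arguments.
Unset Strict Implicit.
Unset Printing Implicit Defensive.

Import Order.TTheory GRing.Theory Num.Theory.
Import numFieldNormedType.Exports.
Local Open Scope classical_set_scope.
Local Open Scope quotient_scope.
Local Open Scope ring_scope.

Definition segment (R : realType) := {x : R | -1 <= x <= 1}.

Definition glue (R : realType) (x y : segment R) : bool :=
  (x == y) || ((`|val x| == 1) && (`|val y| == 1)).

Section circle_quotient.
Variable R : realType.

Let glue_refl : reflexive (@glue R).
Proof. by move=> x; rewrite /glue eqxx. Qed.

Let glue_sym : symmetric (@glue R).
Proof. by move=> x y; rewrite /glue eq_sym andbC. Qed.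

Let glue_trans : transitive (@glue R).
Proof.
move=> y x z; rewrite /glue => /orP[/eqP ->//|/andP[x1 y1]].
by move=> /orP[/eqP <-|/andP[_ z1]]; rewrite x1 ?y1 ?z1 orbT.
Qed.

Canonical glue_equiv := EquivRel (@glue R) glue_refl glue_sym glue_trans.

End circle_quotient.

Definition circle (R : realType) : Type := {eq_quot @glue R}.

HB.instance Definition _ (R : realType) := Choice.on (circle R).
HB.instance Definition _ (R : realType) := EqQuotient.on (circle R).

Section circle_points.
Variable R : realType.

Let one_in_segment : -1 <= (1 : R) <= 1.
Proof. by rewrite lexx andbT; lra. Qed.

(* The class of a real number x of [-1, 1]; outside [-1, 1] the value is a
   meaningless default. *)
Definition pt (x : R) : circle R :=
  \pi_(circle R) (insubd (exist _ 1 one_in_segment : segment R) x).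

(* A representative in [-1, 1] of a point of the circle. *)
Definition rep (c : circle R) : R := val (repr c).

HB.instance Definition _ := isPointed.Build (circle R) (pt 1).

Lemma rep_itv c : -1 <= rep c <= 1.
Proof. exact: valP (repr c). Qed.

Lemma repK : cancel rep pt.
Proof. by move=> c; rewrite /pt /rep valKd reprK. Qed.

Lemma pt_eq x y : -1 <= x <= 1 -> -1 <= y <= 1 ->
  (pt x == pt y) = (x == y) || ((`|x| == 1) && (`|y| == 1)).
Proof.
move=> x1 y1; rewrite /pt -[_ == _]/(_ == _ %[mod circle R]) eqmodE.
by rewrite /equiv /= /glue -val_eqE !val_insubd x1 y1.
Qed.

Lemma ptN1 : pt (-1) = pt 1.
Proof. by apply/eqP; rewrite pt_eq ?normrN ?normr1 ?eqxx ?orbT //; lra. Qed.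

Lemma rep_pt x : -1 <= x <= 1 ->
  rep (pt x) = x \/ (`|x| = 1 /\ rep (pt x) = - x).
Proof.
move=> x1; have /eqP := repK (pt x); rewrite pt_eq ?rep_itv //.
case/orP => [/eqP ->|/andP[/eqP r1 /eqP x1']]; first by left.
move/eqP: (r1); rewrite -x1' eqr_norm2 => /orP[/eqP ->|/eqP ->]; first by left.
by right.
Qed.

End circle_points.

(* The Borel sigma-algebra of the circle is the image of that of R: a set is
   measurable when its preimage in [-1, 1] is. *)
Section circle_measurable.
Variable R : realType.

Definition circle_measurable : set (set (circle R)) :=
  image_set_system `[(-1 : R), 1] (@pt R)
    (@measurable _ (measurableTypeR R)).

Let circle_measurable0 : circle_measurable set0.
Proof. by rewrite /circle_measurable /image_set_system /= preimage_set0 setI0. Qed.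

Let circle_measurableC A : circle_measurable A -> circle_measurable (~` A).
Proof.
rewrite /circle_measurable /image_set_system /= => mA.
rewrite (_ : _ `&` _ = `[(-1 : R), 1] `\` (`[(-1 : R), 1] `&` @pt R @^-1` A)).
  exact: measurableD.
by rewrite setDIr setDv set0U setDE preimage_setC.
Qed.

Let circle_measurable_bigcup (F : (set (circle R))^nat) :
  (forall i, circle_measurable (F i)) -> circle_measurable (\bigcup_i F i).
Proof.
rewrite /circle_measurable /image_set_system /= => mF.
by rewrite preimage_bigcup setI_bigcupr; exact: bigcup_measurable.
Qed.

HB.instance Definition _ := @isMeasurable.Build default_measure_display
  (circle R) circle_measurable circle_measurable0 circle_measurableC
  circle_measurable_bigcup.

End circle_measurable.

Section circle_lebesgue.
Variable R : realType.
Local Open Scope ereal_scope.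

Definition circle_lebesgue (A : set (circle R)) : \bar R :=
  (2^-1)%:E * lebesgue_measure (`[(-1)%R, 1%R] `&` @pt R @^-1` A).

Let circle_lebesgue0 : circle_lebesgue set0 = 0.
Proof. by rewrite /circle_lebesgue preimage_set0 setI0 measure0 mule0. Qed.

Let circle_lebesgue_ge0 A : 0 <= circle_lebesgue A.
Proof. by rewrite mule_ge0 ?lee_fin ?invr_ge0. Qed.

Let circle_lebesgue_sigma_additive : semi_sigma_additive circle_lebesgue.
Proof.
move=> F mF tF mUF; rewrite /circle_lebesgue preimage_bigcup setI_bigcupr.
under eq_fun do rewrite -ge0_sume_distrr //.
apply: cvgeZl => //.
apply: measure_semi_sigma_additive.
- by move=> i; exact: (mF i).
- by move=> i j _ _ [x [[_ Fi] [_ Fj]]]; apply: tF => //; exists (pt x).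
- rewrite -setI_bigcupr -preimage_bigcup; exact: mUF.
Qed.

HB.instance Definition _ := isMeasure.Build _ _ _ circle_lebesgue
  circle_lebesgue0 circle_lebesgue_ge0 circle_lebesgue_sigma_additive.

Let circle_lebesgueT : circle_lebesgue setT = 1.
Proof.
rewrite /circle_lebesgue preimage_setT setIT lebesgue_measure_itv /= lte_fin.
by rewrite (_ : (-1 < 1)%R = true); [rewrite -EFinD -EFinM; congr EFin; lra|lra].
Qed.

HB.instance Definition _ := Measure_isProbability.Build _ _ _ circle_lebesgue
  circle_lebesgueT.

End circle_lebesgue.
Arguments circle_lebesgue R : clear implicits.

Section circle_geometry.
Variable R : realType.

Definition circle_opp (c : circle R) : circle R := pt (- rep c).

(* Arc-length distance; the circle has total length 2. *)
Definition circle_dist (c d : circle R) : R :=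
  Num.min `|rep c - rep d| (2 - `|rep c - rep d|).

Definition circle_holder (psi : circle R -> R) : Prop :=
  exists a C : R, 0 < a <= 1 /\
    forall c d, `|psi c - psi d| <= C * circle_dist c d `^ a.

Lemma circle_opp_pt x : -1 <= x <= 1 -> circle_opp (pt x) = pt (- x).
Proof.
move=> x1; rewrite /circle_opp; have [->//|[nx ->]] := rep_pt x1.
by apply/eqP; rewrite pt_eq ?normrN ?nx ?eqxx ?orbT //; lra.
Qed.

Lemma circle_dist_pt x y : -1 <= x <= 1 -> -1 <= y <= 1 ->
  circle_dist (pt x) (pt y) = Num.min `|x - y| (2 - `|x - y|).
Proof.
have norm1 (z : R) : `|z| = 1 -> z = 1 \/ z = -1.
  by move=> /eqP; rewrite eqr_norml ler01 andbT => /orP[] /eqP; [left|right].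
have abs_cases (z : R) : 0 <= z /\ `|z| = z \/ z <= 0 /\ `|z| = - z.
  have [z0|z0] := leP 0 z; first by left; rewrite ger0_norm.
  by right; rewrite ltr0_norm // ltW.
have min_cases (u v : R) : u <= v /\ Num.min u v = u \/ v <= u /\ Num.min u v = v.
  by have [uv|uv] := leP u v; [left|right; rewrite ltW].
move=> x1 y1; rewrite /circle_dist.
have [->|[/norm1 nx ->]] := rep_pt x1; have [->|[/norm1 ny ->]] := rep_pt y1 => //;
  set u := `|_|; set v := `|_|;
  have [[uv ->]|[uv ->]] := min_cases u (2 - u);
  have [[uv' ->]|[uv' ->]] := min_cases v (2 - v);
  rewrite {}/u {}/v in uv uv' *;
  repeat match goal with H : context [`|?z|] |- _ =>
    have [[? E]|[? E]] := abs_cases z; rewrite ?E in uv uv' *; clear E end;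
  repeat match goal with H : _ \/ _ |- _ => case: H => ? end; subst; lra.
Qed.

End circle_geometry.

(* On the upper branch the value is taken in [0, 1].  For large g the equation
   also has solutions t < 0; they are excluded by the continuity of the map,
   whose value at 1 / (2 g) is 0. *)
Definition is_circle_map (R : realType) (g : R) (T : circle R -> circle R) :
    Prop :=
  [/\ forall x : R, 0 <= x <= (2 * g)^-1 ->
        exists t : R, [/\ -1 <= t <= 0, T (pt x) = pt t
          & x = (2 * g)^-1 * (1 + t) `^ g],
      forall x : R, (2 * g)^-1 <= x <= 1 ->
        exists t : R, [/\ 0 <= t <= 1, T (pt x) = pt t
          & x = t + (2 * g)^-1 * (1 - t) `^ g]
    & forall c, T (circle_opp c) = circle_opp (T c)].

(* The equations determine the map. *)
Section circle_map_existence.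
Variables (R : realType) (g : R).
Hypothesis g1 : 1 < g.

Let g0 : 0 < g. Proof. exact: lt_trans ltr01 g1. Qed.
Let G := (2 * g)^-1.
Let Gg : G * g = 2^-1. Proof. by rewrite /G; field; rewrite ?gt_eqF //; lra. Qed.
Let G0 : 0 < G. Proof. by rewrite /G invr_gt0; move: g0; lra. Qed.
Let G1 : G < 1.
Proof. by rewrite /G invf_lt1; move: g0 g1; lra. Qed.

Let h (u : R) := 1 - u + G * u `^ g.

Let powR_lip (u v : R) : 0 <= u -> u < v -> v <= 1 -> v `^ g - u `^ g <= g * (v - u).
Proof.
move=> u0 uv v1; have [uz|u_n0] := eqVneq u 0.
  rewrite uz powR0 ?gt_eqF // !subr0.
  have : v `^ g <= v by rewrite ge1r_powR ?(ltW g1) //; lra.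
  by move: g1 => g1_; nra.
have {u_n0}u_gt0 : 0 < u by lra.
have der (x : R) : 0 < x -> is_derive x 1 (@powR R ^~ g) (g * x `^ (g - 1)).
  exact: is_derive1_powR.
have [x|x|c] := @MVT R (@powR R ^~ g) (fun x => g * x `^ (g - 1)) u v uv.
- by rewrite in_itv /= => /andP[? _]; apply: der; lra.
- apply: derivable_within_continuous => z.
  by rewrite in_itv /= => /andP[? _]; have [] := der z; first lra.
rewrite in_itv /= => /andP[uc cv] ->.
rewrite ler_wpM2r ?subr_ge0 ?(ltW uv) // ger_pMr // -[leRHS](powRr0 c).
apply: ger_powR; first by lra.
by rewrite subr_ge0 ltW.
Qed.

Let h_anti (u v : R) : 0 <= u -> u < v -> v <= 1 -> h v < h u.
Proof.
move=> u0 uv v1; rewrite /h.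
have := ler_wpM2l (ltW G0) (powR_lip u0 uv v1).
by rewrite mulrA Gg mulrBr; lra.
Qed.

Let h_surj (x : R) : G <= x <= 1 -> exists2 u, 0 <= u <= 1 & h u = x.
Proof.
move=> /andP[Gx x1].
have h0 : h 0 = 1 by rewrite /h powR0 ?gt_eqF // mulr0 addr0 subr0.
have h1 : h 1 = G by rewrite /h powR1 subrr add0r mulr1.
have cont (z : R) : 0 < z -> {for z, continuous h}.
  move=> z0; apply: (@cvgD _ R^o); first by apply: cvgB; [exact: cvg_cst|exact: cvg_id].
  apply: cvgM; first exact: cvg_cst.
  suff : {for z, continuous (@powR R ^~ g)} by [].
  apply: differentiable_continuous; apply/derivable1_diffP.
  by apply: derivable_powR; rewrite in_itv /= andbT.
suff hc : {within `[0, 1], continuous h}.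
  have xh : Num.min (h 0) (h 1) <= x <= Num.max (h 0) (h 1).
    by rewrite h0 h1 /Num.min /Num.max [1 < G]lt_gtF // Gx x1.
  by have [u u01 <-] := IVT ler01 hc xh; exists u.
apply/continuous_within_itvP => //; split.
- by move=> z; rewrite in_itv /= => /andP[z0 _]; exact: cont.
- rewrite /h powR0 ?gt_eqF //; apply: (@cvgD _ R^o).
    by apply: cvgB; [exact: cvg_cst|exact: cvg_at_right_filter cvg_id].
  by apply: cvgM; [exact: cvg_cst|exact: powR_cvg0].
- exact: cvg_at_left_filter (cont 1 ltr01).
Qed.

Let lower (x t : R) := -1 <= t <= 0 /\ x = G * (1 + t) `^ g.
Let upper (x t : R) := 0 <= t <= 1 /\ x = t + G * (1 - t) `^ g.
Let branch (x t : R) := (x <= G /\ lower x t) \/ (G <= x /\ upper x t).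

Let lower_ex (x : R) : 0 <= x <= G -> exists t, lower x t.
Proof.
move=> /andP[x0 xG]; exists ((x / G) `^ g^-1 - 1).
have xG0 : 0 <= x / G by rewrite divr_ge0 // ltW.
have xG1 : x / G <= 1 by rewrite ler_pdivrMr // mul1r.
have p0 : 0 <= (x / G) `^ g^-1 by exact: powR_ge0.
have p1 : (x / G) `^ g^-1 <= 1.
  have e : 1 = 1 `^ g^-1 :> R by rewrite powR1.
  by rewrite [leRHS]e ge0_ler_powR ?nnegrE ?invr_ge0 ?(ltW g0) ?ler01.
split; first by lra.
rewrite addrCA subrr addr0 -powRrM mulVf ?gt_eqF // powRr1 //.
by rewrite mulrC divfK ?gt_eqF.
Qed.

Let upper_ex (x : R) : G <= x <= 1 -> exists t, upper x t.
Proof.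
move=> /h_surj[u u01 <-]; exists (1 - u); split; first by lra.
by rewrite /h subKr.
Qed.

Let lower_inj (x s t : R) : lower x s -> lower x t -> s = t.
Proof.
move=> [s1 ->] [t1 /(mulfI (lt0r_neq0 G0))].
move=> /(powR_injective g0); rewrite !nnegrE => /(_ _ _)/addrI; apply; lra.
Qed.

Let upper_inj (x s t : R) : upper x s -> upper x t -> s = t.
Proof.
move=> [s1 xs] [t1 xt].
have hs : h (1 - s) = x by rewrite xs /h subKr.
have ht : h (1 - t) = x by rewrite xt /h subKr.
have [st|ts|//] := ltgtP s t.
- suff : h (1 - s) < h (1 - t) by rewrite hs ht ltxx.
  by apply: h_anti; lra.
- suff : h (1 - t) < h (1 - s) by rewrite hs ht ltxx.
  by apply: h_anti; lra.
Qed.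

Let lowerG (t : R) : lower G t -> t = 0.
Proof.
move=> Gt; apply: (lower_inj Gt); split; first by lra.
by rewrite addr0 powR1 mulr1.
Qed.

Let upperG (t : R) : upper G t -> t = 0.
Proof.
move=> Gt; apply: (upper_inj Gt); split; first by lra.
by rewrite subr0 powR1 mulr1 add0r.
Qed.

Let branch_inj (x s t : R) : branch x s -> branch x t -> s = t.
Proof.
move=> [[xG xs]|[Gx xs]] [[xG' xt]|[Gx' xt]].
- exact: lower_inj xs xt.
- have xE : x = G by lra.
  by rewrite xE in xs xt; rewrite (lowerG xs) (upperG xt).
- have xE : x = G by lra.
  by rewrite xE in xs xt; rewrite (upperG xs) (lowerG xt).
- exact: upper_inj xs xt.
Qed.

Let branch_ex (x : R) : 0 <= x <= 1 -> exists t, branch x t.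
Proof.
move=> x01; have [xG|Gx] := leP x G.
  by have [|t xt] := @lower_ex x; [lra|exists t; left].
by have [|t xt] := @upper_ex x; [lra|exists t; right; split => //; lra].
Qed.

Let branch_itv (x t : R) : branch x t -> -1 <= t <= 1.
Proof. by move=> [[_ [? _]]|[_ [? _]]]; lra. Qed.

Let branch0 (t : R) : branch 0 t -> t = -1.
Proof.
move=> b; apply: (branch_inj b); left; split; first exact: ltW.
split; first by lra.
by rewrite subrr powR0 ?gt_eqF // mulr0.
Qed.

Let branch1 (t : R) : branch 1 t -> t = 1.
Proof.
move=> b; apply: (branch_inj b); right; split; first exact: ltW.
split; first by lra.
by rewrite subrr powR0 ?gt_eqF // mulr0 addr0.
Qed.

Let is_circle_mapP (T : circle R -> circle R) :
  is_circle_map g T <->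
  (forall x t, 0 <= x <= 1 -> branch x t -> T (pt x) = pt t) /\
  (forall c, T (circle_opp c) = circle_opp (T c)).
Proof.
split=> [[Tl Tu To]|[Tb To]]; split => //.
- move=> x t x01 xt; have [xG|Gx] := leP x G.
  + have [|s [s1 -> xs]] := Tl x; first by rewrite -/G; lra.
    by congr pt; apply: branch_inj xt; left.
  + have [|s [s1 -> xs]] := Tu x; first by rewrite -/G; lra.
    by congr pt; apply: branch_inj xt; right; split => //; lra.
- move=> x; rewrite -/G => x0G; have [t [t1 xt]] := lower_ex x0G.
  exists t; split => //.
  by apply: Tb; [have := G1; lra|left; split; [lra|]].
- move=> x; rewrite -/G => xG1; have [t [t1 xt]] := upper_ex xG1.
  exists t; split => //.
  by apply: Tb; [have := G0; lra|right; split; [lra|]].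
Qed.

Let circle_oppK c : circle_opp (circle_opp c) = c :> circle R.
Proof.
have rc := rep_itv c; rewrite -[c in LHS]repK !circle_opp_pt ?opprK ?repK //; lra.
Qed.

Let circle_opp1 : circle_opp (pt 1) = pt 1 :> circle R.
Proof. by rewrite circle_opp_pt ?ptN1 //; lra. Qed.

Lemma circle_map_exists_unique : exists! T, is_circle_map g T.
Proof.
pose b x := xget 0 [set t | branch x t].
have bP x : 0 <= x <= 1 -> branch x (b x).
  by move=> /branch_ex[t xt]; apply: (@xgetPex _ 0 [set t | branch x t]); exists t.
pose T (c : circle R) : circle R :=
  if 0 <= rep c then pt (b (rep c)) else circle_opp (pt (b (- rep c))).
have Tpt x : 0 <= x <= 1 -> T (pt x) = pt (b x).
  move=> x01; rewrite /T.
  have [|->|[]] := @rep_pt _ x; first by lra.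
    by rewrite ifT //; lra.
  rewrite ger0_norm; last by lra.
  move=> -> ->; rewrite ifF; last by apply/negbTE; rewrite -ltNge; lra.
  by rewrite opprK (branch1 (bP 1 _)) ?circle_opp1 //; lra.
have To c : T (circle_opp c) = circle_opp (T c).
  have pos x : 0 <= x <= 1 -> T (pt (- x)) = circle_opp (T (pt x)).
    move=> x01; rewrite (Tpt x x01) /T.
    have [|->|[nx ->]] := @rep_pt _ (- x); first by lra.
      case: ifPn => [x0|]; last by rewrite opprK.
      have -> : x = 0 by lra.
      by rewrite oppr0 (branch0 (bP 0 _)) ?ptN1 ?circle_opp1 //; lra.
    have -> : x = 1 by move: nx; rewrite normrN ger0_norm //; lra.
    rewrite !opprK ler01 (branch1 (bP 1 _)) ?circle_opp1 //; lra.
  have rc := rep_itv c; rewrite -(repK c) circle_opp_pt //.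
  have [r0|r0] := leP 0 (rep c); first by apply: pos; lra.
  have := pos (- rep c); rewrite opprK => ->; last by lra.
  by rewrite circle_oppK.
have TP : is_circle_map g T.
  apply/is_circle_mapP; split => // x t x01 xt.
  by rewrite Tpt //; congr pt; exact: branch_inj (bP x x01) xt.
exists T; split => // T' /is_circle_mapP[Tb' To']; apply/funext => c.
have pos x : 0 <= x <= 1 -> T (pt x) = T' (pt x).
  by move=> x01; rewrite Tpt // (Tb' x _ x01 (bP x x01)).
have rc := rep_itv c; rewrite -(repK c).
have [r0|r0] := leP 0 (rep c); first by apply: pos; lra.
have := pos (- rep c); rewrite -circle_opp_pt // To To' => /(_ _) E.
by rewrite -[LHS]circle_oppK E ?circle_oppK //; lra.
Qed.

End circle_map_existence.

(* Main.v *)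
Require Import Defs.
From HB Require Import structures.
From mathcomp Require Import all_boot all_order all_algebra.
From mathcomp Require Import all_classical all_reals all_analysis.
From mathcomp Require Import measurable_realfun.
From mathcomp Require Import ring lra zify.

Import Order.TTheory GRing.Theory Num.Theory.
Import numFieldNormedType.Exports.
Local Open Scope classical_set_scope.
Local Open Scope ring_scope.

(* A point [t] has the two preimages [hup t >= 0] and [hlow t <= 0], and since T
   preserves Lebesgue measure the weights [wup t = hup' t] and [1 - wup t] add up
   to 1: the dual of [f |-> f \o T] is the Markov operator [transfer].  The
   correlation is thus bounded by the sup norm of [phi] times the L^1 norm of
   [transfer^n psi - \int psi], and it remains to bound the oscillation of
   [transfer^n psi].

   As [wup] increases, two points [x <= y] can be moved by the same branch except
   with probability [wup y - wup x], in which case [y] takes the upper branch and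
   [x] the lower one, so that the order is kept.  Pairs that have always moved
   together are controlled by a Lyapunov function, the Hoelder distance damped by
   the time elapsed relative to the time spent near the neutral fixed point.
   Pairs that have separated are controlled by increments of an odd nondecreasing
   function [w], a class which the operator preserves.  Since
   [w (hup t) >= 0 >= w (hlow t)] for [t] near 1, only the branch fixing 1
   contributes to a bound of [|transfer w|] there, and the L^1 norm of
   [transfer^n w] is at most that of [w] on the points at distance at most [u_n]
   from the neutral point, where [u_0 = 1] and [u_(n+1) = u_n - u_n^g / (2 g)];
   this sequence is O(n^(-1/(g-1))). *)

(** Everything hinges on a balance at the neutral point. At distance [u] from it, a step of the
    branch fixing 1 lengthens the sojourn time [u^(-(g-1))] by about [(g-1)/(2g) = 1/2 - G]. The
    [k]-th power of the damping factor thus grows by a relative amount of at most about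
    [k (1/2 - G) u^(g-1)], while the probability of leaving is about [u^(g-1)/2]. So one needs
    [k (1/2 - G) < 1/2], that is [k < g/(g-1)]. Summable separation costs ask for [k > 1], and the
    claimed rate asks for [k >= 1/(g-1)]. These conditions are compatible for every [g > 1],
    whatever the Hoelder exponent.

    Separated pairs leave an error that is bounded but not small; pairs moved together leave one
    that is small up to an integrable singularity at the neutral point. Hence the [n] steps are
    shared between two halves: the first produces both errors, the second makes the bounded one
    small in L^1 and, since the operator preserves integrals, does not harm the other. *)

Section powers.
Context {R : realType}.
Implicit Types a k u v z : R.

(* Young's inequality with one of the two factors equal to 1. *)
Lemma powR_bernoulli k z : 1 < k -> 0 <= z -> 1 + k * (z - 1) <= z `^ k.
Proof.
move=> k1 z0; have k0 : 0 < k by lra.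
have q0 : 0 < k / (k - 1) by apply: divr_gt0; lra.
have := @conjugate_powR _ z 1 k (k / (k - 1)) z0 ler01 k0 q0.
have -> : k^-1 + (k / (k - 1))^-1 = 1 by field; rewrite !gt_eqF//; lra.
move=> /(_ erefl).
rewrite mulr1 powR1 invf_div mul1r -(ler_pM2r k0).
have -> : (z `^ k / k + (k - 1) / k) * k = z `^ k + (k - 1).
  by field; rewrite gt_eqF.
by lra.
Qed.

(** Bernoulli at [v / u], rescaled by [u^k]: a convex power lies above its tangents. *)
Lemma powR_tangent k u v : 1 < k -> 0 <= u -> 0 <= v ->
  k * u `^ (k - 1) * (v - u) <= v `^ k - u `^ k.
Proof.
move=> k1; rewrite le_eqVlt => /predU1P[<-|u0] v0.
  rewrite !powR0 ?gt_eqF ?subr_gt0 ?(lt_trans ltr01)//.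
  by rewrite mulr0 mul0r subr0 powR_ge0.
have := powR_bernoulli k (v / u) k1 (divr_ge0 v0 (ltW u0)).
have uk : 0 < u `^ k by exact: powR_gt0.
rewrite -(ler_pM2r uk) -powRM ?divr_ge0 ?(ltW u0)// divfK ?gt_eqF//.
rewrite -{1}(@mulr_powRB1 _ u k) ?(ltW u0) ?(lt_trans ltr01)//.
set w := u `^ (k - 1).
have -> : (1 + k * (v / u - 1)) * (u * w) = u * w + k * w * (v - u).
  by field; rewrite gt_eqF.
by rewrite /w mulr_powRB1 ?(ltW u0) ?(lt_trans ltr01)//; lra.
Qed.

(** Proved through the exponential because the exponents to come, such as [g - 1], may be less than
    1, where [powR_bernoulli] does not apply. *)
Lemma powRN_ge1D k z : 0 <= k -> 0 <= z < 1 -> 1 + k * z <= (1 - z) `^ (- k).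
Proof.
move=> k0 /andP[z0 z1]; rewrite /powR gt_eqF; last by lra.
apply: le_trans (expR_ge1Dx _) _; rewrite ler_expR mulNr -mulrN.
by rewrite ler_wpM2l// lerNr; apply: le_ln1Dx; lra.
Qed.

(** Bernoulli for the exponent [k], divided by [1 - z]; with [k = g] it will bound the growth of the
    sojourn time from above with the sharp constant. *)
Lemma powRN_le_bernoulli k z : 1 < k -> 0 <= z -> k * z < 1 ->
  (1 - z) `^ (- (k - 1)) <= (1 - z) / (1 - k * z).
Proof.
move=> k1 z0 kz; have z1 : z < 1 by nra.
have := powR_bernoulli k (1 - z) k1; rewrite subr_ge0 => /(_ (ltW z1)).
have z1' : 0 < 1 - z by lra.
rewrite -(@mulr_powRB1 _ (1 - z) k) ?(ltW z1')//; last by lra.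
rewrite powRN; have : 0 < (1 - z) `^ (k - 1) by exact: powR_gt0.
set w := _ `^ _ => w0 H.
by rewrite ler_pdivlMr ?subr_gt0// ler_pdivrMl//; lra.
Qed.

End powers.

(** * Inverse branches and the transfer operator *)

Section inverse_branches.
Context {R : realType}.
Implicit Types (g t x y u : R) (f : R -> R).

Definition hup g t :=
  if t <= 0 then (2 * g)^-1 * (1 + t) `^ g else t + (2 * g)^-1 * (1 - t) `^ g.

(** By symmetry this branch is [- hup (- t)], see [hlowE]. In the present form it is visible that
    the two derivatives add up to 1. *)
Definition hlow g t := t - hup g t.

(* The derivative of [hup]. *)
Definition wup g t :=
  if t <= 0 then 2^-1 * (1 + t) `^ (g - 1) else 1 - 2^-1 * (1 - t) `^ (g - 1).

Definition transfer g f t :=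
  wup g t * f (hup g t) + (1 - wup g t) * f (hlow g t).

End inverse_branches.

Section branch_theory.
Context {R : realType} (g : R).
Hypothesis g1 : 1 < g.
Implicit Types (t x y u : R) (f : R -> R).

Local Notation G := ((2 * g)^-1).
Local Notation hup := (hup g).
Local Notation hlow := (hlow g).
Local Notation wup := (wup g).

Let g0 : 0 < g. Proof. by move: g1; lra. Qed.

Lemma Gg : G * g = 2^-1. Proof. by field; rewrite gt_eqF. Qed.

Lemma G_itv : 0 < G < 2^-1.
Proof.
rewrite invr_gt0 mulr_gt0//= ltf_pV2 ?posrE ?mulr_gt0//.
by rewrite -{1}(mulr1 2) ltr_pM2l.
Qed.

Lemma powR_le_id x : 0 <= x <= 1 -> x `^ g <= x.
Proof.
move=> /andP[]; rewrite le_eqVlt => /predU1P[<- _|x0 x1].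
  by rewrite powR0 ?gt_eqF.
by apply: ge1r_powR; rewrite ?x0 ?(ltW g1).
Qed.

Lemma powR_le1 x (k : R) : 0 <= k -> 0 <= x <= 1 -> x `^ k <= 1.
Proof.
move=> k0 /andP[x0 x1]; rewrite (_ : 1 = 1 `^ k); last by rewrite powR1.
by apply: ge0_ler_powR; rewrite ?nnegrE.
Qed.

Lemma hupN t : hup (- t) = hup t - t.
Proof.
rewrite /hup oppr_le0 opprK; case: ltgtP => [t0|t0|<-].
- lra.
- lra.
- by rewrite !subr0 addr0.
Qed.

Lemma hlowE t : hlow t = - hup (- t).
Proof. by rewrite hupN opprB. Qed.

Lemma hlowN t : hlow (- t) = - hup t.
Proof. by rewrite hlowE opprK. Qed.

Lemma wupN t : wup (- t) = 1 - wup t.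
Proof.
rewrite /wup oppr_le0 opprK; case: ltgtP => [t0|t0|<-] //.
- lra.
- by rewrite subr0 addr0 powR1; lra.
Qed.

Lemma wup_itv t : -1 <= t <= 1 -> 0 <= wup t <= 1.
Proof.
move=> t1; rewrite /wup; case: ifPn => [t0|]; [|rewrite -ltNge => t0].
- have := powR_ge0 (1 + t) (g - 1).
  by have := @powR_le1 (1 + t) (g - 1); rewrite subr_ge0 => /(_ (ltW g1)); lra.
- have := powR_ge0 (1 - t) (g - 1).
  by have := @powR_le1 (1 - t) (g - 1); rewrite subr_ge0 => /(_ (ltW g1)); lra.
Qed.

Lemma wup_ge_half t : 0 <= t <= 1 -> 2^-1 <= wup t.
Proof.
move=> t1; rewrite /wup; case: ifPn => [t0|]; [|rewrite -ltNge => t0].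
- by rewrite (_ : t = 0) ?addr0 ?powR1; lra.
- by have := @powR_le1 (1 - t) (g - 1); rewrite subr_ge0 => /(_ (ltW g1)); lra.
Qed.

Lemma wup_ge0E t : 0 <= t -> wup t = 1 - 2^-1 * (1 - t) `^ (g - 1).
Proof.
rewrite /wup => t0; case: ifPn => // t0'.
by rewrite (_ : t = 0) ?addr0 ?subr0 ?powR1; lra.
Qed.

Lemma hup_ge0E t : 0 <= t -> hup t = t + G * (1 - t) `^ g.
Proof.
rewrite /hup => t0; case: ifPn => // t0'.
by rewrite (_ : t = 0) ?addr0 ?subr0 ?powR1 ?add0r; lra.
Qed.

Lemma hup0 : hup 0 = G.
Proof. by rewrite /hup lexx addr0 powR1 mulr1. Qed.

Lemma hup1 : hup 1 = 1.
Proof. by rewrite hup_ge0E// subrr powR0 ?gt_eqF// mulr0 addr0. Qed.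

Lemma hupN1 : hup (-1) = 0.
Proof. by rewrite hupN hup1 subrr. Qed.

Lemma hup_tangent_ge0 x y : 0 <= x -> x <= y -> y <= 1 ->
  wup x * (y - x) <= hup y - hup x <= wup y * (y - x).
Proof.
move=> x0 xy y1; rewrite !wup_ge0E ?hup_ge0E ?(le_trans x0)//.
have := powR_tangent g (1 - x) (1 - y) g1; rewrite !subr_ge0.
move=> /(_ (le_trans xy y1) y1) H1.
have := powR_tangent g (1 - y) (1 - x) g1; rewrite !subr_ge0.
move=> /(_ y1 (le_trans xy y1)) H2.
have /andP[G0 _] := G_itv; have GE := Gg.
move: (ler_wpM2l (ltW G0) H1) (ler_wpM2l (ltW G0) H2); rewrite !mulrA Gg.
set A := (1 - x) `^ (g - 1); set B := (1 - y) `^ (g - 1).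
by set a := (1 - x) `^ g; set b := (1 - y) `^ g => ? ?; apply/andP; split; lra.
Qed.

Lemma hup_tangent_le0 x y : -1 <= x -> x <= y -> y <= 0 ->
  wup x * (y - x) <= hup y - hup x <= wup y * (y - x).
Proof.
move=> x1 xy y0; have := @hup_tangent_ge0 (- y) (- x).
rewrite oppr_ge0 lerN2 lerNl opprK => /(_ y0 xy x1).
rewrite !hupN !wupN; set a := wup _; set b := wup _; lra.
Qed.

Lemma wup_mono x y : -1 <= x -> x <= y -> y <= 1 -> wup x <= wup y.
Proof.
have pos s t : 0 <= s -> s <= t -> t <= 1 -> wup s <= wup t.
  move=> s0 st t1; rewrite !wup_ge0E ?(le_trans s0)// lerD2l lerN2.
  by rewrite ler_pM2l// ge0_ler_powR ?nnegrE ?subr_ge0 ?(ltW g1)//; lra.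
move=> x1 xy y1; have [x0|x0] := leP 0 x; first exact: pos.
have [y0|y0] := leP y 0; first by have := pos (- y) (- x); rewrite !wupN; lra.
by have := pos 0 y; have := pos 0 (- x); rewrite wupN (wup_ge0E 0)// subr0 powR1; lra.
Qed.

(** Convexity of [hup] on both sides of 0, glued at 0 by the monotonicity of [wup]. It stands in for
    the mean value theorem. *)
Lemma hup_tangent x y : -1 <= x -> x <= y -> y <= 1 ->
  wup x * (y - x) <= hup y - hup x <= wup y * (y - x).
Proof.
move=> x1 xy y1; have [x0|x0] := leP 0 x; first exact: hup_tangent_ge0.
have [y0|y0] := leP y 0; first exact: hup_tangent_le0.
have /andP[H1 H2] := @hup_tangent_ge0 0 y (lexx _) (ltW y0) y1.
have /andP[H3 H4] := @hup_tangent_le0 x 0 x1 (ltW x0) (lexx _).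
have := @wup_mono x 0 x1 (ltW x0) ler01; have := @wup_mono 0 y (lerN10 _) (ltW y0) y1.
by move: H1 H2 H3 H4; nra.
Qed.

Lemma hup_homo x y : -1 <= x -> x <= y -> y <= 1 -> hup x <= hup y.
Proof.
move=> x1 xy y1; have /andP[H _] := @hup_tangent x y x1 xy y1.
have /andP[p0 _] : 0 <= wup x <= 1 by apply: wup_itv; lra.
by move: H p0; nra.
Qed.

Lemma hlow_homo x y : -1 <= x -> x <= y -> y <= 1 -> hlow x <= hlow y.
Proof. by move=> x1 xy y1; rewrite !hlowE lerN2 hup_homo ?lerN2//; lra. Qed.

Lemma wup_gt0 t : -1 < t -> t <= 1 -> 0 < wup t.
Proof.
move=> t1 t1'; have [t0|t0] := leP 0 t.
  by have := wup_ge_half t; lra.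
by rewrite /wup (ltW t0) mulr_gt0// powR_gt0; lra.
Qed.

Lemma hup_lt x y : -1 <= x -> x < y -> y <= 1 -> hup x < hup y.
Proof.
(* The slope [wup] vanishes at -1, so strictness is gained on [[m, y]] only. *)
move=> x1 xy y1; set m := (x + y) / 2.
have [xm my] : x < m /\ m < y by rewrite /m; lra.
have := @hup_homo x m; have := @hup_tangent m y; have := @wup_gt0 m.
nra.
Qed.

Lemma hup_inj x y : -1 <= x <= 1 -> -1 <= y <= 1 -> hup x = hup y -> x = y.
Proof.
move=> x1 y1 e; have [|xy|] := ltgtP x y => //.
- by have := @hup_lt x y; rewrite e ltxx; lra.
- by have := @hup_lt y x; rewrite e ltxx; lra.
Qed.

Lemma hup_itv t : -1 <= t <= 1 -> 0 <= hup t <= 1.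
Proof.
by move=> t1; have := @hup_homo (-1) t; have := @hup_homo t 1; rewrite hup1 hupN1; lra.
Qed.

Lemma hup_itvW t : -1 <= t <= 1 -> -1 <= hup t <= 1.
Proof. by move=> /hup_itv; lra. Qed.

Lemma hlow_itv t : -1 <= t <= 1 -> -1 <= hlow t <= 0.
Proof. by move=> t1; have := hup_itv (- t); rewrite hlowE; lra. Qed.

Lemma hlow_itvW t : -1 <= t <= 1 -> -1 <= hlow t <= 1.
Proof. by move=> /hlow_itv; lra. Qed.

(** The mean slope [q]: the branches multiply the distance of a pair by [q] and [1 - q]. The
    one-step estimates see the pair only through [q], the weights and the sojourn times. *)
Lemma hup_slope x y : -1 <= x -> x < y -> y <= 1 -> exists q,
  [/\ hup y - hup x = q * (y - x), hlow y - hlow x = (1 - q) * (y - x),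
      wup x <= q <= wup y & 0 <= q <= 1].
Proof.
move=> x1 xy y1; exists ((hup y - hup x) / (y - x)).
have yx : 0 < y - x by lra.
have e : hup y - hup x = (hup y - hup x) / (y - x) * (y - x).
  by rewrite divfK ?gt_eqF.
have /andP[H1 H2] := @hup_tangent x y x1 (ltW xy) y1.
have [] := (wup_itv x, wup_itv y).
rewrite ler_pdivlMr// ler_pdivrMr// H1 H2 => px py; split => //.
- by rewrite /hlow; lra.
- rewrite divr_ge0 ?ler_pdivrMr ?mul1r//=; last by rewrite ltW.
    by move: H2 py; nra.
  by rewrite subr_ge0 hup_homo ?(ltW xy).
Qed.

End branch_theory.

(** * A Lyapunov function for pairs of points *)

Section lyapunov.
Context {R : realType} (g : R).
Hypothesis g1 : 1 < g.
Implicit Types (a k s x y u q r M N V W c d e : R).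

Local Notation G := ((2 * g)^-1).
Local Notation hup := (hup g).
Local Notation hlow := (hlow g).
Local Notation wup := (wup g).

(* Number of steps, up to a constant factor, that the pair [x < y] spends near
   the neutral fixed point. *)
Definition sojourn x y :=
  if 0 <= x then (1 - x) `^ (- (g - 1))
  else if y <= 0 then (1 + y) `^ (- (g - 1)) else 1.

Lemma sojournN x y : x < y -> sojourn (- y) (- x) = sojourn x y.
Proof.
move=> xy; rewrite /sojourn oppr_ge0 oppr_le0 opprK.
by case: (leP y 0); case: (leP 0 x) => // ? ?; exfalso; lra.
Qed.

Lemma powRN_ge1 u k : 0 < u <= 1 -> 0 <= k -> 1 <= u `^ (- k).
Proof.
move=> /andP[u0 u1] k0; rewrite powRN invf_ge1 ?powR_gt0//.
by apply: powR_le1; rewrite // (ltW u0).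
Qed.

Lemma sojourn_ge1 x y : -1 <= x -> x < y -> y <= 1 -> 1 <= sojourn x y.
Proof.
move=> x1 xy y1; have g10 : 0 <= g - 1 by rewrite subr_ge0 ltW.
rewrite /sojourn; case: ifPn => [x0|]; first by apply: powRN_ge1 => //; lra.
by rewrite -ltNge => x0; case: ifPn => // y0; apply: powRN_ge1 => //; lra.
Qed.

(** With [u = 1 - x] and [s = u^(g-1)] one has [1 - hup x = u (1 - G s)], and [powRN_le_bernoulli]
    applies with [g G s = s / 2]. As [s] tends to 0 the increment tends to [2^-1 - G], the constant
    that limits the exponent [k]. *)
Lemma sojourn_hup_growth x : 0 <= x < 1 ->
  (1 - hup x) `^ (- (g - 1)) <=
  (1 - x) `^ (- (g - 1)) + (2^-1 - G) / (1 - (1 - x) `^ (g - 1) / 2).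
Proof.
move=> /andP[x0 x1]; have u0 : 0 < 1 - x by lra.
have := powR_gt0 (g - 1) u0; set s := (1 - x) `^ (g - 1) => s0.
have s1 : s <= 1 by apply: powR_le1; rewrite ?subr_ge0 ?(ltW g1)//; lra.
have [/andP[G0 G1] GE] := (G_itv g g1, Gg g g1).
have -> : 1 - hup x = (1 - x) * (1 - G * s).
  rewrite (hup_ge0E g)// /s -[in LHS](@mulr_powRB1 _ (1 - x) g) ?(ltW u0)//; first by ring.
  by move: g1; lra.
have z1 : g * (G * s) = s / 2 by rewrite mulrA [g * _]mulrC Gg//; lra.
rewrite powRM ?(ltW u0)//; last by nra.
have := powRN_le_bernoulli g (G * s) g1; rewrite z1 => /(_ _ _)/[dup] _ H.
have {}H := H (mulr_ge0 (ltW G0) (ltW s0)).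
have {}H := H ltac:(lra).
apply: le_trans (ler_wpM2l (powR_ge0 _ _) H) _.
rewrite powRN -/s; set d := 1 - s / 2.
have d0 : 0 < d by rewrite /d; lra.
have -> : s^-1 + (2^-1 - G) / d = s^-1 * ((d + (2^-1 - G) * s) / d).
  have -> : (d + (2^-1 - G) * s) / d = 1 + (2^-1 - G) * s / d.
    by rewrite [LHS]mulrDl divff ?gt_eqF.
  rewrite mulrDr mulr1 [_ * s / d]mulrAC [X in _ = _ + X]mulrCA.
  by rewrite mulVf ?gt_eqF// mulr1.
rewrite ler_wpM2l ?invr_ge0 ?(ltW s0)// ler_pM2r ?invr_gt0// /d; lra.
Qed.

(** Bounds the sojourn time of a pair that has just been sent within [G] of 0. *)
Lemma powRN_le_G x : 1 - G <= x -> x <= 1 -> x `^ (- (g - 1)) <= (1 - G) `^ (- (g - 1)).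
Proof.
move=> xG x1; have /andP[G0 G1] := G_itv g g1.
rewrite !powRN lef_pV2 ?posrE ?powR_gt0//; [|lra..].
by apply: ge0_ler_powR; rewrite ?nnegrE ?subr_ge0 ?(ltW g1)//; lra.
Qed.

Lemma hup_nonpos_le x : -1 <= x <= 0 -> 0 <= hup x <= G.
Proof.
move=> x0; have := @hup_itv _ g g1 x; have := @hup_homo _ g g1 x 0.
by rewrite hup0; lra.
Qed.

Lemma hlow_nonneg_ge y : 0 <= y <= 1 -> - G <= hlow y <= 0.
Proof. by move=> y0; rewrite (hlowE g); have := @hup_nonpos_le (- y); lra. Qed.

(** On [[0, 1]], [hlow t = - G (1 - t)^g]; replace [(1 - y)^(g-1)] by the larger [(1 - x)^(g-1)].
    Away from the neutral point this keeps the slope [q] of the upper branch below 1. *)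
Lemma slope_nonneg x y q : 0 <= x -> x < y -> y <= 1 ->
  hlow y - hlow x = (1 - q) * (y - x) -> G * (1 - x) `^ (g - 1) <= 1 - q.
Proof.
move=> x0 xy y1 H; have yx : 0 < y - x by lra.
rewrite -(ler_pM2r yx) -H /hlow !(hup_ge0E g)//; last by lra.
have [/andP[G0 G1] GE] := (G_itv g g1, Gg g g1).
have g0 : 0 < g by move: g1; lra.
rewrite -(@mulr_powRB1 _ (1 - x) g) ?subr_ge0 ?(le_trans (ltW xy))//.
rewrite -(@mulr_powRB1 _ (1 - y) g) ?subr_ge0//.
have : (1 - y) `^ (g - 1) <= (1 - x) `^ (g - 1).
  by apply: ge0_ler_powR; rewrite ?nnegrE ?subr_ge0 ?(ltW g1)//; lra.
set A := (1 - y) `^ _; set B := (1 - x) `^ _ => AB.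
have : 0 <= G * ((1 - y) * (B - A)) by rewrite !mulr_ge0 ?subr_ge0 ?(ltW G0).
lra.
Qed.

(** Bernoulli for [(1 - y)^g] and [(1 + x)^g <= 1 + x] give [hup y - hup x >= y / 2 - G x], and
    [G < 2^-1]. *)
Lemma slope_sep x y q : -1 <= x -> x <= 0 -> 0 <= y -> x < y -> y <= 1 ->
  hup y - hup x = q * (y - x) -> G <= q.
Proof.
move=> x1 x0 y0 xy y1 H; have yx : 0 < y - x by lra.
rewrite -(ler_pM2r yx) -H (hup_ge0E g)// /hup x0.
have [/andP[G0 G1] GE] := (G_itv g g1, Gg g g1).
have := powR_le_id g g1 (1 + x); have := powR_bernoulli g (1 - y) g1.
rewrite subr_ge0 => /(_ y1) /(ler_wpM2l (ltW G0)).
rewrite mulrDr mulrA GE => HA /(_ _) /(ler_wpM2l (ltW G0)) HB.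
have {}HB := HB ltac:(lra).
have : 0 <= (2^-1 - G) * y by apply: mulr_ge0 => //; lra.
lra.
Qed.

(** Price of one step on the damping factor when the sojourn time goes from [V] to [W <= V + e].
    Since [d <= e], the base on the left is at most [(V + e) / (N + d + V)]; Bernoulli at
    [V / (V + e)] then compares the powers. *)
Lemma powR_ratio k V W N d e : 1 < k -> 0 < V -> 0 < W -> 0 <= N ->
  0 < d <= e -> W <= V + e -> k * e < V ->
  (W / (N + W)) `^ k <= (V / (N + d + V)) `^ k / (1 - k * e / V).
Proof.
move=> k1 V0 W0 N0 /andP[d0 de] WV ke.
have [NW NV Ve] : [/\ 0 < N + W, 0 < N + d + V & 0 < V + e] by split; lra.
have k0 : 0 <= k by lra.
have e0 : 0 < 1 - k * e / V by rewrite subr_gt0 ltr_pdivrMr// mul1r.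
rewrite ler_pdivlMr//.
have H : W / (N + W) <= (V + e) / (N + d + V).
  rewrite ler_pdivrMr// mulrAC ler_pdivlMr//.
  have : 0 <= (V + e - W) * N by rewrite mulr_ge0// subr_ge0.
  have : 0 <= (e - d) * W by rewrite mulr_ge0 ?subr_ge0// ltW.
  lra.
have {}H := ge0_ler_powR k0 _ _ H.
have {}H : (W / (N + W)) `^ k <= ((V + e) / (N + d + V)) `^ k.
  by apply: H; rewrite nnegrE divr_ge0// ltW.
have {}H := ler_wpM2r (ltW e0) H; apply: le_trans H _.
have H := powR_bernoulli k (V / (V + e)) k1 (divr_ge0 (ltW V0) (ltW Ve)).
have -> : V / (N + d + V) = (V / (V + e)) * ((V + e) / (N + d + V)).
  by field; rewrite !gt_eqF.
rewrite [X in _ <= X]powRM ?divr_ge0 ?(ltW V0) ?(ltW Ve) ?(ltW NV)// [X in _ <= X]mulrC.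
apply: ler_wpM2l; first exact: powR_ge0.
apply: le_trans H; rewrite -subr_ge0.
have -> : 1 + k * (V / (V + e) - 1) - (1 - k * e / V) = k * e ^+ 2 / (V * (V + e)).
  by field; rewrite !gt_eqF.
by apply: divr_ge0; apply: mulr_ge0 => //; rewrite ?sqr_ge0// ltW.
Qed.

(* Here [N] is the time for which the pair has already travelled; distances that
   are still small because of a long sojourn are damped less. *)
Definition lyap a k M N x y :=
  (y - x) `^ a *
    ((M + sojourn x y) / (N + (M + sojourn x y))) `^ k.

Lemma lyapN a k M N x y : x < y -> lyap a k M N (- y) (- x) = lyap a k M N x y.
Proof. by move=> xy; rewrite /lyap sojournN// opprK addrC. Qed.

Lemma split_powR_le p q q' a r : 0 <= a -> p <= q' -> 0 <= p -> q' <= 1 ->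
  0 <= q <= r -> 0 <= 1 - q <= r ->
  p * q `^ a + (1 - q') * (1 - q) `^ a <= r `^ a.
Proof.
move=> a0 pq p0 q1 /andP[q0 qr] /andP[q0' qr'].
have H1 : q `^ a <= r `^ a by apply: ge0_ler_powR; rewrite ?nnegrE//; lra.
have H2 : (1 - q) `^ a <= r `^ a by apply: ge0_ler_powR; rewrite ?nnegrE//; lra.
have H3 := ler_wpM2l p0 H1.
have q'0 : 0 <= 1 - q' by lra.
have H4 := ler_wpM2l q'0 H2.
have : 0 <= (q' - p) * r `^ a by rewrite mulr_ge0 ?powR_ge0// subr_ge0.
lra.
Qed.

(** Reduces one step to a scalar inequality, the last hypothesis: distances scale by [q] and
    [1 - q], and [powR_ratio] handles the damping, with [e1] and [e2] bounding the growth of the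
    sojourn time along each branch. The gain is the shift of [N] by [d]. *)
Lemma lyap_step_slope a k M N x y d e1 e2 q : 1 < k -> 0 <= N -> 0 <= M ->
  -1 <= x -> x < y -> y <= 1 ->
  hup y - hup x = q * (y - x) -> hlow y - hlow x = (1 - q) * (y - x) ->
  0 <= q <= 1 -> 0 < d <= e1 -> 0 < d <= e2 ->
  sojourn (hup x) (hup y) <= sojourn x y + e1 ->
  sojourn (hlow x) (hlow y) <= sojourn x y + e2 ->
  k * e1 < M + sojourn x y -> k * e2 < M + sojourn x y ->
  wup x * (q `^ a / (1 - k * e1 / (M + sojourn x y)))
    + (1 - wup y) * ((1 - q) `^ a / (1 - k * e2 / (M + sojourn x y))) <= 1 ->
  wup x * lyap a k M N (hup x) (hup y)
    + (1 - wup y) * lyap a k M N (hlow x) (hlow y)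
  <= lyap a k M (N + d) x y.
Proof.
move=> k1 N0 M0 x1 xy y1 qu ql /andP[q0 q1] de1 de2 su sl ke1 ke2.
have yx : 0 < y - x by lra.
rewrite /lyap qu ql.
have q1' : 0 <= 1 - q by lra.
rewrite (powRM _ q0 (ltW yx)) (powRM _ q1' (ltW yx)).
have /andP[p0 _] : 0 <= wup x <= 1 by apply: wup_itv => //; lra.
have /andP[_ p1] : 0 <= wup y <= 1 by apply: wup_itv => //; lra.
have hx1 : -1 <= hup x by have := @hup_itv _ g g1 x; lra.
have hy1 : hup y <= 1 by have := @hup_itv _ g g1 y; lra.
have lx1 : -1 <= hlow x by have := @hlow_itv _ g g1 x; lra.
have ly1 : hlow y <= 1 by have := @hlow_itv _ g g1 y; lra.
have hxy : hup x < hup y by apply: hup_lt.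
have lxy : hlow x < hlow y.
  by rewrite !(hlowE g) ltrN2; apply: hup_lt => //; lra.
have [V1 V2 V3] : [/\ 1 <= sojourn x y, 1 <= sojourn (hup x) (hup y) &
    1 <= sojourn (hlow x) (hlow y)] by split; exact: sojourn_ge1.
move: su sl V1 V2 V3 ke1 ke2; set v := sojourn x y.
set v1 := sojourn (hup x) _; set v2 := sojourn (hlow x) _.
move=> su sl V1 V2 V3 ke1 ke2.
have MV : 0 < M + v by lra.
have MV1 : 0 < M + v1 by lra.
have MV2 : 0 < M + v2 by lra.
have MVe1 : M + v1 <= M + v + e1 by lra.
have MVe2 : M + v2 <= M + v + e2 by lra.
have H1 := powR_ratio k (M + v) (M + v1) N d e1 k1 MV MV1 N0 de1 MVe1 ke1.
have H2 := powR_ratio k (M + v) (M + v2) N d e2 k1 MV MV2 N0 de2 MVe2 ke2.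
move: H1 H2; set F := (_ / (N + d + _)) `^ k; set A := (_ / (N + _)) `^ k.
set B := (_ / (N + _)) `^ k; set i1 := 1 - k * e1 / _; set i2 := 1 - k * e2 / _.
move=> H1 H2 Hs.
set dl := (y - x) `^ a.
have d0 : 0 <= dl by exact: powR_ge0.
have p1' : 0 <= 1 - wup y by lra.
have {}H1 := ler_wpM2l (mulr_ge0 p0 (mulr_ge0 (powR_ge0 q a) d0)) H1.
have {}H2 := ler_wpM2l (mulr_ge0 p1' (mulr_ge0 (powR_ge0 (1 - q) a) d0)) H2.
have F0 : 0 <= F by exact: powR_ge0.
have {}Hs := ler_wpM2l (mulr_ge0 d0 F0) Hs.
rewrite mulr1 in Hs.
clear -H1 H2 Hs; lra.
Qed.

(** When both slopes are at most [r < 1], the factor [r^a] gained on distances pays for the damping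
    loss, at most [k e / M]. This is what the offset [M] in [lyap] is for. *)
Lemma lyap_step_far a k M N x y d e q r : 1 < k -> 0 < a -> 0 <= N -> 0 <= M ->
  -1 <= x -> x < y -> y <= 1 ->
  hup y - hup x = q * (y - x) -> hlow y - hlow x = (1 - q) * (y - x) ->
  wup x <= q <= wup y -> 0 <= q <= r -> 0 <= 1 - q <= r -> 0 < r < 1 ->
  0 < d <= e -> k * e <= M * (1 - r `^ a) ->
  sojourn (hup x) (hup y) <= sojourn x y + e ->
  sojourn (hlow x) (hlow y) <= sojourn x y + e ->
  wup x * lyap a k M N (hup x) (hup y)
    + (1 - wup y) * lyap a k M N (hlow x) (hlow y)
  <= lyap a k M (N + d) x y.
Proof.
move=> k1 a0 N0 M0 x1 xy y1 qu ql /andP[pq qp] q0r q1r /andP[r0 r1] de ke su sl.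
have v1 := @sojourn_ge1 x y x1 xy y1.
have ra : 0 < r `^ a by exact: powR_gt0.
have MV : 0 < M + sojourn x y by lra.
have ke' : k * e <= (M + sojourn x y) * (1 - r `^ a).
  apply: le_trans ke _; rewrite ler_wpM2r ?lerDl//; last by lra.
  rewrite subr_ge0; apply: powR_le1; lra.
have ke'' : k * e < M + sojourn x y.
  have : 0 < (M + sojourn x y) * r `^ a by rewrite mulr_gt0.
  lra.
have [q01 p0 p1] : [/\ 0 <= q <= 1, 0 <= wup x <= 1 & 0 <= wup y <= 1].
  by split; [lra|apply: wup_itv => //; lra|apply: wup_itv => //; lra].
apply: (lyap_step_slope a k M N x y d e e q) => //.
rewrite !mulrA -mulrDl; set i := 1 - _ / _.
have : k * e / (M + sojourn x y) <= 1 - r `^ a by rewrite ler_pdivrMr// [leRHS]mulrC.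
have -> : k * e / (M + sojourn x y) = 1 - i by rewrite /i subKr.
move=> i0.
rewrite ler_pdivrMr ?mul1r; last by lra.
have ri : r `^ a <= i by lra.
apply: le_trans ri; apply: split_powR_le; rewrite ?(ltW a0)//; lra.
Qed.

(** The upper branch hardly contracts here. The gain is its weight [1 - s / 2], which exceeds the
    damping loss [(2^-1 - c) s] by about [c s]; this surplus pays for the pairs that leave, whose
    distance to the power [a] shrinks by the factor [c]. *)
Lemma lyap_step_near a k M N x y c s0 e : 1 < k -> 0 < a -> 0 <= N ->
  0 < c < 2^-1 -> s0 <= 1 -> k * (2^-1 - G) <= (2^-1 - c) * (1 - s0 / 2) ->
  s0 `^ a <= c -> 2 * k * e <= M -> 2^-1 - G <= e -> (1 - G) `^ (- (g - 1)) <= e ->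
  0 <= x -> x < y -> y <= 1 -> (1 - x) `^ (g - 1) <= s0 ->
  wup x * lyap a k M N (hup x) (hup y)
    + (1 - wup y) * lyap a k M N (hlow x) (hlow y)
  <= lyap a k M (N + (2^-1 - G)) x y.
Proof.
move=> k1 a0 N0 /andP[c0 c1] s01 Hs0 Hs0a HM be ce x0 xy y1.
have x1 : x < 1 by lra.
have u0 : 0 < 1 - x by lra.
have := powR_gt0 (g - 1) u0.
have := sojourn_hup_growth x; rewrite x0 x1 => /(_ isT).
have /andP[G0 G1] := G_itv g g1.
have [q [qu ql pqp q01]] := hup_slope g g1 x y ltac:(lra) xy y1.
have v1 : 1 <= sojourn x y by apply: sojourn_ge1; lra.
have vE : sojourn x y = ((1 - x) `^ (g - 1))^-1 by rewrite /sojourn x0 powRN.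
have sv1 : sojourn (hup x) (hup y) = (1 - hup x) `^ (- (g - 1)).
  by rewrite /sojourn; have /andP[-> _] : 0 <= hup x <= 1 by apply: hup_itv => //; lra.
have sv2 : sojourn (hlow x) (hlow y) <= e.
  apply: le_trans ce; rewrite /sojourn.
  have /andP[l1 l2] := @hlow_nonneg_ge x ltac:(lra).
  have /andP[l3 l4] := @hlow_nonneg_ge y ltac:(lra).
  case: ifPn => [l0|_]; first by apply: powRN_le_G; lra.
  by rewrite l4; apply: powRN_le_G; lra.
have pE := wup_ge0E g x x0.
rewrite -sv1 (powRN (1 - x)) -vE; move: pE vE; set s := (1 - x) `^ (g - 1).
move=> pE vE Hv s_gt0 ss0.
have e0 : 0 < e by lra.
have ke0 : 0 < k * e by rewrite mulr_gt0//; lra.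
have M0 : 0 < M by lra.
have ds : 0 < 1 - s0 / 2 by lra.
set e1 := (2^-1 - G) / (1 - s0 / 2).
have ke1 : k * e1 <= 2^-1 - c by rewrite /e1 mulrA ler_pdivrMr.
have de1 : 0 < 2^-1 - G <= e1.
  by rewrite /e1 ler_pdivlMr// subr_gt0 G1/=; nra.
have se1 : (2^-1 - G) / (1 - s / 2) <= e1.
  rewrite /e1 ler_wpM2l ?lef_pV2 ?posrE//; lra.
clearbody e1 s.
have VM : s^-1 <= M + sojourn x y by rewrite vE lerDr ltW.
have V0 : 0 < M + sojourn x y by lra.
(* As [M + sojourn x y >= 1 / s], the absolute loss [k * e1] becomes proportional to [s]. *)
have k1e : k * e1 / (M + sojourn x y) <= (2^-1 - c) * s.
  rewrite ler_pdivrMr//; apply: le_trans ke1 _.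
  rewrite -mulrA ler_peMr//; first lra.
  by have := ler_wpM2l (ltW s_gt0) VM; rewrite mulfV ?gt_eqF.
have k2e : k * e / (M + sojourn x y) <= 2^-1.
  by rewrite ler_pdivrMr//; lra.
apply: (lyap_step_slope a k M N x y (2^-1 - G) e1 e q) => //; rewrite ?(ltW M0)//; try lra.
rewrite pE; move: k1e k2e; set i1 := _ / _; set i2 := k * e / _ => k1e k2e.
clearbody i1 i2.
clear sv1 sv2 Hv qu ql VM V0 ke1 de1 se1 ds M0 ke0 e0 v1 HM be ce Hs0 vE.
have [/andP[q0 q1] /andP[pq qp]] := (q01, pqp).
have qa : q `^ a <= 1 by apply: powR_le1; lra.
(* Pairs that stay: [(1 - c s) (1 - (2^-1 - c) s) >= 1 - s / 2]. *)
have T1 : (1 - 2^-1 * s) * (q `^ a / (1 - i1)) <= 1 - c * s.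
  rewrite mulrA ler_pdivrMr; last by nra.
  have : (1 - 2^-1 * s) * q `^ a <= 1 - 2^-1 * s by rewrite ler_piMr//; lra.
  have : 0 <= (1 - c * s) * ((2^-1 - c) * s - i1) by rewrite mulr_ge0//; nra.
  have : 0 <= c * s * ((2^-1 - c) * s) by rewrite !mulr_ge0//; lra.
  lra.
(* Pairs that leave: weight at most [s / 2], and a contraction [c] at most doubled by the damping
   loss. *)
have T2 : (1 - wup y) * ((1 - q) `^ a / (1 - i2)) <= c * s.
  have q1s : 1 - q <= s / 2 by lra.
  have H1 : (1 - q) `^ a <= c.
    apply: le_trans Hs0a; apply: ge0_ler_powR; rewrite ?nnegrE ?(ltW a0)//; lra.
  have H2 : (1 - q) `^ a / (1 - i2) <= 2 * c.
    by rewrite ler_pdivrMr; nra.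
  have py : 0 <= 1 - wup y.
    by have := @wup_itv _ g g1 y ltac:(lra); lra.
  have := ler_wpM2l py H2; nra.
lra.
Qed.

End lyapunov.

(** * One-step decrease of the Lyapunov function *)

Section lyapunov_step.
Context {R : realType} (g : R).
Hypothesis g1 : 1 < g.
Implicit Types (a k s x y u q r M N V W c d e l : R).

Local Notation G := ((2 * g)^-1).
Local Notation hup := (hup g).
Local Notation hlow := (hlow g).
Local Notation wup := (wup g).
Local Notation sojourn := (sojourn g).
Local Notation lyap := (lyap g).

(** [c] is half the margin in [k (2^-1 - G) < 2^-1]. The condition [s0 <= 4 c] spends the other half
    on the factor [1 - s0 / 2], and [s0 <= c^(1/a)] gives the contraction of leaving pairs. [M] is
    the sum of its two lower bounds. *)
Lemma lyap_constants a k : 1 < k -> k * (2^-1 - G) < 2^-1 -> 0 < a ->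
  exists c s0 e M : R,
  [/\ 0 < c < 2^-1, 0 < s0 <= 1, s0 `^ a <= c &
    k * (2^-1 - G) <= (2^-1 - c) * (1 - s0 / 2)] /\
  [/\ 1 <= e, (1 - G) `^ (- (g - 1)) <= e, 0 < M, 2 * k * e <= M &
    k * e <= M * (1 - (1 - G * s0) `^ a)].
Proof.
move=> k1 kb a0; have /andP[G0 G1] := G_itv g g1.
set b := 2^-1 - G in kb *; have b0 : 0 < b by rewrite subr_gt0.
have C0 : 0 <= (1 - G) `^ (- (g - 1)) by exact: powR_ge0.
pose c := (2^-1 - k * b) / 2.
have kb0 : 0 < k * b by rewrite mulr_gt0//; lra.
have [c0 c4] : 0 < c /\ c <= 4^-1 by rewrite /c; lra.
have kbE : k * b = 2^-1 - 2 * c by rewrite /c; lra.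
pose s0 := Num.min (4 * c) (c `^ a^-1).
have s00 : 0 < s0 by rewrite /s0 lt_min powR_gt0// andbT mulr_gt0.
have [s0c s0a] : s0 <= 4 * c /\ s0 <= c `^ a^-1.
  by rewrite /s0 !ge_min !lexx orbT.
clearbody s0 c b.
have s01 : s0 <= 1.
  by apply: le_trans s0a _; apply: powR_le1; rewrite ?invr_ge0 ?(ltW a0)//; lra.
have s0ac : s0 `^ a <= c.
  have : s0 `^ a <= (c `^ a^-1) `^ a.
    by apply: ge0_ler_powR; rewrite ?nnegrE ?powR_ge0 ?(ltW a0) ?(ltW s00).
  by rewrite -powRrM mulVf ?gt_eqF// powRr1// ltW.
have Gs0 : 0 < G * s0 <= G by rewrite mulr_gt0//= ler_piMr// ltW.
pose e := 1 + (1 - G) `^ (- (g - 1)).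
have [e1 e2] : 1 <= e /\ (1 - G) `^ (- (g - 1)) <= e by rewrite /e; lra.
have ra1 : (1 - G * s0) `^ a < 1.
  have := @gt0_ltr_powR _ a a0 (1 - G * s0) 1; rewrite !nnegrE powR1; apply => //; lra.
have ke : 0 < k * e by rewrite mulr_gt0//; lra.
have i0 : 0 < (1 - (1 - G * s0) `^ a)^-1 by rewrite invr_gt0 subr_gt0.
exists c, s0, e, (2 * k * e + k * e / (1 - (1 - G * s0) `^ a)).
have kei : 0 < k * e / (1 - (1 - G * s0) `^ a) by rewrite mulr_gt0.
split; split => //.
- by rewrite c0/=; lra.
- by rewrite s00.
- rewrite kbE; have : 0 <= c * s0 by rewrite mulr_ge0 ?ltW.
  lra.
- by rewrite addr_gt0// -mulrA mulr_gt0.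
- by rewrite lerDl ltW.
- rewrite mulrDl divfK ?gt_eqF ?subr_gt0// lerDr -mulrA mulr_ge0//; first lra.
  by rewrite mulr_ge0//; [lra|rewrite subr_ge0 ltW].
Qed.

Section with_constants.
Variables (a k c s0 e M : R).
Hypotheses (k1 : 1 < k) (a0 : 0 < a) (c01 : 0 < c < 2^-1) (s01 : 0 < s0 <= 1)
  (s0a : s0 `^ a <= c) (Hs0 : k * (2^-1 - G) <= (2^-1 - c) * (1 - s0 / 2))
  (e1 : 1 <= e) (Ce : (1 - G) `^ (- (g - 1)) <= e) (M0 : 0 < M)
  (M1 : 2 * k * e <= M) (M2 : k * e <= M * (1 - (1 - G * s0) `^ a)).

Let C1 x : 1 - G <= x -> x <= 1 -> x `^ (- (g - 1)) <= e.
Proof. by move=> xG x1; apply: le_trans Ce; apply: powRN_le_G. Qed.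

Let Gs0 : 0 < G * s0 <= G.
Proof.
have /andP[G0 _] := G_itv g g1; have /andP[s00 s1] := s01.
by rewrite mulr_gt0//= ler_piMr// ltW.
Qed.

Let be : 0 < 2^-1 - G <= e.
Proof. by have := G_itv g g1; move: e1; lra. Qed.

Let r01 : 0 < 1 - G * s0 < 1.
Proof. by have := G_itv g g1; move: Gs0; lra. Qed.

Let sojourn_hlow x y : -1 <= x -> x < y -> 0 <= y -> y <= 1 ->
  sojourn (hlow x) (hlow y) <= e.
Proof.
move=> x1 xy y0 y1; have y01 : 0 <= y <= 1 by rewrite y0.
have /andP[l1 l2] := @hlow_nonneg_ge _ g g1 y y01.
have l3 := @hlow_homo _ g g1 x y x1 (ltW xy) y1.
rewrite /sojourn l2; case: ifPn => [l0|_]; apply: C1.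
- by move: Gs0; lra.
- by lra.
- by lra.
- by lra.
Qed.

(** The threshold [s0] separates the two regimes: near the neutral point leaving is what helps,
    elsewhere both branches contract by [1 - G * s0]. *)
Let step_nonneg N x y : 0 <= N -> 0 <= x -> x < y -> y <= 1 ->
  wup x * lyap a k M N (hup x) (hup y)
    + (1 - wup y) * lyap a k M N (hlow x) (hlow y)
  <= lyap a k M (N + (2^-1 - G)) x y.
Proof.
move=> N0 x0 xy y1; have [ss0|ss0] := leP ((1 - x) `^ (g - 1)) s0.
  have /andP[_ s1] := s01; have /andP[_ be'] := be.
  exact: (lyap_step_near g g1 a k M N x y c s0 e).
have x1 : -1 <= x by apply: le_trans x0; rewrite lerN10.
have [q [qu ql pqp q01]] := hup_slope g g1 x y x1 xy y1.
have q1 := slope_nonneg g g1 x y q x0 xy y1 ql.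
have /andP[G0 G1] := G_itv g g1.
have Gs : G * s0 <= G * (1 - x) `^ (g - 1) by rewrite ler_pM2l// ltW.
have x01 : 0 <= x < 1 by rewrite x0 (lt_le_trans xy).
have x01' : 0 <= x <= 1 by case/andP: x01 => ? /ltW ->; rewrite x0.
have p2 : 2^-1 <= wup x by apply: wup_ge_half.
have V1 : 1 <= sojourn x y by apply: sojourn_ge1.
have y0 : 0 <= y by exact: le_trans x0 (ltW xy).
apply: (lyap_step_far g g1 a k M N x y _ e q (1 - G * s0)) => //.
- exact: ltW.
- by lra.
- by have := Gs0; lra.
- have := sojourn_hup_growth g g1 x x01.
  rewrite /sojourn x0; have /andP[-> _] : 0 <= hup x <= 1.
    by apply: hup_itv => //; lra.
  move/le_trans; apply; rewrite lerD2l.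
  have s1 : (1 - x) `^ (g - 1) <= 1.
    by apply: powR_le1; rewrite ?subr_ge0 ?(ltW g1)//; lra.
  apply: le_trans e1; rewrite ler_pdivrMr; lra.
- apply: (@le_trans _ _ e); first exact: sojourn_hlow.
  by rewrite lerDr (le_trans ler01 V1).
Qed.

Let step_sep N x y : 0 <= N -> -1 <= x -> x < 0 -> 0 < y -> y <= 1 ->
  wup x * lyap a k M N (hup x) (hup y)
    + (1 - wup y) * lyap a k M N (hlow x) (hlow y)
  <= lyap a k M (N + (2^-1 - G)) x y.
Proof.
move=> N0 x1 x0 y0 y1; have xy := lt_trans x0 y0.
have [q [qu ql pqp q01]] := hup_slope g g1 x y x1 xy y1.
have Gq := slope_sep g g1 x y q x1 (ltW x0) (ltW y0) xy y1 qu.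
have Gq' : G <= 1 - q.
  apply: (slope_sep g g1 (- y) (- x) (1 - q)); rewrite ?lerN2 ?ltrN2 ?oppr_ge0 ?oppr_le0 ?(ltW x0) ?(ltW y0)//.
    by rewrite lerNl.
  by rewrite opprK [- x + y]addrC -ql !(hlowE g) opprK addrC.
have v1 : sojourn x y = 1 by rewrite /sojourn !leNgt x0 y0.
apply: (lyap_step_far g g1 a k M N x y _ e q (1 - G * s0)); rewrite ?v1//.
- exact: ltW.
- by have := Gs0; lra.
- by have := Gs0; lra.
- have x10 : -1 <= x <= 0 by rewrite x1 ltW.
  have /andP[l1 l2] := @hup_nonpos_le _ g g1 x x10.
  rewrite /sojourn l1; apply: le_trans (_ : e <= _); last by rewrite lerDr.
  by apply: C1; lra.
- apply: (@le_trans _ _ e); first by apply: sojourn_hlow => //; exact: ltW.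
  by rewrite lerDr.
Qed.

Lemma lyap_step_with N x y : 0 <= N -> -1 <= x -> x < y -> y <= 1 ->
  wup x * lyap a k M N (hup x) (hup y)
    + (1 - wup y) * lyap a k M N (hlow x) (hlow y)
  <= lyap a k M (N + (2^-1 - G)) x y.
Proof.
move=> N0 x1 xy y1.
have [x0|x0] := leP 0 x; first exact: step_nonneg.
have [y0|y0] := leP y 0; last exact: step_sep.
(* The remaining case is the mirror image of the first: reflection exchanges the branches. *)
have := @step_nonneg N (- y) (- x) N0; rewrite oppr_ge0 ltrN2 lerNl => /(_ y0 xy x1).
have hupNE t : hup (- t) = - hlow t by rewrite (hlowE g) opprK.
rewrite (hupNE x) (hupNE y) (hlowN g x) (hlowN g y) (wupN g x) (wupN g y).
have hxy : hup x < hup y by apply: hup_lt.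
have lxy : hlow x < hlow y.
  by rewrite !(hlowE g) ltrN2; apply: hup_lt; rewrite ?ltrN2 ?lerN2// lerNl.
rewrite (lyapN g a k M (N + (2^-1 - G)) x y xy).
rewrite (lyapN g a k M N (hlow x) (hlow y) lxy).
rewrite (lyapN g a k M N (hup x) (hup y) hxy).
by rewrite (subKr 1 (wup x)) [X in X <= _ -> _]addrC.
Qed.

End with_constants.

Lemma lyap_step a k : 1 < k -> k * (2^-1 - G) < 2^-1 -> 0 < a ->
  exists2 M : R, 0 < M & forall N x y, 0 <= N -> -1 <= x -> x < y -> y <= 1 ->
  wup x * lyap a k M N (hup x) (hup y)
    + (1 - wup y) * lyap a k M N (hlow x) (hlow y)
  <= lyap a k M (N + (2^-1 - G)) x y.
Proof.
move=> k1 kb a0.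
have [c [s0 [e [M [[c01 s01 s0a Hs0] [e1 Ce M0 M1 M2]]]]]] := lyap_constants a k k1 kb a0.
by exists M => // N x y; exact: (lyap_step_with a k c s0 e M).
Qed.

End lyapunov_step.

(** * Size of the Lyapunov function after a given time *)

Section lyapunov_bounds.
Context {R : realType} (g : R).
Hypothesis g1 : 1 < g.
Implicit Types (a k s x y u q r M N V W c d e l : R).

Local Notation sojourn := (sojourn g).
Local Notation lyap := (lyap g).

Lemma lyap0 a k M x y : 0 <= M -> -1 <= x -> x < y -> y <= 1 ->
  lyap a k M 0 x y = (y - x) `^ a.
Proof.
move=> M0 x1 xy y1; rewrite /lyap add0r divff ?powR1 ?mulr1//.
by rewrite gt_eqF//; have := @sojourn_ge1 _ g g1 x y x1 xy y1; lra.
Qed.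

Lemma sojourn_sep x y : x <= 0 -> 0 <= y -> sojourn x y = 1.
Proof.
move=> x0 y0; rewrite /sojourn.
case: ifPn => [x0'|_]; first by rewrite (_ : x = 0) ?subr0 ?powR1//; lra.
by case: ifPn => // y0'; rewrite (_ : y = 0) ?addr0 ?powR1//; lra.
Qed.

Lemma lyap_sep a k M N x y : 0 <= a -> -1 <= x -> x <= 0 -> 0 <= y -> y <= 1 ->
  lyap a k M N x y <= 2 `^ a * ((M + 1) / (N + (M + 1))) `^ k.
Proof.
move=> a0 x1 x0 y0 y1; rewrite /lyap sojourn_sep//.
by rewrite ler_wpM2r ?powR_ge0// ge0_ler_powR ?nnegrE//; lra.
Qed.

(** [l] is, up to a constant factor, the distance from the neutral point at which the sojourn time
    equals [N]. The supremum of the bound is only of order [l^a], but the singularity of exponent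
    [a - 1] is integrable, so that in mean the bound is of order [l], the claimed rate. *)
Lemma lyap_le a k M N x y : 0 < a <= 1 -> (g - 1)^-1 <= k -> 0 < M -> 0 < N ->
  -1 <= x -> x < y -> y <= 1 ->
  forall l, l = ((M + 1) / N) `^ (g - 1)^-1 ->
  lyap a k M N x y <=
    2 * l * (1 + (1 - x + l) `^ (a - 1) + (1 + y + l) `^ (a - 1)).
Proof.
move=> /andP[a0 a1] gk M0 N0 x1 xy y1 l lE.
have g10 : 0 < g - 1 by rewrite subr_gt0.
have l0 : 0 < l by rewrite lE powR_gt0// divr_gt0//; lra.
have pos s t : 0 <= s -> s < t -> t <= 1 ->
    lyap a k M N s t <= 2 * l * (1 - s + l) `^ (a - 1).
  move=> s0 st t1; have u0 : 0 < 1 - s by lra.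
  rewrite /lyap /sojourn s0; set v := (1 - s) `^ _.
  have v1 : 1 <= v by apply: powRN_ge1; [lra|exact: ltW].
  set z := _ / _; have z0 : 0 < z by rewrite divr_gt0//; lra.
  have z1 : z <= 1 by rewrite ler_pdivrMr; lra.
  have zv : z <= (M + 1) / N * v.
    rewrite /z ler_pdivrMr; last by lra.
    have -> : (M + 1) / N * v * (N + (M + v)) = (M + 1) * v * (N + (M + v)) / N.
      by rewrite -!mulrA; congr (_ * _); rewrite mulrC -mulrA.
    rewrite ler_pdivlMr//.
    have : 0 <= M * (v - 1) * N by rewrite !mulr_ge0 ?subr_ge0// ltW.
    have : 0 <= (M + 1) * v * (M + v) by rewrite !mulr_ge0//; lra.
    lra.
  have zk : z `^ k <= z `^ (g - 1)^-1 by apply: ger_powR; rewrite ?z0.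
  set m := z `^ (g - 1)^-1 in zk.
  have m1 : m <= 1 by apply: powR_le1; rewrite ?invr_ge0 ?(ltW g10)// (ltW z0).
  (* Together with [m <= 1] this gives [m (1 - s + l) <= 2 l], from which one power of [1 - s + l]
     is traded for [l]. *)
  have ml : m * (1 - s) <= l.
    have : m <= l * (1 - s)^-1.
      have -> : (1 - s)^-1 = v `^ (g - 1)^-1.
        by rewrite /v -powRrM mulNr mulfV ?gt_eqF// powR_inv1// ltW.
      rewrite /m lE -powRM ?divr_ge0 ?powR_ge0//; [|lra..].
      by apply: ge0_ler_powR => //; rewrite ?nnegrE ?invr_ge0 ?(ltW g10) ?(ltW z0)// (le_trans (ltW z0) zv).
    by rewrite ler_pdivlMr.
  have U0 : 0 < 1 - s + l by lra.
  apply: (@le_trans _ _ ((1 - s + l) `^ a * m)).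
    apply: ler_pM; rewrite ?powR_ge0//.
    by apply: ge0_ler_powR; rewrite ?nnegrE ?(ltW a0)//; lra.
  rewrite -(@mulr_powRB1 _ (1 - s + l) a) ?(ltW U0)// mulrAC.
  apply: ler_wpM2r; first exact: powR_ge0.
  have := ler_wpM2r (ltW l0) m1; lra.
have o_ge0 := powR_ge0 (1 - x + l) (a - 1).
have o'_ge0 := powR_ge0 (1 + y + l) (a - 1).
have [x0|x0] := leP 0 x.
  apply: le_trans (pos _ _ x0 xy y1) _.
  by rewrite ler_wpM2l ?mulr_ge0// ?(ltW l0)//; lra.
have [y0|y0] := leP y 0.
  rewrite -lyapN//; apply: le_trans (pos (- y) (- x) _ _ _) _; try lra.
  by rewrite opprK ler_wpM2l ?mulr_ge0// ?(ltW l0)//; lra.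
apply: le_trans (lyap_sep _ _ _ _ _ _ (ltW a0) x1 (ltW x0) (ltW y0) y1) _.
apply: (@le_trans _ _ (2 * l)); last first.
  by rewrite ler_peMr ?mulr_ge0// ?(ltW l0)//; lra.
have M10 : 0 < M + 1 by lra.
apply: ler_pM; rewrite ?powR_ge0//.
  by apply: ler1_powR; lra.
set z := _ / _; have z0 : 0 < z by rewrite divr_gt0//; lra.
have z1 : z <= 1 by rewrite ler_pdivrMr; lra.
apply: (@le_trans _ _ (z `^ (g - 1)^-1)); first by apply: ger_powR; rewrite ?z0.
have zl : z <= (M + 1) / N.
  have H : (N + (M + 1))^-1 <= N^-1 by rewrite lef_pV2 ?posrE; lra.
  exact: (ler_wpM2l (ltW M10) H).
rewrite lE; apply: ge0_ler_powR => //; rewrite ?nnegrE ?invr_ge0 ?(ltW g10) ?(ltW z0)//.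
by rewrite (le_trans (ltW z0) zl).
Qed.

End lyapunov_bounds.

(** * Monotone coupling *)

Section coupling.
Context {R : realType} (g : R).
Hypothesis g1 : 1 < g.
Implicit Types (a k s x y c d e C : R) (f w : R -> R) (m n : nat).

Local Notation hup := (hup g).
Local Notation hlow := (hlow g).
Local Notation wup := (wup g).
Local Notation transfer := (transfer g).

(** The coupling as an identity: the three weights are the probabilities of the joint moves of the
    pair, nonnegative for [x <= y] and of sum 1. *)
Lemma transfer_diff f x y : transfer f y - transfer f x =
  wup x * (f (hup y) - f (hup x)) + (1 - wup y) * (f (hlow y) - f (hlow x))
  + (wup y - wup x) * (f (hup y) - f (hlow x)).
Proof. by rewrite /transfer; ring. Qed.

(* The points [x <= y] are coupled so that they take different branches with
   the least possible probability [wup y - wup x], and then stay ordered. *)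
Lemma transfer_coupling f A B :
  (forall x y, -1 <= x -> x <= y -> y <= 1 -> `|f y - f x| <= A x + B y) ->
  forall x y, -1 <= x -> x <= y -> y <= 1 ->
  `|transfer f y - transfer f x| <= transfer A x + transfer B y.
Proof.
move=> fAB x y x1 xy y1; rewrite transfer_diff.
have x11 : -1 <= x <= 1 by rewrite x1 (le_trans xy).
have y11 : -1 <= y <= 1 by rewrite y1 (le_trans x1).
have /andP[p0 _] := wup_itv g g1 x x11.
have /andP[_ p1] := wup_itv g g1 y y11.
have pp := wup_mono g g1 x y x1 xy y1.
have /andP[ux uy] := hup_itv g g1 x x11; have /andP[ux' uy'] := hup_itv g g1 y y11.
have /andP[lx ly] := hlow_itv g g1 x x11; have /andP[lx' ly'] := hlow_itv g g1 y y11.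
have uxy := hup_homo g g1 x y x1 xy y1.
have lxy := hlow_homo g g1 x y x1 xy y1.
have H1 : `|f (hup y) - f (hup x)| <= A (hup x) + B (hup y).
  by apply: fAB => //; exact: le_trans ux.
have H2 : `|f (hlow y) - f (hlow x)| <= A (hlow x) + B (hlow y).
  by apply: fAB => //; exact: le_trans ly' _.
have H3 : `|f (hup y) - f (hlow x)| <= A (hlow x) + B (hup y).
  by apply: fAB => //; exact: le_trans ly ux'.
have p1' : 0 <= 1 - wup y by rewrite subr_ge0.
have pp' : 0 <= wup y - wup x by rewrite subr_ge0.
apply: le_trans (ler_normD _ _) _.
apply: (@le_trans _ _ (wup x * (A (hup x) + B (hup y))
   + (1 - wup y) * (A (hlow x) + B (hlow y))
   + (wup y - wup x) * (A (hlow x) + B (hup y)))); last first.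
  by rewrite /transfer le_eqVlt; apply/orP; left; apply/eqP; ring.
apply: lerD; last by rewrite normrM (ger0_norm pp') ler_wpM2l.
apply: le_trans (ler_normD _ _) _.
apply: lerD; first by rewrite normrM (ger0_norm p0) ler_wpM2l.
by rewrite normrM (ger0_norm p1') ler_wpM2l.
Qed.

Lemma iter_transfer_coupling n f A B :
  (forall x y, -1 <= x -> x <= y -> y <= 1 -> `|f y - f x| <= A x + B y) ->
  forall x y, -1 <= x -> x <= y -> y <= 1 ->
  `|iter n transfer f y - iter n transfer f x|
    <= iter n transfer A x + iter n transfer B y.
Proof.
by move=> fAB; elim: n => // n IH x y; rewrite !iterS; exact: transfer_coupling.
Qed.

Lemma iter_transfer_lin n c d e f w x :
  iter n transfer (fun x => c + d * f x + e * w x) x =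
  c + d * iter n transfer f x + e * iter n transfer w x.
Proof.
elim: n x => // n IH x; rewrite !iterS /transfer !IH; ring.
Qed.

Lemma transfer_ge0 f : (forall x, -1 <= x <= 1 -> 0 <= f x) ->
  forall x, -1 <= x <= 1 -> 0 <= transfer f x.
Proof.
move=> f0 x x1; have /andP[p0 p1] := wup_itv g g1 x x1.
rewrite /transfer addr_ge0// mulr_ge0 ?subr_ge0 ?f0//.
  exact: hup_itvW.
exact: hlow_itvW.
Qed.

Lemma iter_transfer_ge0 n f : (forall x, -1 <= x <= 1 -> 0 <= f x) ->
  forall x, -1 <= x <= 1 -> 0 <= iter n transfer f x.
Proof. by move=> f0; elim: n => // n IH; exact: transfer_ge0. Qed.

Definition odd_homo f := (forall x, f (- x) = - f x) /\
  (forall x y, -1 <= x -> x <= y -> y <= 1 -> f x <= f y).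

(** Reflection exchanges the branches, and in [transfer_diff] all three increments of [f] are taken
    along ordered pairs. *)
Lemma transfer_odd_homo f : odd_homo f -> odd_homo (transfer f).
Proof.
move=> [fN fh]; split=> [x|x y x1 xy y1].
  rewrite /transfer (wupN g) (hlowN g).
  have -> : hup (- x) = - hlow x by rewrite (hlowE g) opprK.
  by rewrite !fN; ring.
have x11 : -1 <= x <= 1 by rewrite x1 (le_trans xy).
have y11 : -1 <= y <= 1 by rewrite y1 (le_trans x1).
have /andP[p0 _] := wup_itv g g1 x x11.
have /andP[_ p1] := wup_itv g g1 y y11.
have pp := wup_mono g g1 x y x1 xy y1.
have /andP[ux uy] := hup_itv g g1 x x11; have /andP[ux' uy'] := hup_itv g g1 y y11.
have /andP[lx ly] := hlow_itv g g1 x x11; have /andP[lx' ly'] := hlow_itv g g1 y y11.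
have uxy := hup_homo g g1 x y x1 xy y1.
have lxy := hlow_homo g g1 x y x1 xy y1.
rewrite -subr_ge0 transfer_diff !addr_ge0// mulr_ge0 ?subr_ge0//; apply: fh => //.
- exact: le_trans ux.
- exact: le_trans ly' _.
- exact: le_trans ly ux'.
Qed.

Lemma odd_homo_wup : odd_homo (fun x => wup x - 2^-1).
Proof.
split=> [x|x y x1 xy y1]; first by rewrite (wupN g); lra.
by rewrite lerD2r wup_mono.
Qed.

Lemma odd_homoD c f w : 0 <= c -> odd_homo f -> odd_homo w ->
  odd_homo (fun x => f x + c * w x).
Proof.
move=> c0 [fN fh] [wN wh]; split=> [x|x y x1 xy y1].
  by rewrite fN wN mulrN opprD.
by rewrite lerD ?ler_wpM2l ?fh ?wh.
Qed.

Section drift.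
Variable kap : nat -> R.
Hypothesis kap0 : forall m, 0 <= kap m.

(* Its increments dominate the contribution of the pairs that have taken
   different branches; [kap n] bounds what such a pair costs at step [n]. *)
Fixpoint drift m x :=
  if m is n.+1 then transfer (drift n) x + kap n * (wup x - 2^-1) else 0.

Lemma drift_odd_homo m : odd_homo (drift m).
Proof.
elim: m => [|m IH]; first by split=> [x|] //=; rewrite oppr0.
by apply: odd_homoD => //; [exact: transfer_odd_homo|exact: odd_homo_wup].
Qed.

(** Averaging does not increase the sup norm; the bound is uniform in [m] once [kap] is summable. *)
Lemma drift_le m x : -1 <= x <= 1 -> `|drift m x| <= \sum_(j < m) kap j.
Proof.
elim: m x => [|m IH] x x1 /=; first by rewrite big_ord0 normr0.
rewrite big_ord_recr/=; have /andP[p0 p1] := wup_itv g g1 x x1.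
have Hu := IH _ (hup_itvW g g1 x x1); have Hl := IH _ (hlow_itvW g g1 x x1).
have p1' : 0 <= 1 - wup x by rewrite subr_ge0.
apply: le_trans (ler_normD _ _) _; apply: lerD.
  rewrite /transfer; apply: le_trans (ler_normD _ _) _.
  rewrite !normrM (ger0_norm p0) (ger0_norm p1').
  have := ler_wpM2l p0 Hu; have := ler_wpM2l p1' Hl; lra.
rewrite normrM ger0_norm// ler_piMr//.
by rewrite ler_norml; lra.
Qed.

End drift.

End coupling.

(** * Modulus of continuity of the iterates *)

Section holder.
Context {R : realType} (g : R).
Hypothesis g1 : 1 < g.
Implicit Types (a k s x y c d e C M N b l : R) (f w : R -> R) (m n : nat).

Local Notation G := ((2 * g)^-1).
Local Notation hup := (hup g).
Local Notation hlow := (hlow g).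
Local Notation wup := (wup g).
Local Notation transfer := (transfer g).
Local Notation lyap := (lyap g).
Local Notation drift := (drift g).

(** Discrete integral comparison: [N^(-k)] against the increment of its primitive over a step
    [b]. *)
Lemma powRN_sub_le b k N : 1 < k -> 0 < b -> b < N ->
  (k - 1) * b * N `^ (- k) <= (N - b) `^ (- (k - 1)) - N `^ (- (k - 1)).
Proof.
move=> k1 b0 bN; have N0 : 0 < N by lra.
have k10 : 0 <= k - 1 by lra.
have z01 : 0 <= b / N < 1 by rewrite divr_ge0 ?ltr_pdivrMr ?mul1r ?(ltW b0) ?(ltW N0).
have H := powRN_ge1D (k - 1) (b / N) k10 z01.
have -> : N - b = N * (1 - b / N) by rewrite mulrBr mulr1 mulrCA mulfV ?gt_eqF// mulr1.
have z0 : 0 <= 1 - b / N by case/andP: z01 => _ ?; rewrite subr_ge0 ltW.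
rewrite (powRM _ (ltW N0) z0).
have -> : N `^ (- k) = N `^ (- (k - 1)) / N.
  rewrite (_ : - k = - (k - 1) - 1); last by ring.
  by rewrite (@powRB _ N (- (k - 1)) 1) ?(gt_eqF N0) ?implybT// powRr1// ltW.
have := ler_wpM2l (powR_ge0 N (- (k - 1))) H; lra.
Qed.

Lemma sum_powR_le A b k m : 1 < k -> 0 < b -> b < A ->
  \sum_(j < m) (A / (b * j%:R + A)) `^ k <=
  A `^ k / ((k - 1) * b) * (A - b) `^ (- (k - 1)).
Proof.
move=> k1 b0 bA; have A0 : 0 < A by lra.
have kb : 0 < (k - 1) * b by rewrite mulr_gt0// subr_gt0.
have K0 : 0 <= A `^ k / ((k - 1) * b) by rewrite divr_ge0 ?powR_ge0 ?ltW.
(* Keeping the remainder of the telescoping sum makes the induction go through. *)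
suff H : \sum_(j < m) (A / (b * j%:R + A)) `^ k <=
    A `^ k / ((k - 1) * b) *
    ((A - b) `^ (- (k - 1)) - (b * m%:R + A - b) `^ (- (k - 1))).
  apply: le_trans H _; rewrite ler_wpM2l// gerBl; exact: powR_ge0.
elim: m => [|m IH]; first by rewrite big_ord0 mulr0 add0r subrr mulr0.
rewrite big_ord_recr/=.
have m0 : 0 <= b * m%:R by rewrite mulr_ge0 ?ler0n// ltW.
set N := b * m%:R + A in IH *; have N0 : 0 < N by rewrite /N; lra.
have bN : b < N by rewrite /N; lra.
have -> : b * m.+1%:R + A - b = N by rewrite /N -natr1; ring.
have -> : (A / N) `^ k = A `^ k * N `^ (- k).
  by rewrite (powRM _ (ltW A0)) ?invr_ge0 ?(ltW N0)// -powR_inv1 ?(ltW N0)// -powRrM mulN1r.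
have H := powRN_sub_le b k N k1 b0 bN.
have {}H := ler_wpM2l K0 H.
have E : A `^ k / ((k - 1) * b) * ((k - 1) * b * N `^ (- k)) = A `^ k * N `^ (- k).
  by rewrite [X in _ * X]mulrC mulrCA mulrC divfK// gt_eqF.
rewrite E in H; lra.
Qed.

Section holder_step.
Variables (a k M C : R) (f : R -> R).
Hypotheses (a0 : 0 < a) (M0 : 0 < M) (C0 : 0 <= C).
Let b := 2^-1 - G.
Hypothesis step : forall N x y, 0 <= N -> -1 <= x -> x < y -> y <= 1 ->
  wup x * lyap a k M N (hup x) (hup y)
    + (1 - wup y) * lyap a k M N (hlow x) (hlow y) <= lyap a k M (N + b) x y.
Hypothesis f_holder : forall x y, -1 <= x -> x < y -> y <= 1 ->
  `|f y - f x| <= C * (y - x) `^ a.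

(** The bound of [lyap_sep] at time [b * m]: a pair that has just separated straddles 0, where the
    sojourn time is 1. *)
Definition split_weight m := 2 `^ a * ((M + 1) / (b * m%:R + (M + 1))) `^ k.

Lemma split_weight_ge0 m : 0 <= split_weight m.
Proof. by rewrite mulr_ge0 ?powR_ge0. Qed.

(** Induction through [transfer_diff]. The two common moves are covered by [step]. The separating
    move has weight [wup y - wup x] and costs at most [split_weight m], which is exactly what the
    last term of [drift] adds to its increment. *)
Lemma iter_transfer_lyap m x y : -1 <= x -> x < y -> y <= 1 ->
  `|iter m transfer f y - iter m transfer f x| <=
  C * (lyap a k M (b * m%:R) x y
       + (drift split_weight m y - drift split_weight m x)).
Proof.
elim: m x y => [|m IH] x y x1 xy y1.
  by rewrite /= mulr0 lyap0 ?(ltW M0)// subrr addr0 f_holder.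
have x11 : -1 <= x <= 1 by rewrite x1 (le_trans (ltW xy)).
have y11 : -1 <= y <= 1 by rewrite y1 (le_trans x1)// ltW.
have /andP[p0 _] := wup_itv g g1 x x11.
have /andP[_ p1] := wup_itv g g1 y y11.
have pp := wup_mono g g1 x y x1 (ltW xy) y1.
have /andP[ux uy] := hup_itv g g1 x x11; have /andP[ux' uy'] := hup_itv g g1 y y11.
have /andP[lx ly] := hlow_itv g g1 x x11; have /andP[lx' ly'] := hlow_itv g g1 y y11.
have uxy : hup x < hup y by apply: hup_lt.
have lxy : hlow x < hlow y.
  by rewrite !(hlowE g) ltrN2; apply: hup_lt; rewrite ?ltrN2 ?lerN2// lerNl.
have m0 : 0 <= b * m%:R.
  by rewrite mulr_ge0 ?ler0n// subr_ge0 ltW//; have /andP[] := G_itv g g1.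
have H1 := IH _ _ (le_trans (lerN10 _) ux) uxy uy'.
have H2 := IH _ _ lx lxy (le_trans ly' ler01).
have H3 := IH _ _ lx (lt_le_trans lxy (le_trans ly' ux')) uy'.
have L3 := lyap_sep g a k M (b * m%:R) (hlow x) (hup y) (ltW a0) lx ly ux' uy'.
have Hs := step (b * m%:R) x y m0 x1 xy y1.
have E : b * m.+1%:R = b * m%:R + b by rewrite -natr1 mulrDr mulr1.
rewrite E !iterS transfer_diff /=.
rewrite -/(split_weight m) in L3.
have -> : transfer (drift split_weight m) y + split_weight m * (wup y - 2^-1) -
    (transfer (drift split_weight m) x + split_weight m * (wup x - 2^-1)) =
  transfer (drift split_weight m) y - transfer (drift split_weight m) x
    + split_weight m * (wup y - wup x) by ring.
rewrite transfer_diff.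
move: H1 H2 H3 L3 Hs; set F1 := _ - iter m _ _ _; set F2 := _ - iter m _ _ _.
set F3 := _ - iter m _ _ _.
set D1 := drift _ m (hup y) - _; set D2 := drift _ m (hlow y) - _.
set D3 := drift _ m (hup y) - _.
set L1 := lyap _ _ _ _ _ _; set L2 := lyap _ _ _ _ _ _; set L3 := lyap _ _ _ _ _ _.
set L4 := lyap _ _ _ _ _ _; set P := wup x in p0 pp *; set Q := wup y in p1 pp *.
set S := split_weight m.
clearbody F1 F2 F3 D1 D2 D3 L1 L2 L3 L4 P Q S => H1 H2 H3 L3S Hs.
have Q1 : 0 <= 1 - Q by rewrite subr_ge0.
have PQ : 0 <= Q - P by rewrite subr_ge0.
have {}H3 : `|F3| <= C * (S + D3).
  by apply: le_trans H3 _; rewrite ler_wpM2l// lerD2r.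
have {}H1 := ler_wpM2l p0 H1; have {}H2 := ler_wpM2l Q1 H2.
have {}H3 := ler_wpM2l PQ H3.
have {}Hs := ler_wpM2l C0 Hs.
apply: (@le_trans _ _ (P * `|F1| + (1 - Q) * `|F2| + (Q - P) * `|F3|)).
  apply: le_trans (ler_normD _ _) _; apply: lerD.
    apply: le_trans (ler_normD _ _) _.
    by rewrite !normrM (ger0_norm p0) (ger0_norm Q1).
  by rewrite normrM (ger0_norm PQ).
lra.
Qed.

End holder_step.

Lemma measurable_hup : measurable_fun setT (hup : R -> R).
Proof.
apply: measurable_fun_ifT.
- exact: measurable_fun_ler.
- apply: measurable_funM => //.
  by apply: (measurableT_comp (measurable_powR _)); exact: measurable_funD.
- apply: measurable_funD => //; apply: measurable_funM => //.
  by apply: (measurableT_comp (measurable_powR _)); exact: measurable_funB.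
Qed.

Lemma measurable_hlow : measurable_fun setT (hlow : R -> R).
Proof. by apply: measurable_funB => //; exact: measurable_hup. Qed.

Lemma measurable_wup : measurable_fun setT (wup : R -> R).
Proof.
apply: measurable_fun_ifT.
- exact: measurable_fun_ler.
- apply: measurable_funM => //.
  by apply: (measurableT_comp (measurable_powR _)); exact: measurable_funD.
- apply: measurable_funB => //; apply: measurable_funM => //.
  by apply: (measurableT_comp (measurable_powR _)); exact: measurable_funB.
Qed.

Lemma measurable_transfer f : measurable_fun setT f -> measurable_fun setT (transfer f).
Proof.
move=> mf; apply: measurable_funD; apply: measurable_funM.
- exact: measurable_wup.
- by apply: measurableT_comp => //; exact: measurable_hup.
- by apply: measurable_funB => //; exact: measurable_wup.
- by apply: measurableT_comp => //; exact: measurable_hlow.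
Qed.

Lemma measurable_iter_transfer n f :
  measurable_fun setT f -> measurable_fun setT (iter n transfer f).
Proof. by move=> mf; elim: n => // n; exact: measurable_transfer. Qed.

Lemma measurable_drift (kap : nat -> R) m : measurable_fun setT (drift kap m).
Proof.
elim: m => [|m IH]; first exact: measurable_cst.
apply: measurable_funD; first exact: measurable_transfer.
by apply: measurable_funM => //; apply: measurable_funB => //; exact: measurable_wup.
Qed.

(* The last condition reads [k < g / (g - 1)]. *)
Lemma lyap_exponent : exists k : R,
  [/\ 1 < k, (g - 1)^-1 <= k & k * (2^-1 - G) < 2^-1].
Proof.
have g0 : 0 < g by move: g1; lra.
have a0 : 0 < g - 1 by rewrite subr_gt0.
(* Since [g / (g - 1) = (g - 1)^-1 + 1], an increment below 1 meets the upper bound; [(g - 1) / g]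
   also pushes the sum above 1 for every [g > 1]. *)
exists ((g - 1)^-1 + (g - 1) / g); split.
- have -> : (g - 1)^-1 + (g - 1) / g = 1 + 1 / ((g - 1) * g).
    by field; rewrite !gt_eqF.
  by rewrite ltrDl divr_gt0// mulr_gt0.
- by rewrite lerDl divr_ge0// ltW.
- have -> : ((g - 1)^-1 + (g - 1) / g) * (2^-1 - G) = 2^-1 - 2^-1 * (g - 1) / (g * g).
    by field; rewrite !gt_eqF.
  by rewrite ltrBlDr ltrDl divr_gt0 ?mulr_gt0.
Qed.

(** The bound is split into a part of order [l], singular at the neutral point, and the increments
    of [w]. The latter are merely bounded, but oddness and monotonicity make further iterates of [w]
    decay in mean. *)
Lemma holder_modulus a C f : 0 < a <= 1 -> 0 <= C ->
  (forall x y, -1 <= x -> x < y -> y <= 1 -> `|f y - f x| <= C * (y - x) `^ a) ->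
  exists A K : R, [/\ 0 < A, 0 <= K & forall m l, (0 < m)%N ->
    l = (A / m%:R) `^ (g - 1)^-1 -> exists w,
    [/\ odd_homo w, measurable_fun setT w,
      forall x, -1 <= x <= 1 -> `|w x| <= K
    & forall x y, -1 <= x -> x <= y -> y <= 1 ->
      `|iter m transfer f y - iter m transfer f x| <=
      K * l * (1 + (1 - x + l) `^ (a - 1) + (1 + y + l) `^ (a - 1)) + (w y - w x)]].
Proof.
move=> a01 C0 fC; have /andP[a0 _] := a01.
have [k [k1 gk kG]] := lyap_exponent.
have [M M0 step] := lyap_step g g1 a k k1 kG a0.
have /andP[G0 G1] := G_itv g g1.
have b0 : 0 < 2^-1 - G by rewrite subr_gt0.
have bA : 2^-1 - G < M + 1 by lra.
have Mb : 0 < (M + 1) / (2^-1 - G) by rewrite divr_gt0//; lra.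
pose S := (M + 1) `^ k / ((k - 1) * (2^-1 - G)) * (M + 1 - (2^-1 - G)) `^ (- (k - 1)).
have S0 : 0 <= S.
  by rewrite /S !mulr_ge0 ?powR_ge0 ?invr_ge0 ?mulr_ge0 ?subr_ge0 ?(ltW k1) ?(ltW G1).
have aS0 : 0 <= C * (2 `^ a * S) by exact: mulr_ge0 C0 (mulr_ge0 (powR_ge0 _ _) S0).
(* The first constant makes [A / m] equal to [(M + 1) / N] at the time [N = (2^-1 - G) m]. *)
exists ((M + 1) / (2^-1 - G)), (2 * C + C * (2 `^ a * S)); split => //.
  by rewrite addr_ge0// mulr_ge0.
move=> m l m0 lE.
exists (fun x => 0 + C * drift (split_weight a k M) m x); split.
- have od := drift_odd_homo g g1 _ (split_weight_ge0 a k M) m.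
  apply: odd_homoD => //; split=> [x|x y _ _ _] //=.
  by rewrite oppr0.
- apply: measurable_funD => //; apply: measurable_funM => //.
  exact: measurable_drift.
- move=> x x1; rewrite add0r normrM (ger0_norm C0).
  have H := drift_le g g1 _ (split_weight_ge0 a k M) m x x1.
  have HS : \sum_(j < m) split_weight a k M j <= 2 `^ a * S.
    rewrite -mulr_sumr ler_wpM2l ?powR_ge0//.
    exact: sum_powR_le.
  have := ler_wpM2l C0 (le_trans H HS); lra.
- move=> x y x1; rewrite le_eqVlt => /predU1P[<- y1|xy y1].
    rewrite !subrr normr0 addr0; apply: mulr_ge0; last first.
      by rewrite !addr_ge0 ?powR_ge0.
    apply: mulr_ge0; last by rewrite lE powR_ge0.
    by apply: addr_ge0 => //; exact: mulr_ge0.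
  apply: le_trans (iter_transfer_lyap a k M C f a0 M0 C0 step fC m x y x1 xy y1) _.
  have m0' : 0 < m%:R :> R by rewrite ltr0n.
  have lE' : l = ((M + 1) / ((2^-1 - G) * m%:R)) `^ (g - 1)^-1.
    by rewrite lE -mulrA -(invfM (2^-1 - G)).
  have Hl := lyap_le g g1 a k M ((2^-1 - G) * m%:R) x y a01 gk M0
    (mulr_gt0 b0 m0') x1 xy y1 l lE'.
  have l0 : 0 <= l by rewrite lE powR_ge0.
  move: Hl; set O := 1 + _ + _.
  have O0 : 0 <= O by rewrite /O !addr_ge0 ?powR_ge0.
  set L := lyap _ _ _ _ _ _; set D1 := drift _ _ y; set D2 := drift _ _ x.
  clearbody O L D1 D2 => /(ler_wpM2l C0).
  have : 0 <= C * (2 `^ a * S) * (l * O) by rewrite mulr_ge0// mulr_ge0.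
  lra.
Qed.

End holder.

(** * Invariance of Lebesgue measure *)

Section real_integrals.
Context {R : realType}.
Implicit Types (a b c d p x y : R) (f h : R -> R).
Local Notation mu := (@lebesgue_measure R).

Lemma bounded_integrable_itv f a b c : measurable_fun setT f ->
  (forall x, a <= x <= b -> `|f x| <= c) -> mu.-integrable `[a, b] (EFin \o f).
Proof.
move=> mf fc; apply: measurable_bounded_integrable => //.
- by rewrite /= lebesgue_measure_itv/=; case: ifP => // _; rewrite -EFinB ltry.
- exact: measurable_funTS.
- exists c; split; first exact: num_real.
  move=> e ce x /=; rewrite in_itv/= => /fc fxc.
  by apply: le_trans fxc _; exact: ltW.
Qed.

Lemma le_expn2_eq0 c d : (forall n, `|d| <= c / 2 ^+ n) -> d = 0.
Proof.
move=> H; apply/eqP; rewrite -normr_le0.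
apply/ler_addgt0Pl => e e0; rewrite addr0.
set n := Num.truncn (c / e).
apply: le_trans (H n.+1) _; rewrite ler_pdivrMr ?exprn_gt0//.
have : c / e < n.+1%:R by exact: truncnS_gt.
rewrite ltr_pdivrMr// => /ltW/le_trans; apply.
rewrite mulrC ler_pM2l// -natrX ler_nat.
exact: ltnW (ltn_expl _ _).
Qed.

(** Fundamental theorem of calculus for a monotone slope. On each interval the integral and the
    increment of [h] both lie between [f x (y - x)] and [f y (y - x)], and bisection halves the
    total gap. *)
Lemma Rintegral_slope f h a b :
  measurable_fun setT f -> a <= b ->
  (forall x y, a <= x -> x <= y -> y <= b -> f x <= f y) ->
  (forall x y, a <= x -> x <= y -> y <= b ->
    f x * (y - x) <= h y - h x <= f y * (y - x)) ->
  \int[mu]_(t in `[a, b]) f t = h b - h a.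
Proof.
move=> mf ab fh hf.
pose I x y := \int[mu]_(t in `[x, y]) f t.
have fint x y : a <= x -> x <= y -> y <= b -> mu.-integrable `[x, y] (EFin \o f).
  move=> ax xy yb; apply: (@bounded_integrable_itv _ _ _ (`|f a| + `|f b|)) => //.
  move=> t /andP[xt ty]; have := fh a t (lexx _); have := fh t b _ _ (lexx _).
  move=> /(_ (le_trans ax xt) (le_trans ty yb)) H1.
  move=> /(_ (le_trans ax xt) (le_trans ty yb)) H2.
  have := ler_norm (f b); have := ler_norm (- f a); rewrite normrN.
  have := normr_ge0 (f a); have := normr_ge0 (f b).
  by rewrite ler_norml; lra.
have cint x y c : mu.-integrable `[x, y] (EFin \o cst c).
  by apply: (@bounded_integrable_itv _ _ _ `|c|).
have muE x y : x <= y -> fine (mu `[x, y]) = y - x.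
  rewrite le_eqVlt => /predU1P[->|xy].
    by rewrite lebesgue_measure_itv/= lte_fin ltxx subrr.
  by rewrite lebesgue_measure_itv/= lte_fin xy.
have IU x m y : a <= x -> x <= m -> m <= y -> y <= b -> I x y = I x m + I m y.
  move=> ax xm my yb; rewrite /I.
  have := @Rintegral_itvB _ f (BLeft x) (BRight y) m (fint x y ax (le_trans xm my) yb).
  rewrite !bnd_simp => /(_ xm my).
  rewrite Rintegral_itv_obnd_cbnd; first by move=> <-; rewrite addrC subrK.
  apply: integrableS (fint m y (le_trans ax xm) my yb) => //.
  by apply: subset_itvr; rewrite bnd_simp.
have Ib x y : a <= x -> x <= y -> y <= b -> f x * (y - x) <= I x y <= f y * (y - x).
  move=> ax xy yb; rewrite -(muE x y xy) -!Rintegral_cst//.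
  apply/andP; split; apply: le_Rintegral => //.
  - exact: cint.
  - exact: fint.
  - move=> t /=; rewrite in_itv/= => /andP[xt ty].
    by apply: fh => //; exact: le_trans ty yb.
  - exact: fint.
  - exact: cint.
  - move=> t /=; rewrite in_itv/= => /andP[xt ty].
    by apply: fh => //; exact: le_trans ax xt.
have E n x y : a <= x -> x <= y -> y <= b ->
    `|I x y - (h y - h x)| <= (f y - f x) * (y - x) / 2 ^+ n.
  elim: n x y => [|n IH] x y ax xy yb.
    rewrite expr0 divr1; have := Ib x y ax xy yb; have := hf x y ax xy yb.
    by rewrite ler_norml; lra.
  pose m := (x + y) / 2.
  have [xm my] : x <= m /\ m <= y by rewrite /m; lra.
  have H1 := IH x m ax xm (le_trans my yb).
  have H2 := IH m y (le_trans ax xm) my yb.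
  have -> : I x y - (h y - h x) = I x m - (h m - h x) + (I m y - (h y - h m)).
    by rewrite (IU x m y)//; ring.
  apply: le_trans (ler_normD _ _) _; apply: le_trans (lerD H1 H2) _.
  rewrite exprS invfM -!mulrDl !mulrA ler_pM2r ?invr_gt0 ?exprn_gt0//.
  by rewrite /m; lra.
apply/eqP; rewrite -subr_eq0; apply/eqP.
by apply: le_expn2_eq0 => n; exact: E n a b (lexx _) ab (lexx _).
Qed.

End real_integrals.

Section invariance.
Context {R : realType} (g : R).
Hypothesis g1 : 1 < g.
Implicit Types (s t x y : R) (f : R -> R).
Local Open Scope ereal_scope.

Local Notation mu := (@lebesgue_measure R).
Local Notation hup := (hup g).
Local Notation hlow := (hlow g).
Local Notation wup := (wup g).
Local Notation transfer := (transfer g).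

(* Choosing the branch of [t] by comparing [wup t] with a uniform [s] makes
   [transfer] the conditional expectation of a single map. *)
Let baker (z : R * R) : measurableTypeR R := if (z.2 < wup z.1)%R then hup z.1 else hlow z.1.

Let measurable_baker : measurable_fun setT baker.
Proof.
apply: measurable_fun_ifT.
- apply: measurable_fun_ltr => //.
  by apply: measurableT_comp => //; exact: measurable_wup.
- by apply: measurableT_comp => //; exact: measurable_hup.
- by apply: measurableT_comp => //; exact: measurable_hlow.
Qed.

Let N11 : (-1 < 1 :> R)%R. Proof. lra. Qed.
Let U := uniform_prob N11.
Let V := uniform_prob (@ltr01 R).

Lemma integral_step (p : R) (u l : \bar R) : (0 <= p <= 1)%R -> 0 <= u -> 0 <= l ->
  \int[mu]_(s in `[0%R, 1%R]) (if (s < p)%R then u else l) = p%:E * u + (1 - p)%:E * l.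
Proof.
move=> /andP[p0 p1] u0 l0.
have -> : `[0%R, 1%R]%classic = `[0%R, p[ `|` `[p, 1%R] :> set R.
  by apply: itv_bndbnd_setU; rewrite bnd_simp.
rewrite ge0_integral_setU//=.
- congr (_ + _).
  + rewrite (eq_integral (cst u)); last first.
      by move=> s; rewrite inE/= in_itv/= => /andP[_ ->].
    rewrite integral_cst//= lebesgue_measure_itv/= lte_fin.
    case: ifPn => [_|]; first by rewrite oppr0 addr0 muleC.
    rewrite -leNgt => p0'; have -> : p = 0%R by apply/eqP; rewrite eq_le p0 p0'.
    by rewrite mul0e mule0.
  + rewrite (eq_integral (cst l)); last first.
      by move=> s; rewrite inE/= in_itv/= ltNge => /andP[-> _].
    rewrite integral_cst//= lebesgue_measure_itv/= lte_fin.
    case: ifPn => [_|]; first by rewrite muleC.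
    rewrite -leNgt => p1'; have -> : p = 1%R by apply/eqP; rewrite eq_le p1 p1'.
    by rewrite subrr mul0e mule0.
- by apply: measurable_funTS; apply: measurable_fun_ifT => //; exact: measurable_fun_ltr.
- by move=> s _; case: ifP.
- apply/disj_setPS => s [] /=; rewrite !in_itv/= => /andP[_ sp] /andP[ps _].
  by move: sp; rewrite ltNge ps.
Qed.

(** The law of [baker] under the product of two uniform laws; invariance will say that it is again
    uniform on [[-1, 1]]. *)
Let nu : {measure set (measurableTypeR R) -> \bar R}.
Proof.
refine [the {measure set _ -> \bar R} of pushforward (U \x V) baker].
exact: measurable_baker.
Defined.

Let integral_baker f : measurable_fun setT f -> (forall x, 0 <= f x)%R ->
  \int[nu]_x (f x)%:E =
  2^-1%:E * \int[mu]_(x in `[(-1)%R, 1%R]) (transfer f x)%:E.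
Proof.
move=> mf f0.
transitivity (\int[pushforward (U \x V) baker]_x (f x)%:E); first by [].
rewrite ge0_integral_pushforward//=; last 2 first.
  exact/measurable_EFinP.
  by move=> x _; rewrite lee_fin.
rewrite preimage_setT fubini_tonelli1//=; last 2 first.
  by apply/measurable_EFinP; exact: measurableT_comp.
  by move=> x; rewrite lee_fin.
rewrite integral_uniform//=; last 2 first.
  apply: measurable_fun_fubini_tonelli_F => //=; last by move=> x; rewrite lee_fin.
  by apply/measurable_EFinP; exact: measurableT_comp.
  by move=> x; apply: integral_ge0 => s _; rewrite lee_fin.
rewrite opprK; congr (_ * _); apply: eq_integral => x.
rewrite inE/= in_itv/= => x1; have p01 := wup_itv g g1 x x1.
rewrite /fubini_F integral_uniform//=; last 2 first.
  apply/measurable_EFinP; apply: measurableT_comp => //.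
  exact: (measurableT_comp measurable_baker).
  by move=> s; rewrite lee_fin.
rewrite subr0 invr1 mul1e.
transitivity (\int[mu]_(s in `[0%R, 1%R])
    (if (s < wup x)%R then (f (hup x))%:E else (f (hlow x))%:E)).
  by apply: eq_integral => s _; rewrite /baker/=; case: ifP.
by rewrite integral_step ?lee_fin.
Qed.

(** The existence of a circle map already contains a solution of the branch equations at [y]. *)
Lemma hup_surj y : (0 <= y <= 1)%R -> exists2 s, (-1 <= s <= 1)%R & hup s = y.
Proof.
move=> /andP[y0 y1]; have [T [[Tl Tu _] _]] := circle_map_exists_unique g1.
have [yG|Gy] := leP y (2 * g)^-1%R.
  have [|t [/andP[t1 t0] _ ->]] := Tl y; first by rewrite y0.
  by exists t; rewrite ?t1 ?(le_trans t0)// /hup t0.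
have [|t [/andP[t1 t0] _ ->]] := Tu y; first by rewrite (ltW Gy).
by exists t; rewrite ?t0 ?andbT ?(le_trans _ t1)// hup_ge0E.
Qed.

Lemma hlow_surj y : (-1 <= y <= 0)%R -> exists2 s, (-1 <= s <= 1)%R & hlow s = y.
Proof.
move=> /andP[y1 y0]; have [|s s1 sy] := @hup_surj (- y).
  by rewrite oppr_ge0 y0 lerNl.
exists (- s)%R; last by rewrite (hlowN g) sy opprK.
by move/andP: s1 => [? ?]; rewrite lerN2 lerNl; apply/andP.
Qed.

Lemma Rintegral_wup s : (-1 <= s <= 1)%R ->
  (\int[mu]_(t in `[(-1)%R, s]) wup t)%R = hup s.
Proof.
move=> /andP[s1 s2]; rewrite (@Rintegral_slope _ wup hup)//.
- by rewrite (hupN1 g g1) subr0.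
- exact: measurable_wup.
- by move=> x y x1 xy ys; apply: wup_mono => //; exact: le_trans s2.
- by move=> x y x1 xy ys; apply: hup_tangent => //; exact: le_trans s2.
Qed.

Let int_wup s : (-1 <= s <= 1)%R -> mu.-integrable `[(-1)%R, s] (EFin \o wup).
Proof.
move=> /andP[s1 s2]; apply: (@bounded_integrable_itv _ _ _ _ 1).
  exact: measurable_wup.
move=> x /andP[x1 xs]; have /andP[p0 p1] : (0 <= wup x <= 1)%R.
  by apply: wup_itv => //; rewrite x1 (le_trans xs).
by rewrite ger0_norm.
Qed.

Lemma integral_wup s : (-1 <= s <= 1)%R ->
  \int[mu]_(t in `[(-1)%R, s]) (wup t)%:E = (hup s)%:E.
Proof.
move=> s1; rewrite -Rintegral_wup// /Rintegral fineK//.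
by apply: integrable_fin_num => //; exact: int_wup.
Qed.

Lemma integral_onem_wup s : (-1 <= s <= 1)%R ->
  \int[mu]_(t in `[(-1)%R, s]) (1 - wup t)%:E = (1 + hlow s)%:E.
Proof.
move=> s1; have /andP[s1' _] := s1.
transitivity (\int[mu]_(t in `[(-1)%R, s]) ((cst 1%R t)%:E - (wup t)%:E)).
  by apply: eq_integral => t _; rewrite EFinB.
rewrite integralB//=; [|exact: (@bounded_integrable_itv _ (cst 1%R) _ _ `|1|%R)|exact: int_wup].
rewrite integral_wup// integral_cst//= lebesgue_measure_itv/= lte_fin.
move: s1'; rewrite le_eqVlt => /predU1P[<-|s1'].
  by rewrite ltxx mule0 add0e /hlow (hupN1 g g1) oppr0 addr0 subrr.
by rewrite s1' mul1e -!EFinD; congr EFin; rewrite /hlow; ring.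
Qed.

Let integral_cut (F : R -> \bar R) s : (-1 <= s <= 1)%R -> measurable_fun setT F ->
  \int[mu]_(x in `[(-1)%R, 1%R]) (if (x < s)%R then F x else 0) =
  \int[mu]_(x in `[(-1)%R, s]) F x.
Proof.
move=> /andP[s1 s2] mF; rewrite -(@integral_itv_bndo_bndc _ (BLeft (-1)%R) s F); last exact: measurable_funTS.
have -> : `[(-1)%R, s[%classic = `[(-1)%R, 1%R] `&` `]-oo, s[ :> set R.
  apply/seteqP; split=> x /=; rewrite !in_itv/=; first last.
    by move=> [/andP[-> _] ->].
  by move=> /andP[-> xs]; rewrite xs (ltW (lt_le_trans xs s2)).
rewrite integral_mkcondr; apply: eq_integral => x _.
rewrite patchE; case: ifPn => xs.
  by rewrite mem_set//= in_itv/=.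
by rewrite memNset//= in_itv/=; exact/negP.
Qed.

Let indic_cut s x : \1_(`]-oo, s[%classic : set R) x = (if (x < s)%R then 1%R else 0%R) :> R.
Proof.
rewrite indicE; case: ifPn => xs; first by rewrite mem_set//= in_itv/=.
by rewrite memNset//= in_itv/=; exact/negP.
Qed.

Let transfer_indic_cut s x : transfer \1_(`]-oo, s[%classic : set R) x =
  (wup x * (if (hup x < s)%R then 1 else 0)
   + (1 - wup x) * (if (hlow x < s)%R then 1 else 0))%R.
Proof. by rewrite /transfer !indic_cut. Qed.

Let measurable_wupE : measurable_fun setT (fun x => (wup x)%:E).
Proof. by apply/measurable_EFinP; exact: measurable_wup. Qed.

Let measurable_onem_wupE : measurable_fun setT (fun x => (1 - wup x)%:E).
Proof.
by apply/measurable_EFinP; apply: measurable_funB => //; exact: measurable_wup.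
Qed.

Let hup_ltE s x : (-1 <= s <= 1)%R -> (-1 <= x <= 1)%R -> (hup x < hup s)%R = (x < s)%R.
Proof.
move=> /andP[s1 s2] /andP[x1 x2]; have [xs|sx] := ltP x s; first exact: hup_lt.
by apply/negbTE; rewrite -leNgt; exact: hup_homo.
Qed.

Let hlow_ltE s x : (-1 <= s <= 1)%R -> (-1 <= x <= 1)%R -> (hlow x < hlow s)%R = (x < s)%R.
Proof.
move=> s1 x1; rewrite !(hlowE g) ltrN2 hup_ltE ?ltrN2//.
- by move: x1 => /andP[? ?]; rewrite lerN2 lerNl; apply/andP.
- by move: s1 => /andP[? ?]; rewrite lerN2 lerNl; apply/andP.
Qed.

(** Invariance on half-lines. For [y] in []-1, 0]] only the lower branch gets below [y], up to the
    point [s] with [hlow s = y]. For [y] in []0, 1]] the lower branch is always below [y], and the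
    upper one is up to [hup s = y]. The integrals of the weights are the branches themselves. *)
Let integral_transfer_cut y :
  \int[mu]_(x in `[(-1)%R, 1%R]) (transfer \1_(`]-oo, y[%classic : set R) x)%:E =
  \int[mu]_(x in `[(-1)%R, 1%R]) (\1_(`]-oo, y[%classic : set R) x)%:E.
Proof.
have one1 : (-1 <= (1 : R) <= 1)%R by rewrite lexx andbT; lra.
have cutE : (-1 <= y <= 1)%R ->
    \int[mu]_(x in `[(-1)%R, 1%R]) (\1_(`]-oo, y[%classic : set R) x)%:E = (y + 1)%:E.
  move=> y1; transitivity (\int[mu]_(x in `[(-1)%R, 1%R]) (if (x < y)%R then cst 1 x else 0)).
    by apply: eq_integral => x _; rewrite indic_cut; case: ifP.
  rewrite integral_cut// integral_cst//= mul1e lebesgue_measure_itv/= lte_fin.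
  have /andP[] := y1; rewrite le_eqVlt => /predU1P[<- _|-> _].
    by rewrite ltxx addNr.
  by rewrite -EFinD opprK.
have [y1|y1] := leP y (-1)%R.
  apply: eq_integral => x; rewrite inE/= in_itv/= => x1.
  rewrite transfer_indic_cut indic_cut.
  have := @hup_itv _ g g1 x x1; have := @hlow_itv _ g g1 x x1 => /andP[l1 l2] /andP[u1 u2].
  rewrite !ifF ?mulr0 ?addr0//; apply/negbTE; rewrite -leNgt.
  - by apply: le_trans y1 _; have /andP[] := x1.
  - exact: le_trans y1 _.
  - by apply: le_trans y1 _; exact: le_trans (lerN10 _) u1.
have [y2|y2] := leP y 0%R.
  rewrite cutE; last by rewrite (ltW y1) (le_trans y2).
  have [|s s1 sy] := @hlow_surj y; first by rewrite (ltW y1).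
  transitivity (\int[mu]_(x in `[(-1)%R, 1%R]) (if (x < s)%R then (1 - wup x)%:E else 0)).
    apply: eq_integral => x; rewrite inE/= in_itv/= => x1.
    have /andP[u1 u2] := @hup_itv _ g g1 x x1.
    rewrite transfer_indic_cut ifF; last by apply/negbTE; rewrite -leNgt (le_trans y2).
    by rewrite mulr0 add0r -sy hlow_ltE//; case: ifP; rewrite ?mulr1 ?mulr0.
  by rewrite integral_cut// integral_onem_wup// sy addrC.
have [y3|y3] := leP y 1%R.
  rewrite cutE; last by rewrite (ltW y1).
  have [|s s1 sy] := @hup_surj y; first by rewrite (ltW y2).
  transitivity (\int[mu]_(x in `[(-1)%R, 1%R])
      ((if (x < s)%R then (wup x)%:E else 0) + (1 - wup x)%:E)).
    apply: eq_integral => x; rewrite inE/= in_itv/= => x1.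
    have /andP[u1 u2] := @hlow_itv _ g g1 x x1.
    rewrite transfer_indic_cut (ifT _ _ (le_lt_trans u2 y2)) mulr1.
    by rewrite -sy hup_ltE//; case: ifP; rewrite ?mulr1 ?mulr0 ?EFinD ?add0r ?add0e.
  rewrite ge0_integralD//=.
  - rewrite integral_cut// integral_wup// integral_onem_wup// sy -EFinD.
    by rewrite /hlow (hup1 g g1) subrr addr0.
  - move=> x; rewrite in_itv/= => x1; case: ifP => // _.
    by rewrite lee_fin; have /andP[] := wup_itv g g1 x x1.
  - apply: measurable_funTS; apply: measurable_fun_ifT => //.
    exact: measurable_fun_ltr.
  - move=> x; rewrite in_itv/= => x1.
    by rewrite lee_fin subr_ge0; have /andP[] := wup_itv g g1 x x1.
  - exact: measurable_funTS.
apply: eq_integral => x; rewrite inE/= in_itv/= => x1.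
rewrite transfer_indic_cut indic_cut.
have /andP[l1 l2] := @hlow_itv _ g g1 x x1; have /andP[u1 u2] := @hup_itv _ g g1 x x1.
have /andP[x2 x3] := x1.
rewrite !ifT; first by rewrite !mulr1 addrC subrK.
- exact: le_lt_trans x3 _.
- exact: le_lt_trans l2 _.
- exact: le_lt_trans u2 _.
Qed.

Let nuE A : measurable A -> nu A = U A.
Proof.
have cut y : nu `]-oo, y[%classic = U `]-oo, y[%classic.
  have -> : U `]-oo, y[%classic = \int[U]_x (\1_(`]-oo, y[%classic : set R) x)%:E.
    by rewrite integral_indic// setIT.
  transitivity (\int[nu]_x (\1_(`]-oo, y[%classic : set R) x)%:E).
    rewrite -[X in nu X]setIT; apply/esym/integral_indic; first exact: measurableT.
    exact: measurable_itv.
  rewrite integral_baker//=.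
  rewrite integral_transfer_cut integral_uniform//=.
  - by rewrite opprK.
  - exact/measurable_EFinP/measurable_indic.
apply: (@measure_unique _ R (measurableTypeR R) (@RGenInftyO.G R) (fun n => `]-oo, n%:R[%classic)).
- exact: RGenInftyO.measurableE.
- move=> _ _ [x ->] [y ->]; exists (Num.min x y).
  apply/seteqP; split=> z /=; rewrite !in_itv/= lt_min; first by move=> [-> ->].
  by move=> /andP[].
- by move=> n; exists n%:R.
- apply/seteqP; split=> // x _; exists (Num.truncn x).+1 => //=.
  by rewrite in_itv/=; exact: truncnS_gt.
- by move=> _ [y ->].
- move=> n; change (nu `]-oo, n%:R[%classic < +oo).
  by rewrite cut; apply: le_lt_trans (probability_le1 _ _) (ltry _).
Qed.

Lemma integral_transfer f : measurable_fun setT f -> (forall x, 0 <= f x)%R ->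
  \int[mu]_(x in `[(-1)%R, 1%R]) (transfer f x)%:E =
  \int[mu]_(x in `[(-1)%R, 1%R]) (f x)%:E.
Proof.
move=> mf f0.
have : \int[nu]_x (f x)%:E = \int[U]_x (f x)%:E.
  by apply: eq_measure_integral => A mA _; exact: nuE.
rewrite integral_baker// integral_uniform//=; last exact/measurable_EFinP.
have -> : (1 - -1 = 2 :> R)%R by rewrite opprK.
move=> /(congr1 (fun z => 2%:E * z)); rewrite !muleA -EFinM divff// !mul1e.
exact.
Qed.

End invariance.

(** * Decay for odd monotone functions *)

Section odd_decay.
Context {R : realType} (g : R).
Hypothesis g1 : 1 < g.
Implicit Types (a b c l s t x y u B : R) (f w : R -> R) (n m : nat).

Local Notation mu := (@lebesgue_measure R).
Local Notation G := ((2 * g)^-1).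
Local Notation hup := (hup g).
Local Notation hlow := (hlow g).
Local Notation wup := (wup g).
Local Notation transfer := (transfer g).

(* [hup] in the coordinate [u = 1 - x] near the fixed point. *)
Definition shrink u := u - G * u `^ g.

Lemma hup_shrink u : 0 <= u <= 1 -> hup (1 - u) = 1 - shrink u.
Proof.
move=> /andP[u0 u1]; rewrite (hup_ge0E g) ?subr_ge0// subKr /shrink; ring.
Qed.

Lemma shrink_itv u : 0 <= u <= 1 -> 0 <= shrink u <= 1.
Proof.
move=> /andP[u0 u1]; have := @hup_itv _ g g1 (1 - u).
by rewrite hup_shrink ?u0//; lra.
Qed.

Lemma iter_shrink_itv n u : 0 <= u <= 1 -> 0 <= iter n shrink u <= 1.
Proof. by move=> u01; elim: n => // n IH; exact: shrink_itv. Qed.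

Lemma odd_homo_ge0 f x : odd_homo f -> 0 <= x <= 1 -> 0 <= f x.
Proof.
move=> [fN fh] /andP[x0 x1]; have := fh 0 x (lerN10 _) x0 x1.
by have := fN 0; rewrite oppr0; lra.
Qed.

Lemma odd_homo_le0 f x : odd_homo f -> -1 <= x <= 0 -> f x <= 0.
Proof.
move=> fo /andP[x1 x0]; have := odd_homo_ge0 f (- x) fo; have [fN _] := fo.
by rewrite fN oppr_ge0 lerNl x0 x1 => /(_ isT); lra.
Qed.

Let tail f c x : R := if 1 - c <= `|x| then `|f x| else 0.

Let tail_ge0 f c x : 0 <= tail f c x.
Proof. by rewrite /tail; case: ifP. Qed.

Let tail_transfer f c x : odd_homo f -> 0 <= c <= 1 -> -1 <= x <= 1 ->
  tail (transfer f) c x <= transfer (tail f (shrink c)) x.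
Proof.
move=> fo c01 x1; have tfo := transfer_odd_homo g g1 f fo.
(* The term carried by [hlow z] is nonpositive and is dropped; by monotonicity
   [hup z >= hup (1 - c) = 1 - shrink c]. *)
have pos z : 0 <= z <= 1 -> 1 - c <= z ->
    `|transfer f z| <= wup z * tail f (shrink c) (hup z).
  move=> z01 cz; have zD : -1 <= z <= 1 by lra.
  have /andP[p0 p1] := wup_itv g g1 z zD.
  have uz := hup_itv g g1 z zD; have /andP[uz0 uz1] := uz.
  rewrite (ger0_norm (odd_homo_ge0 _ _ tfo z01)) /tail (ger0_norm uz0).
  have -> : 1 - shrink c <= hup z.
    by rewrite -hup_shrink//; apply: hup_homo => //; lra.
  rewrite (ger0_norm (odd_homo_ge0 _ _ fo uz)) /transfer.
  have := odd_homo_le0 _ _ fo (hlow_itv g g1 z zD).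
  by rewrite gerDl => l0; rewrite mulr_ge0_le0// subr_ge0.
have /andP[p0 p1] := wup_itv g g1 x x1.
have p1' : 0 <= 1 - wup x by rewrite subr_ge0.
rewrite {1}/tail; case: ifPn => [cx|_]; last first.
  by apply: transfer_ge0 => // z _; exact: tail_ge0.
have [x0|x0] := leP 0 x.
  rewrite (ger0_norm x0) in cx; apply: le_trans (pos x _ cx) _; first by lra.
  by rewrite /transfer lerDl mulr_ge0.
rewrite (ltr0_norm x0) in cx; have [tN _] := tfo.
have -> : `|transfer f x| = `|transfer f (- x)| by rewrite tN normrN.
apply: le_trans (pos (- x) _ cx) _; first by lra.
rewrite (wupN g) /transfer.
have -> : hup (- x) = - hlow x by rewrite (hlowE g) opprK.
have -> : tail f (shrink c) (- hlow x) = tail f (shrink c) (hlow x).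
  by rewrite /tail normrN; have [-> _] := fo; rewrite normrN.
by rewrite lerDr mulr_ge0.
Qed.

Let measurable_tail f c : measurable_fun setT f -> measurable_fun setT (tail f c).
Proof.
move=> mf; apply: measurable_fun_ifT => //.
- by apply: measurable_fun_ler => //; exact: measurableT_comp.
- exact: measurableT_comp.
Qed.

Local Open Scope ereal_scope.

Let integral_tail f c n : odd_homo f -> measurable_fun setT f -> (0 <= c <= 1)%R ->
  \int[mu]_(x in `[(-1)%R, 1%R]) (tail (iter n transfer f) c x)%:E <=
  \int[mu]_(x in `[(-1)%R, 1%R]) (tail f (iter n shrink c) x)%:E.
Proof.
move=> fo mf c01; elim: n f fo mf => // n IH f fo mf.
rewrite iterSr [X in _ <= X](_ : _ =
    \int[mu]_(x in `[(-1)%R, 1%R]) (transfer (tail f (iter n.+1 shrink c)) x)%:E).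
  apply: le_trans (IH _ (transfer_odd_homo g g1 f fo) (measurable_transfer g f mf)) _.
  apply: ge0_le_integral => //=.
  - by move=> x _; rewrite lee_fin tail_ge0.
  - apply/measurable_EFinP; apply: measurable_funTS; apply: measurable_tail.
    exact: measurable_transfer.
  - apply/measurable_EFinP; apply: measurable_funTS; apply: measurable_transfer.
    exact: measurable_tail.
  - move=> x; rewrite in_itv/= => x1; rewrite lee_fin.
    by apply: tail_transfer => //; exact: iter_shrink_itv.
by rewrite integral_transfer//; exact: measurable_tail.
Qed.

Lemma integral_iter_transfer_odd f n B : odd_homo f -> measurable_fun setT f ->
  (forall x, (-1 <= x <= 1)%R -> (`|f x| <= B)%R) ->
  \int[mu]_(x in `[(-1)%R, 1%R]) (`|iter n transfer f x|)%:E <=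
  (2 * B * iter n shrink 1)%:E.
Proof.
move=> fo mf fB.
have B0 : (0 <= B)%R by apply: le_trans (fB 0%R _) => //; lra.
have one1 : (0 <= (1 : R) <= 1)%R by rewrite ler01 lexx.
have H := integral_tail f 1 n fo mf one1.
rewrite [X in X <= _](_ : _ =
  \int[mu]_(x in `[(-1)%R, 1%R]) (tail (iter n transfer f) 1 x)%:E); last first.
  by apply: eq_integral => x _; rewrite /tail subrr normr_ge0.
apply: le_trans H _; set u := iter n shrink 1%R.
have /andP[u0 u1] : (0 <= u <= 1)%R by exact: iter_shrink_itv.
pose E1 : set R := `[(-1)%R, (u - 1)%R]%classic; pose E2 : set R := `[(1 - u)%R, 1%R]%classic.
have mE : measurable (E1 `|` E2) by apply: measurableU; exact: measurable_itv.
have HE : mu (E1 `|` E2) <= (2 * u)%:E.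
  apply: (@le_trans _ _ (mu E1 + mu E2)); first by apply: measureU2; exact: measurable_itv.
  rewrite !lebesgue_measure_itv/= !lte_fin.
  have -> : (2 * u)%:E = u%:E + u%:E by rewrite -EFinD mulr_natl mulr2n.
  by apply: leeD; case: ifP => _; rewrite -?EFinB lee_fin//; lra.
apply: (@le_trans _ _ (\int[mu]_(x in E1 `|` E2) (cst B%:E x))); last first.
  rewrite integral_cst//.
  rewrite -mulrA mulrCA EFinM; exact: lee_wpmul2l.
have -> : \int[mu]_(x in E1 `|` E2) cst B%:E x =
    \int[mu]_(x in `[(-1)%R, 1%R]) ((cst B%:E) \_ (E1 `|` E2)) x.
  rewrite -integral_mkcondr; congr (integral _ _ _).
  apply/seteqP; split=> x; last by case.
  by rewrite /E1 /E2 /= !in_itv/= => x12; split => //; case: x12 => /andP[? ?]; lra.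
apply: ge0_le_integral => //=.
- by move=> x _; rewrite lee_fin tail_ge0.
- by apply/measurable_EFinP; apply: measurable_funTS; exact: measurable_tail.
- by apply: measurable_funTS; apply/(measurable_restrictT _ mE); exact: measurable_cst.
- move=> x; rewrite in_itv/= => x1; rewrite /tail patchE; case: ifPn => [xu|_].
    rewrite mem_set ?lee_fin ?fB// /E1 /E2/= !in_itv/=.
    have [x0|x0] := leP 0%R x.
      by right; rewrite ger0_norm// in xu; rewrite xu; case/andP: x1.
    by left; rewrite ltr0_norm// in xu; case/andP: x1 => -> _/=; lra.
  by case: ifP => // _; rewrite lee_fin.
Qed.

Local Close Scope ereal_scope.

(** In the coordinate [u^(-(g-1))] each application of [shrink] adds at least [(g - 1) G]: with
    [s = u^(g-1)], [shrink u = u (1 - G s)] and [s^-1 (1 + (g - 1) G s) = s^-1 + (g - 1) G]. *)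
Lemma iter_shrink_le n : (0 < n)%N ->
  iter n shrink 1 <= (((g - 1) * G) * n%:R) `^ (- (g - 1)^-1).
Proof.
move=> n0; have g10 : 0 < g - 1 by rewrite subr_gt0.
have [/andP[G0 G1] GE] := (G_itv g g1, Gg g g1).
have H m : 0 < iter m shrink 1 <= 1 /\
    1 + (g - 1) * G * m%:R <= (iter m shrink 1) `^ (- (g - 1)).
  elim: m => [|m [/andP[u0 u1] IH]]; first by rewrite /= mulr0 addr0 powR1 ltr01 !lexx.
  rewrite iterS; set u := iter m shrink 1 in u0 u1 IH *.
  set s := u `^ (g - 1).
  have s0 : 0 < s by exact: powR_gt0.
  have s1 : s <= 1 by apply: powR_le1; [exact: ltW|rewrite (ltW u0)].
  have uE : shrink u = u * (1 - G * s).
    by rewrite /shrink -(@mulr_powRB1 _ u g) ?(ltW u0)// /s; [ring|move: g1; lra].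
  have Gs0 : 0 < G * s by rewrite mulr_gt0.
  have Gs1 : G * s < 1 by nra.
  split; first by rewrite uE mulr_gt0 ?subr_gt0//=; nra.
  rewrite uE powRM ?(ltW u0)//; last by rewrite subr_ge0 ltW.
  have z01 : 0 <= G * s < 1 by rewrite (ltW Gs0).
  have H := powRN_ge1D (g - 1) (G * s) (ltW g10) z01.
  have us : u `^ (- (g - 1)) = s^-1 by rewrite powRN.
  rewrite us in IH *.
  have si0 : 0 <= s^-1 by rewrite invr_ge0 ltW.
  apply: le_trans (ler_wpM2l si0 H).
  have -> : s^-1 * (1 + (g - 1) * (G * s)) = s^-1 + (g - 1) * G.
    by rewrite mulrDr mulr1; congr (_ + _); rewrite mulrCA (mulrCA s^-1) mulVf ?gt_eqF// mulr1.
  by rewrite -[m.+1%:R]natr1 mulrDr mulr1 addrA lerD2r.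
have [/andP[u0 u1] Hn] := H n; set u := iter n shrink 1 in u0 u1 Hn *.
have n0' : 0 < n%:R :> R by rewrite ltr0n.
have N0 : 0 < (g - 1) * G * n%:R by rewrite !mulr_gt0.
have -> : u = (u `^ (- (g - 1))) `^ (- (g - 1)^-1).
  by rewrite -powRrM mulrNN mulfV ?gt_eqF// powRr1// ltW.
rewrite !powRN lef_pV2 ?posrE ?powR_gt0 ?invr_gt0 ?powR_gt0//.
rewrite -powRN.
apply: ge0_ler_powR; rewrite ?nnegrE ?invr_ge0 ?powR_ge0 ?(ltW g10) ?(ltW N0)//.
by apply: le_trans Hn; rewrite lerDr.
Qed.

End odd_decay.

(** * Oscillation of the iterates of the transfer operator *)

Section oscillation.
Context {R : realType} (g : R).
Hypothesis g1 : 1 < g.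
Implicit Types (a b c l s t x y u B C K : R) (f w : R -> R) (n m : nat).

Local Notation mu := (@lebesgue_measure R).
Local Notation G := ((2 * g)^-1).
Local Notation transfer := (transfer g).

(** For [a < 1] this is Bernoulli with the exponent [1 / a] at the point [(x / y)^a]. *)
Lemma powR_concave a x y : 0 < a <= 1 -> 0 < x -> 0 < y ->
  x `^ a - y `^ a <= a * y `^ (a - 1) * (x - y).
Proof.
move=> /andP[a0]; rewrite le_eqVlt => /predU1P[->|a1] x0 y0.
  by rewrite subrr powRr0 !powRr1 ?(ltW x0) ?(ltW y0)// !mul1r.
have k1 : 1 < a^-1 by rewrite invf_gt1.
have := powR_bernoulli a^-1 ((x / y) `^ a) k1 (powR_ge0 _ _).
rewrite -powRrM mulfV ?gt_eqF// powRr1; last by rewrite divr_ge0// ltW.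
rewrite (powRM _ (ltW x0)) ?invr_ge0 ?(ltW y0)//.
have ya : 0 < y `^ (a - 1) by exact: powR_gt0.
have yaE : y `^ a = y * y `^ (a - 1) by rewrite mulr_powRB1// ltW.
have yiE : y^-1 `^ a = (y `^ a)^-1.
  by rewrite -powR_inv1 ?(ltW y0)// -powRrM mulN1r powRN.
rewrite yiE -lerBrDl -(ler_pM2l a0) mulrA mulfV ?gt_eqF// mul1r => H.
have y0' : 0 < y `^ a by exact: powR_gt0.
have := ler_wpM2r (ltW y0') H.
rewrite mulrBl divfK ?gt_eqF// mul1r => /le_trans; apply.
rewrite yaE; have -> : a * (x / y - 1) * (y * y `^ (a - 1)) = a * y `^ (a - 1) * (x / y * y - y) by ring.
by rewrite divfK ?gt_eqF.
Qed.

Lemma integral_powR_sub a l : 0 < a <= 1 -> 0 < l ->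
  \int[mu]_(x in `[(-1), 1]) (1 - x + l) `^ (a - 1) <= (2 + l) `^ a / a.
Proof.
move=> a01 l0; have /andP[a0 a1] := a01.
rewrite (@Rintegral_slope _ _ (fun x => - ((1 - x + l) `^ a / a))).
- rewrite subrr add0r opprK opprK addrC lerBlDr.
  by rewrite -lerBlDl subrr mulr_ge0 ?powR_ge0 ?invr_ge0 ?ltW.
- by apply: (measurableT_comp (measurable_powR _)); apply: measurable_funD => //; exact: measurable_funB.
- lra.
- move=> x y x1 xy y1; rewrite -(opprB 1 a) !powRN lef_pV2 ?posrE ?powR_gt0//; [|lra..].
  by apply: ge0_ler_powR; rewrite ?nnegrE ?subr_ge0//; lra.
- move=> x y x1 xy y1; have [X0 Y0] : 0 < 1 - x + l /\ 0 < 1 - y + l by lra.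
  have H1 := powR_concave a _ _ a01 X0 Y0; have H2 := powR_concave a _ _ a01 Y0 X0.
  rewrite (_ : - (_ / _) - _ = ((1 - x + l) `^ a - (1 - y + l) `^ a) / a); last by ring.
  rewrite ler_pdivlMr// ler_pdivrMr//.
  move: H1 H2; set A := _ `^ (a - 1); set A' := _ `^ (a - 1).
  lra.
Qed.

Lemma integral_powR_add a l : 0 < a <= 1 -> 0 < l ->
  \int[mu]_(x in `[(-1), 1]) (1 + x + l) `^ (a - 1) <= (2 + l) `^ a / a.
Proof.
move=> a01 l0; have /andP[a0 a1] := a01.
have mf : measurable_fun setT (fun x : R => (1 + x + l) `^ (a - 1)).
  by apply: (measurableT_comp (measurable_powR _)); apply: measurable_funD => //; exact: measurable_funD.
have fle x y : -1 <= x -> x <= y -> y <= 1 -> (1 + y + l) `^ (a - 1) <= (1 + x + l) `^ (a - 1).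
  move=> x1 xy y1; rewrite -(opprB 1 a) !powRN lef_pV2 ?posrE ?powR_gt0//; [|lra..].
  by apply: ge0_ler_powR; rewrite ?nnegrE ?subr_ge0//; lra.
(* [Rintegral_slope] wants a nondecreasing integrand, hence the change of sign. *)
have E : \int[mu]_(x in `[(-1), 1]) (-1 * (1 + x + l) `^ (a - 1)) =
    - ((2 + l) `^ a / a) + l `^ a / a.
  rewrite (@Rintegral_slope _ _ (fun x => - ((1 + x + l) `^ a / a))).
  - rewrite opprK; congr (- (_ `^ _ / _) + _ `^ _ / _); ring.
  - exact: measurable_funM.
  - lra.
  - by move=> x y x1 xy y1; rewrite !mulN1r lerN2; exact: fle.
  - move=> x y x1 xy y1; have [X0 Y0] : 0 < 1 + x + l /\ 0 < 1 + y + l by lra.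
    have H1 := powR_concave a _ _ a01 X0 Y0; have H2 := powR_concave a _ _ a01 Y0 X0.
    rewrite (_ : - (_ / _) - _ = ((1 + x + l) `^ a - (1 + y + l) `^ a) / a); last by ring.
    rewrite ler_pdivlMr// ler_pdivrMr//.
    move: H1 H2; set A := _ `^ (a - 1); set A' := _ `^ (a - 1).
    lra.
rewrite RintegralZl// in E; last first.
  apply: (@bounded_integrable_itv _ _ _ _ (l `^ (a - 1))) => // x /andP[x1 x2].
  rewrite ger0_norm ?powR_ge0//; have := fle (-1) x (lexx _) x1 x2.
  by rewrite subrr add0r.
have : 0 <= l `^ a / a by rewrite divr_ge0 ?powR_ge0 ?ltW.
lra.
Qed.

Lemma integral_iter_transfer n f : measurable_fun setT f -> (forall x, 0 <= f x) ->
  (\int[mu]_(x in `[(-1)%R, 1%R]) (iter n transfer f x)%:E =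
   \int[mu]_(x in `[(-1)%R, 1%R]) (f x)%:E)%E.
Proof.
move=> mf f0; elim: n => // n IH; rewrite -IH iterS.
have mn := measurable_iter_transfer g n f mf.
have pos x : -1 <= x <= 1 -> 0 <= iter n transfer f x.
  exact: (iter_transfer_ge0 g g1 n f).
(* [integral_transfer] asks for nonnegativity on the whole line, but the iterates are only known to
   be nonnegative on [[-1, 1]]. *)
transitivity (\int[mu]_(x in `[(-1)%R, 1%R]) (transfer (fun x => `|iter n transfer f x|) x)%:E)%E.
  apply: eq_integral => x; rewrite inE/= in_itv/= => x1.
  rewrite /transfer !ger0_norm//; apply: pos; first exact: hlow_itvW.
  exact: hup_itvW.
rewrite integral_transfer//; last exact: measurableT_comp.
by apply: eq_integral => x; rewrite inE/= in_itv/= => x1; rewrite ger0_norm// pos.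
Qed.

Lemma half_bounds n : (1 < n)%N ->
  [/\ (0 < n./2)%N, (n <= 3 * n./2)%N, (n <= 2 * (n - n./2))%N & (n - n./2 + n./2 = n)%N].
Proof.
move=> n1; have := odd_double_half n; rewrite -mul2n.
have : (odd n <= 1)%N by case: (odd n).
by move=> o1 e; split; lia.
Qed.

Lemma powRN_le_scale b c n m : 0 <= b -> 0 < c -> (0 < n)%N -> (0 < m)%N ->
  (n <= m)%N -> (c * m%:R) `^ (- b) <= c `^ (- b) * n%:R `^ (- b).
Proof.
move=> b0 c0 n0 m0 nm; rewrite -powRM ?ler0n ?(ltW c0)//.
rewrite !powRN lef_pV2 ?posrE ?powR_gt0 ?mulr_gt0 ?ltr0n//.
apply: ge0_ler_powR; rewrite ?nnegrE ?mulr_ge0 ?ler0n ?(ltW c0)//.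
by rewrite ler_pM2l// ler_nat.
Qed.

(** The modulus obtained after [m = n./2] steps is a function of [x] plus a function of [y], the
    form that the coupling propagates through the other [k = n - m] steps. Only the integral of
    [Psi] matters afterwards. *)
Lemma transfer_oscillation a C f : 0 < a <= 1 -> 0 <= C ->
  (forall x y, -1 <= x -> x < y -> y <= 1 -> `|f y - f x| <= C * (y - x) `^ a) ->
  exists2 K : R, 0 <= K & forall n, (1 < n)%N -> exists Psi : R -> R,
    [/\ measurable_fun setT Psi, forall x, -1 <= x <= 1 -> 0 <= Psi x,
      (\int[mu]_(x in `[(-1)%R, 1%R]) (Psi x)%:E <= (K * n%:R `^ (- (g - 1)^-1))%:E)%E
    & forall x y, -1 <= x <= 1 -> -1 <= y <= 1 ->
      `|iter n transfer f x - iter n transfer f y| <= Psi x + Psi y].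
Proof.
move=> a01 C0 fC; have /andP[a0 a1] := a01.
have [A [K [A0 K0 modulus]]] := holder_modulus g g1 a C f a01 C0 fC.
set b := (g - 1)^-1 in modulus *.
have b0 : 0 < b by rewrite invr_gt0 subr_gt0.
(* A bound of [(2 + l)^a / a] independent of [n], as [l <= A^b]. *)
pose S := (2 + A `^ b) / a.
have S0 : 0 <= S by rewrite divr_ge0 ?addr_ge0 ?powR_ge0// ltW.
have /andP[G0 _] := G_itv g g1.
have [c cE] : exists c : R, c = (g - 1) * G by exists ((g - 1) * G).
have c0 : 0 < c by rewrite cE mulr_gt0// subr_gt0.
(* The first term comes from [l] with [n <= 3 m], and [2 + 2 S] bounds the integral of the singular
   factor. The second comes from [iter_shrink_le] with [n <= 2 k]. *)
exists (K * (A^-1 / 3) `^ (- b) * (2 + 2 * S) + 2 * K * (c / 2) `^ (- b)).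
  by rewrite addr_ge0// !mulr_ge0 ?powR_ge0// addr_ge0// mulr_ge0.
move=> n n1; have [m0 nm nk kmE] := half_bounds n n1.
set m := n./2 in m0 nm nk kmE *; set k := (n - m)%N in nk kmE *.
pose l := (A / m%:R) `^ b.
have m0' : 0 < m%:R :> R by rewrite ltr0n.
have l0 : 0 < l by rewrite powR_gt0// divr_gt0.
have lA : l <= A `^ b.
  apply: ge0_ler_powR; rewrite ?nnegrE ?divr_ge0 ?(ltW b0) ?(ltW A0)//.
  by rewrite ler_pdivrMr// ler_peMr ?ler1n// ltW.
have ln : l <= (A^-1 / 3) `^ (- b) * n%:R `^ (- b).
  have -> : l = (A^-1 / 3 * (3 * m)%:R) `^ (- b).
    have -> : A^-1 / 3 * (3 * m)%:R = (A / m%:R)^-1.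
      by rewrite natrM; field; rewrite ?gt_eqF.
    rewrite -powR_inv1; last by rewrite divr_ge0// ltW.
    by rewrite -powRrM mulrNN mul1r.
  apply: powRN_le_scale => //; [exact: ltW|by rewrite divr_gt0 ?invr_gt0|exact: ltnW|].
  by rewrite muln_gt0 m0.
have [w [wo mw wK Hm]] := modulus m l m0 erefl.
clearbody l.
pose om1 x := (1 - x + l) `^ (a - 1); pose om2 x := (1 + x + l) `^ (a - 1).
have mom1 : measurable_fun setT om1.
  by apply: (measurableT_comp (measurable_powR _)); apply: measurable_funD => //; exact: measurable_funB.
have mom2 : measurable_fun setT om2.
  by apply: (measurableT_comp (measurable_powR _)); apply: measurable_funD => //; exact: measurable_funD.
have mTw : measurable_fun setT (fun x => `|iter k transfer w x|).
  by apply: measurableT_comp => //; exact: measurable_iter_transfer.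
have p1 x : -1 <= x <= 1 -> 0 <= iter k transfer om1 x.
  by apply: iter_transfer_ge0 => // z _; exact: powR_ge0.
have p2 x : -1 <= x <= 1 -> 0 <= iter k transfer om2 x.
  by apply: iter_transfer_ge0 => // z _; exact: powR_ge0.
have Kl0 : 0 <= K * l by rewrite mulr_ge0// ltW.
pose Psi1 x := K * l * (1 + iter k transfer om1 x + iter k transfer om2 x).
have mPsi1 : measurable_fun setT Psi1.
  apply: measurable_funM => //; apply: measurable_funD; last exact: measurable_iter_transfer.
  by apply: measurable_funD => //; exact: measurable_iter_transfer.
have Psi1_ge0 x : -1 <= x <= 1 -> 0 <= Psi1 x.
  by move=> x1; rewrite mulr_ge0// !addr_ge0 ?p1 ?p2.
exists (fun x => Psi1 x + `|iter k transfer w x|); split.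
- exact: measurable_funD.
- by move=> x x1; rewrite addr_ge0 ?Psi1_ge0.
- have oml (h : R -> R) : (forall x, 0 <= h x) -> (forall x, -1 <= x <= 1 -> h x <= l `^ (a - 1)) ->
      measurable_fun setT h -> \int[mu]_(x in `[(-1), 1]) h x <= (2 + l) `^ a / a ->
      (\int[mu]_(x in `[(-1)%R, 1%R]) (iter k transfer h x)%:E <= S%:E)%E.
    move=> h0 hl mh hS; rewrite integral_iter_transfer//.
    have ih : mu.-integrable `[(-1), 1] (EFin \o h).
      apply: (@bounded_integrable_itv _ _ _ _ (l `^ (a - 1))) => // x x1.
      by rewrite ger0_norm ?hl.
    have -> : (\int[mu]_(x in `[(-1)%R, 1%R]) (h x)%:E =
        (\int[mu]_(x in `[(-1), 1]) h x)%:E)%E.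
      by rewrite /Rintegral fineK//; apply: integrable_fin_num.
    rewrite lee_fin; apply: le_trans hS _; rewrite /S ler_pM2r ?invr_gt0//.
    apply: le_trans (_ : 2 + l <= _); last by rewrite lerD2l.
    by apply: ler1_powR => //; lra.
  have I1 := oml om1 (fun x => powR_ge0 _ _) _ mom1 (integral_powR_sub a l a01 l0).
  have I2 := oml om2 (fun x => powR_ge0 _ _) _ mom2 (integral_powR_add a l a01 l0).
  have om1l x : -1 <= x <= 1 -> om1 x <= l `^ (a - 1).
    move=> /andP[x1 x2]; rewrite /om1 -(opprB 1 a) !powRN lef_pV2 ?posrE ?powR_gt0//; last by lra.
    by apply: ge0_ler_powR; rewrite ?nnegrE ?subr_ge0//; lra.
  have om2l x : -1 <= x <= 1 -> om2 x <= l `^ (a - 1).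
    move=> /andP[x1 x2]; rewrite /om2 -(opprB 1 a) !powRN lef_pV2 ?posrE ?powR_gt0//; last by lra.
    by apply: ge0_ler_powR; rewrite ?nnegrE ?subr_ge0//; lra.
  have {}I1 := I1 om1l; have {}I2 := I2 om2l.
  have Iw := integral_iter_transfer_odd g g1 w k K wo mw wK.
  have m1 : measurable_fun setT (iter k transfer om1) by exact: measurable_iter_transfer.
  have m2 : measurable_fun setT (iter k transfer om2) by exact: measurable_iter_transfer.
  have I12 : (\int[mu]_(x in `[(-1)%R, 1%R]) (1 + iter k transfer om1 x + iter k transfer om2 x)%:E
      <= (2 + S + S)%:E)%E.
    under eq_integral do rewrite !EFinD.
    rewrite ge0_integralD//=.
    - rewrite !EFinD; apply: leeD => //.
      rewrite ge0_integralD//=.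
      + apply: leeD I1; rewrite integral_cst//= mul1e lebesgue_measure_itv/= lte_fin.
        by rewrite ifT ?lee_fin; lra.
      + exact/measurable_EFinP/measurable_funTS.
    - move=> x; rewrite in_itv/= => x1.
      by rewrite -EFinD lee_fin addr_ge0 ?p1.
    - apply/measurable_EFinP/measurable_funTS.
      exact: measurable_funD.
    - exact/measurable_EFinP/measurable_funTS.
  under eq_integral do rewrite EFinD.
  rewrite ge0_integralD//=; last 2 first.
  - exact/measurable_EFinP/measurable_funTS.
  - exact/measurable_EFinP/measurable_funTS.
  rewrite mulrDl EFinD; apply: leeD.
  + under eq_integral do rewrite EFinM.
    rewrite ge0_integralZl//=.
    * apply: (@le_trans _ _ ((K * l)%:E * (2 + S + S)%:E)%E).
        by apply: lee_wpmul2l => //; rewrite lee_fin.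
      rewrite -EFinM lee_fin.
      have S20 : 0 <= 2 + S + S by rewrite !addr_ge0.
      have H1 := ler_wpM2r S20 (ler_wpM2l K0 ln); apply: le_trans H1 _.
      by rewrite le_eqVlt; apply/orP; left; apply/eqP; ring.
    * apply/measurable_EFinP/measurable_funTS; apply: measurable_funD => //.
      exact: measurable_funD.
    * by move=> x; rewrite in_itv/= => x1; rewrite lee_fin !addr_ge0 ?p1 ?p2.
  + apply: le_trans Iw _; rewrite lee_fin -!mulrA !ler_wpM2l//.
    have k0 : (0 < k)%N.
      by rewrite lt0n; apply/negP => /eqP kz; move: (leq_trans n1 nk); rewrite kz.
    apply: le_trans (iter_shrink_le g g1 k k0) _; rewrite -/b -cE.
    have -> : c * k%:R = c / 2 * (2 * k)%:R by rewrite natrM; field.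
    apply: powRN_le_scale => //; [exact: ltW|by rewrite divr_gt0|exact: ltnW|].
    by rewrite muln_gt0.
- have Hle x y : -1 <= x -> x <= y -> y <= 1 ->
      `|iter n transfer f y - iter n transfer f x| <=
      (Psi1 x + `|iter k transfer w x|) + (Psi1 y + `|iter k transfer w y|).
    move=> x1 xy y1; rewrite -{1 2}kmE !iterD.
    (* The bound is put in the affine form of [iter_transfer_lin], with the constant [K * l] and
       [- w] on the side of the smaller point. *)
    have cond s t : -1 <= s -> s <= t -> t <= 1 ->
        `|iter m transfer f t - iter m transfer f s| <=
        (K * l + (K * l) * om1 s + (-1) * w s) + (0 + (K * l) * om2 t + 1 * w t).
      move=> s1 st t1; apply: le_trans (Hm s t s1 st t1) _.
      by rewrite /om1 /om2; lra.
    have := iter_transfer_coupling g g1 k _ _ _ cond x y x1 xy y1.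
    rewrite !iter_transfer_lin => /le_trans; apply.
    have := ler_norm (- iter k transfer w x); rewrite normrN.
    have := ler_norm (iter k transfer w y).
    have x11 : -1 <= x <= 1 by rewrite x1 (le_trans xy).
    have y11 : -1 <= y <= 1 by rewrite y1 (le_trans x1).
    have := mulr_ge0 Kl0 (p2 x x11); have := mulr_ge0 Kl0 (p1 y y11).
    rewrite /Psi1; lra.
  move=> x y /andP[x1 x2] /andP[y1 y2]; have [xy|yx] := leP x y.
    by rewrite distrC; exact: Hle.
  by rewrite [leRHS]addrC; apply: Hle => //; exact: ltW.
Qed.

End oscillation.

(** * Duality between the operator and composition with the map *)

Section decorrelation.
Context {R : realType} (g : R).
Hypothesis g1 : 1 < g.
Implicit Types (a b c l s t x y B C K : R) (f : R -> R) (U : nat -> R -> R) (n m : nat).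

Local Notation mu := (@lebesgue_measure R).
Local Notation hup := (hup g).
Local Notation hlow := (hlow g).
Local Notation wup := (wup g).
Local Notation transfer := (transfer g).

Lemma integrable_transfer f : measurable_fun setT f ->
  mu.-integrable `[(-1), 1] (EFin \o f) -> mu.-integrable `[(-1), 1] (EFin \o transfer f).
Proof.
move=> mf /integrableP[_ fi]; apply/integrableP; split.
  apply: measurableT_comp => //; apply: measurable_funTS; exact: measurable_transfer.
apply: le_lt_trans fi.
rewrite -(integral_transfer g g1 (fun x => `|f x|)) //; last exact: measurableT_comp.
apply: ge0_le_integral => //.
- apply/measurable_EFinP/measurable_funTS; apply: measurableT_comp => //.
  exact: measurable_transfer.
- apply/measurable_EFinP/measurable_funTS; apply: measurable_transfer.
  exact: measurableT_comp.
- move=> x /=; rewrite in_itv/= => x1; rewrite lee_fin /transfer.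
  have /andP[w0 w1] := wup_itv g g1 x x1.
  apply: le_trans (ler_normD _ _) _; by rewrite !normrM (ger0_norm w0) (@ger0_norm _ (1 - wup x)) ?subr_ge0.
Qed.

(** Invariance is known for nonnegative functions, so [f] is written as the difference of [|f| + f]
    and [|f|]. *)
Lemma Rintegral_transfer f : measurable_fun setT f ->
  mu.-integrable `[(-1), 1] (EFin \o f) ->
  \int[mu]_(x in `[(-1), 1]) transfer f x = \int[mu]_(x in `[(-1), 1]) f x.
Proof.
move=> mf fi.
have pos f' : measurable_fun setT f' -> (forall x, 0 <= f' x) ->
    \int[mu]_(x in `[(-1), 1]) transfer f' x = \int[mu]_(x in `[(-1), 1]) f' x.
  by move=> mf' f0'; rewrite /Rintegral integral_transfer.
have mn : measurable_fun setT (fun x => `|f x|) by exact: measurableT_comp.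
have mp : measurable_fun setT (fun x => `|f x| + f x) by exact: measurable_funD.
have ni : mu.-integrable `[(-1), 1] (EFin \o (fun x => `|f x|)) by exact: integrable_norm.
have pi : mu.-integrable `[(-1), 1] (EFin \o (fun x => `|f x| + f x)).
  rewrite (_ : _ \o _ = ((EFin \o (fun x => (`|f x|)%R)) \+ (EFin \o f))%E); first exact: integrableD.
  by apply/funext => x /=; rewrite EFinD.
transitivity (\int[mu]_(x in `[(-1), 1]) (transfer (fun x => `|f x| + f x) x - transfer (fun x => `|f x|) x)).
  by apply: eq_Rintegral => x _; rewrite /transfer; ring.
rewrite RintegralB//; [|exact: integrable_transfer..].
rewrite !pos//; last by move=> x; rewrite -lerBlDr sub0r -normrN ler_norm.
by rewrite -RintegralB//; apply: eq_Rintegral => x _; ring.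
Qed.

Lemma transfer_intertwine u v f : (forall t, -1 <= t <= 1 -> u (hup t) = v t) ->
  (forall t, -1 <= t <= 1 -> u (hlow t) = v t) ->
  forall t, -1 <= t <= 1 -> transfer (fun x => u x * f x) t = v t * transfer f t.
Proof. by move=> uh ul t t1; rewrite /transfer uh// ul//; ring. Qed.

Lemma transfer_bounded f B : (forall x, -1 <= x <= 1 -> `|f x| <= B) ->
  forall x, -1 <= x <= 1 -> `|transfer f x| <= B.
Proof.
move=> fB x x1; have /andP[w0 w1] := wup_itv g g1 x x1.
have w1' : 0 <= 1 - wup x by rewrite subr_ge0.
rewrite /transfer; apply: le_trans (ler_normD _ _) _.
rewrite !normrM (ger0_norm w0) (ger0_norm w1').
have H1 := ler_wpM2l w0 (fB _ (hup_itvW g g1 x x1)).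
have H2 := ler_wpM2l w1' (fB _ (hlow_itvW g g1 x x1)).
by move: H1 H2; lra.
Qed.

Lemma integrable_bounded_mul u f B : measurable_fun setT u -> measurable_fun setT f ->
  mu.-integrable `[(-1), 1] (EFin \o u) -> (forall x, -1 <= x <= 1 -> `|f x| <= B) ->
  mu.-integrable `[(-1), 1] (EFin \o (fun x => u x * f x)).
Proof.
move=> mu_ mf ui fB.
rewrite (_ : _ \o _ = ((EFin \o u) \* (EFin \o f))%E); last by apply/funext => x /=; rewrite EFinM.
apply: integrableMl => //; first exact: measurable_funTS.
exists B; split; first exact: num_real.
by move=> e Be x /=; rewrite in_itv/= => /fB /le_trans; apply; exact: ltW.
Qed.

Section observable.
(** [U n] will be [phi] composed with the [n]-th iterate of the map; [Uup] and [Ulow] say that [hup]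
    and [hlow] are inverse branches. *)
Variable U : nat -> R -> R.
Hypothesis mU : forall n, measurable_fun setT (U n).
Hypothesis U0i : mu.-integrable `[(-1), 1] (EFin \o U 0%N).
Hypothesis Uup : forall n t, -1 <= t <= 1 -> U n.+1 (hup t) = U n t.
Hypothesis Ulow : forall n t, -1 <= t <= 1 -> U n.+1 (hlow t) = U n t.

(** The operator sends [|U n.+1|] to [|U n|], so all these functions have the same L^1 norm. *)
Lemma observable_integrable n : mu.-integrable `[(-1), 1] (EFin \o U n).
Proof.
elim: n => // n /integrableP[_ IH]; apply/integrableP; split.
  by apply: measurableT_comp => //; exact: measurable_funTS (mU _).
apply: le_lt_trans IH.
rewrite -(integral_transfer g g1 (fun x => `|U n.+1 x|)) //; last exact: measurableT_comp.
rewrite le_eqVlt; apply/orP; left; apply/eqP.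
apply: eq_integral => x; rewrite inE/= in_itv/= => x1.
by rewrite /transfer Uup// Ulow//; congr EFin; ring.
Qed.

Lemma observable_duality n f B : measurable_fun setT f ->
  (forall x, -1 <= x <= 1 -> `|f x| <= B) ->
  \int[mu]_(x in `[(-1), 1]) (U n x * f x) =
  \int[mu]_(x in `[(-1), 1]) (U 0%N x * iter n transfer f x).
Proof.
elim: n f => // n IH f mf fB.
rewrite -Rintegral_transfer; last 2 first.
- exact: measurable_funM.
- exact: (integrable_bounded_mul _ _ B (mU _) mf (observable_integrable _) fB).
transitivity (\int[mu]_(x in `[(-1), 1]) (U n x * transfer f x)).
  apply: eq_Rintegral => x; rewrite inE/= in_itv/= => x1.
  by apply: transfer_intertwine => // t t1; [exact: Uup|exact: Ulow].
rewrite IH; [|exact: measurable_transfer|exact: transfer_bounded].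
by under eq_Rintegral do rewrite -iterSr.
Qed.

End observable.

Lemma iter_transfer_bounded n f B : (forall x, -1 <= x <= 1 -> `|f x| <= B) ->
  forall x, -1 <= x <= 1 -> `|iter n transfer f x| <= B.
Proof. by move=> fB; elim: n => //= n IH; exact: transfer_bounded. Qed.

Lemma Rintegral_iter_transfer n f B : measurable_fun setT f ->
  (forall x, -1 <= x <= 1 -> `|f x| <= B) ->
  \int[mu]_(x in `[(-1), 1]) iter n transfer f x = \int[mu]_(x in `[(-1), 1]) f x.
Proof.
move=> mf fB; elim: n => //= n IH; rewrite Rintegral_transfer//.
  exact: measurable_iter_transfer.
apply: (@bounded_integrable_itv _ _ _ _ B); first exact: measurable_iter_transfer.
exact: iter_transfer_bounded.
Qed.

Lemma Rintegral_cst_itv c : \int[mu]_(x in `[(-1), 1]) c = 2 * c.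
Proof.
have -> : \int[mu]_(x in `[(-1), 1]) c = \int[mu]_(x in `[(-1), 1]) (cst c) x by [].
rewrite Rintegral_cst//= lebesgue_measure_itv/= lte_fin ifT; last by lra.
by rewrite -EFinB/=; ring.
Qed.

End decorrelation.

(** * Decay of correlations on the interval *)

Section interval_decorrelation.
Context {R : realType} (g : R).
Hypothesis g1 : 1 < g.
Implicit Types (a b c l s t x y B C K : R) (f : R -> R) (U : nat -> R -> R) (n m : nat).

Local Notation mu := (@lebesgue_measure R).
Local Notation hup := (hup g).
Local Notation hlow := (hlow g).
Local Notation transfer := (transfer g).

Lemma ae_Rintegral_le (u v : R -> R) B : 0 <= B ->
  measurable_fun setT u -> measurable_fun setT v ->
  mu.-integrable `[(-1), 1] (EFin \o u) -> mu.-integrable `[(-1), 1] (EFin \o v) ->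
  {ae mu, forall x, -1 <= x <= 1 -> `|u x| <= B * v x} ->
  (forall x, -1 <= x <= 1 -> 0 <= v x) ->
  `|\int[mu]_(x in `[(-1), 1]) u x| <= B * \int[mu]_(x in `[(-1), 1]) v x.
Proof.
move=> B0 mu_ mv ui vi uv v0.
apply: le_trans (le_normr_Rintegral _ ui) _ => //.
rewrite -RintegralZl// /Rintegral.
have Bvi : mu.-integrable `[(-1), 1] (EFin \o (fun x => B * v x)).
  rewrite (_ : _ \o _ = (fun x => B%:E * (EFin \o v) x)%E); first exact: integrableZl.
  by apply/funext => x /=; rewrite EFinM.
apply: fine_le.
- exact: (integrable_fin_num _ (integrable_norm ui)).
- exact: (integrable_fin_num _ Bvi).
apply: ae_ge0_le_integral => //.
- by apply/measurable_EFinP/measurable_funTS; exact: measurableT_comp.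
- by move=> x /=; rewrite in_itv/= => x1; rewrite lee_fin mulr_ge0// v0.
- by apply/measurable_EFinP/measurable_funTS; exact: measurable_funM.
Qed.

Lemma ae_bounded_integrable (u : R -> R) B : 0 <= B -> measurable_fun setT u ->
  {ae mu, forall x, -1 <= x <= 1 -> `|u x| <= B} ->
  mu.-integrable `[(-1), 1] (EFin \o u).
Proof.
move=> B0 mu_ [N [mN N0 uN]]; apply/integrableP; split.
  by apply: measurableT_comp => //; exact: measurable_funTS.
have /integrableP[_] : mu.-integrable `[(-1), 1] (EFin \o cst B).
  by apply: (@bounded_integrable_itv _ _ _ _ `|B|).
apply: le_lt_trans; apply: ae_ge0_le_integral => //.
- by apply/measurable_EFinP/measurable_funTS; exact: measurableT_comp.
- exact: (measurable_cst (`|B|%:E)%E).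
- exists N; split => //; apply: subset_trans uN => x /= H1 H2; apply: H1.
  by rewrite in_itv/= => x1; rewrite lee_fin (ger0_norm B0) H2.
Qed.

Lemma holder_bounded f a C : 0 < a -> 0 <= C ->
  (forall x y, -1 <= x -> x < y -> y <= 1 -> `|f y - f x| <= C * (y - x) `^ a) ->
  forall x, -1 <= x <= 1 -> `|f x| <= C * 2 `^ a + `|f (-1)|.
Proof.
move=> a0 C0 fC x /andP[]; rewrite le_eqVlt => /predU1P[<- _|x1 x2].
  by rewrite lerDr mulr_ge0 ?powR_ge0.
rewrite -[f x](subrK (f (-1))); apply: le_trans (ler_normD _ _) _.
rewrite lerD2r; apply: le_trans (fC _ _ (lexx _) x1 x2) _.
by apply: ler_wpM2l => //; apply: ge0_ler_powR; rewrite ?nnegrE ?(ltW a0)//; lra.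
Qed.

(** The two-point bound is averaged over [y]. *)
Lemma mean_oscillation f Psi B :
  measurable_fun setT f -> (forall x, -1 <= x <= 1 -> `|f x| <= B) ->
  mu.-integrable `[(-1), 1] (EFin \o Psi) ->
  (forall x y, -1 <= x <= 1 -> -1 <= y <= 1 -> `|f x - f y| <= Psi x + Psi y) ->
  forall x, -1 <= x <= 1 ->
  `|f x - 2^-1 * \int[mu]_(y in `[(-1), 1]) f y|
    <= Psi x + 2^-1 * \int[mu]_(y in `[(-1), 1]) Psi y.
Proof.
move=> mf fB Pi osc x x1.
have fi : mu.-integrable `[(-1), 1] (EFin \o f) by apply: (@bounded_integrable_itv _ _ _ _ B).
have ci c : mu.-integrable `[(-1), 1] (EFin \o cst c).
  by apply: (@bounded_integrable_itv _ _ _ _ `|c|).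
have -> : f x - 2^-1 * \int[mu]_(y in `[(-1), 1]) f y =
    2^-1 * \int[mu]_(y in `[(-1), 1]) (f x - f y).
  by rewrite (RintegralB _ (ci (f x)))//= Rintegral_cst_itv; field.
have -> : Psi x + 2^-1 * \int[mu]_(y in `[(-1), 1]) Psi y =
    2^-1 * \int[mu]_(y in `[(-1), 1]) (Psi x + Psi y).
  by rewrite (RintegralD _ (ci (Psi x)))//= Rintegral_cst_itv; field.
have di : mu.-integrable `[(-1), 1] (EFin \o (fun y => f x - f y)).
  by have := integrableB _ (ci (f x)) fi; apply.
have si : mu.-integrable `[(-1), 1] (EFin \o (fun y => Psi x + Psi y)).
  by have := integrableD _ (ci (Psi x)) Pi; apply.
rewrite normrM ger0_norm ?invr_ge0// ler_pM2l ?invr_gt0//.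
apply: le_trans (le_normr_Rintegral _ di) _ => //.
apply: le_Rintegral => //; first exact: integrable_norm.
by move=> y /=; rewrite in_itv/= => y1; exact: osc.
Qed.

Lemma interval_decorrelation U f B a C :
  (forall n, measurable_fun setT (U n)) ->
  (forall n t, -1 <= t <= 1 -> U n.+1 (hup t) = U n t) ->
  (forall n t, -1 <= t <= 1 -> U n.+1 (hlow t) = U n t) ->
  0 <= B -> {ae mu, forall x, -1 <= x <= 1 -> `|U 0%N x| <= B} ->
  measurable_fun setT f -> 0 < a <= 1 -> 0 <= C ->
  (forall x y, -1 <= x -> x < y -> y <= 1 -> `|f y - f x| <= C * (y - x) `^ a) ->
  exists2 K : R, 0 <= K & forall n, (1 < n)%N ->
    `|2^-1 * \int[mu]_(x in `[(-1), 1]) (U n x * f x)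
      - (2^-1 * \int[mu]_(x in `[(-1), 1]) U 0%N x)
        * (2^-1 * \int[mu]_(x in `[(-1), 1]) f x)|
    <= K * n%:R `^ (- (g - 1)^-1).
Proof.
move=> mU Uup Ulow B0 UB mf a01 C0 fC.
have [K K0 osc] := transfer_oscillation g g1 a C f a01 C0 fC.
exists (B * K) => [|n n1]; first exact: mulr_ge0.
have [Psi [mPsi Psi0 PsiI Psiosc]] := osc n n1.
have bi c : mu.-integrable `[(-1), 1] (EFin \o cst c).
  by apply: (@bounded_integrable_itv _ _ _ _ `|c|).
have Ui := ae_bounded_integrable _ B B0 (mU 0%N) UB.
have Pi : mu.-integrable `[(-1), 1] (EFin \o Psi).
  apply/integrableP; split.
    by apply: measurableT_comp => //; exact: measurable_funTS.
  apply: (@le_lt_trans _ _ (\int[mu]_(x in `[(-1)%R, 1%R]) (Psi x)%:E)%E).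
    rewrite le_eqVlt; apply/orP; left; apply/eqP.
    apply: eq_integral => x; rewrite inE/= in_itv/= => x1.
    by rewrite ger0_norm ?Psi0.
  by apply: le_lt_trans PsiI _; rewrite ltry.
pose I := \int[mu]_(x in `[(-1), 1]) Psi x.
have IK : I <= K * n%:R `^ (- (g - 1)^-1).
  by rewrite -lee_fin /I /Rintegral fineK//; apply: integrable_fin_num.
have I0 : 0 <= I.
  by apply: Rintegral_ge0 => x /=; rewrite in_itv/=; exact: Psi0.
have /andP[a0 _] := a01.
pose F := C * 2 `^ a + `|f (-1)|.
have fF : forall x, -1 <= x <= 1 -> `|f x| <= F by exact: holder_bounded.
pose Tf := iter n transfer f.
have mT : measurable_fun setT Tf by exact: measurable_iter_transfer.
have TF x : -1 <= x <= 1 -> `|Tf x| <= F by exact: iter_transfer_bounded.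
pose c := 2^-1 * \int[mu]_(x in `[(-1), 1]) f x.
have cE : c = 2^-1 * \int[mu]_(x in `[(-1), 1]) Tf x.
  by rewrite (Rintegral_iter_transfer g g1 n f F).
have TP x : -1 <= x <= 1 -> `|Tf x - c| <= Psi x + 2^-1 * I.
  by move=> x1; rewrite cE; apply: (mean_oscillation Tf Psi F).
have UTi : mu.-integrable `[(-1), 1] (EFin \o (fun x => U 0%N x * Tf x)).
  exact: (integrable_bounded_mul _ _ F (mU _) mT Ui TF).
have Uci : mu.-integrable `[(-1), 1] (EFin \o (fun x => U 0%N x * c)).
  by apply: (integrable_bounded_mul _ _ `|c| (mU _) _ Ui).
rewrite (observable_duality g g1 U mU Ui Uup Ulow n f F)// -/c -/Tf.
(* Subtracting the mean [c] inside the integral leaves [|Tf - c| <= Psi + I / 2], whose bound has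
   integral [2 I]. *)
have -> : 2^-1 * \int[mu]_(x in `[(-1), 1]) (U 0%N x * Tf x)
      - (2^-1 * \int[mu]_(x in `[(-1), 1]) U 0%N x) * c =
    2^-1 * \int[mu]_(x in `[(-1), 1]) (U 0%N x * (Tf x - c)).
  under [in RHS]eq_Rintegral do rewrite mulrBr.
  by rewrite RintegralB// RintegralZr//; ring.
have PIi : mu.-integrable `[(-1), 1] (EFin \o (fun x => Psi x + 2^-1 * I)).
  by have := integrableD _ Pi (bi (2^-1 * I)); apply.
have mTc : measurable_fun setT (fun x => Tf x - c) by exact: measurable_funB.
have := @ae_Rintegral_le (fun x => U 0%N x * (Tf x - c)) (fun x => Psi x + 2^-1 * I) B B0.
move=> /(_ _ _ _ PIi _ _)/wrap[].
- exact: measurable_funM.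
- exact: measurable_funD.
- apply: (integrable_bounded_mul _ _ (F + `|c|) (mU _) mTc Ui) => x x1.
  by apply: le_trans (ler_normB _ _) _; rewrite lerD2r TF.
- have [N [mN N0 UN]] := UB; exists N; split => //.
  apply: subset_trans UN => x /= H1 H2; apply: H1 => x1; rewrite normrM.
  by apply: ler_pM => //; [exact: H2|exact: TP].
- by move=> x x1; rewrite addr_ge0 ?Psi0// mulr_ge0.
rewrite (RintegralD _ Pi (bi (2^-1 * I)))//= Rintegral_cst_itv -/I.
have -> : I + 2 * (2^-1 * I) = 2 * I by field.
move=> H; rewrite normrM ger0_norm ?invr_ge0//.
have := ler_wpM2l B0 IK; move: H; lra.
Qed.

End interval_decorrelation.

(** * Transport to the circle *)

Section circle_integral.
Context {R : realType}.
Implicit Types (x y : R).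

Local Notation mu := (@lebesgue_measure R).

Lemma pt_out x : ~~ (-1 <= x <= 1) -> pt x = pt 1.
Proof.
move=> x1; rewrite /pt; congr (\pi_(circle R)%qT _); apply: val_inj.
by rewrite !val_insubd (negPf x1); case: ifP.
Qed.

(** Outside [[-1, 1]] the map [pt] is constant, so a preimage there is everything or nothing. *)
Lemma measurable_pt :
  measurable_fun setT (@pt R : measurableTypeR R -> circle R).
Proof.
move=> _ A mA; rewrite setTI.
have -> : @pt R @^-1` A = (`[(-1), 1] `&` @pt R @^-1` A) `|` (~` `[(-1), 1] `&` @pt R @^-1` A).
  by rewrite -setIUl setUCr setTI.
apply: measurableU; first exact: mA.
have [p1|p1] := boolP (pt 1 \in A).
- rewrite (_ : _ `&` _ = ~` `[(-1), 1]); first by apply: measurableC; exact: measurable_itv.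
  apply/seteqP; split => [x [] //|x /= H]; split => //.
  by rewrite pt_out; [exact/set_mem|move/negP: H; rewrite in_itv].
- rewrite (_ : _ `&` _ = set0); first exact: measurable0.
  apply/seteqP; split => [x /= [H]|//].
  rewrite pt_out; last by move/negP: H; rewrite in_itv.
  by move/mem_set; apply/negP.
Qed.

Let N11 : -1 < 1 :> R. Proof. by lra. Qed.

(** The measure of the circle presented as an image of the uniform law, to which the change of
    variables applies. *)
Let nu : {measure set (circle R) -> \bar R}.
Proof.
refine [the {measure set _ -> \bar R} of pushforward (uniform_prob N11) (@pt R)].
exact: measurable_pt.
Defined.

Lemma integral_circle (F : circle R -> \bar R) : measurable_fun setT F ->
  (forall c, 0 <= F c)%E ->
  (\int[circle_lebesgue R]_c F c =
   (2^-1)%:E * \int[mu]_(x in `[(-1)%R, 1%R]) F (pt x))%E.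
Proof.
move=> mF F0.
have half : (1 - -1)^-1 = 2^-1 :> R by congr (_^-1); ring.
have mFpt : measurable_fun setT (F \o @pt R : measurableTypeR R -> \bar R).
  exact: measurableT_comp measurable_pt.
transitivity (\int[nu]_c F c)%E.
  apply: eq_measure_integral => A mA _.
  transitivity (uniform_prob N11 (@pt R @^-1` A)); last by [].
  rewrite /circle_lebesgue /uniform_prob integral_uniform_pdf /=.
  rewrite (eq_integral (cst (2^-1)%:E)); last first.
    move=> x; rewrite inE => -[_ /=]; rewrite in_itv/= => x1.
    by rewrite /uniform_pdf x1 half.
  rewrite [X in integral _ X]setIC.
  exact/esym/(@integral_cst _ _ _ mu _ mA).
transitivity (\int[pushforward (uniform_prob N11) (@pt R)]_c F c)%E; first by [].
rewrite ge0_integral_pushforward//; last exact: measurable_pt.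
by rewrite preimage_setT integral_uniform//= half.
Qed.

Lemma Rintegral_circle (F : circle R -> R) : measurable_fun setT F ->
  mu.-integrable `[(-1), 1] (EFin \o (fun x => F (pt x))) ->
  \int[circle_lebesgue R]_c F c = 2^-1 * \int[mu]_(x in `[(-1), 1]) F (pt x).
Proof.
move=> mF Fi; rewrite /Rintegral integralE [in RHS]integralE.
have mE : measurable_fun setT (EFin \o F) by exact: measurableT_comp.
rewrite integral_circle//; last exact: measurable_funepos.
rewrite integral_circle//; last exact: measurable_funeneg.
have Hp := integrable_pos_fin_num _ Fi; have {}Hp := Hp (measurable_itv _).
have Hn := integrable_neg_fin_num _ Fi; have {}Hn := Hn (measurable_itv _).
set P := (\int[_]_(x in _) _)%E in Hp; set N := (\int[_]_(x in _) _)%E in Hn.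
transitivity (fine ((2^-1)%:E * P - (2^-1)%:E * N)%E).
  congr fine; congr (_ * _ - _ * _)%E; apply: eq_integral => x _.
    by rewrite !funeposE.
  by rewrite !funenegE.
rewrite -/P -/N; case: P Hp => // p _; case: N Hn => // q _.
by rewrite -!EFinM -!EFinB /= mulrBr.
Qed.

Lemma ae_circle (P : circle R -> Prop) :
  {ae circle_lebesgue R, forall c, P c} ->
  {ae mu, forall x, -1 <= x <= 1 -> P (pt x)}.
Proof.
move=> [N [mN N0 PN]]; exists (`[(-1), 1] `&` @pt R @^-1` N); split.
- exact: mN.
- move/eqP: N0; rewrite /circle_lebesgue/= mule_eq0 => /orP[|/eqP//].
  by rewrite eqe invr_eq0 pnatr_eq0.
- move=> x /= H; have x1 : -1 <= x <= 1 by apply: contrapT => x1; apply: H.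
  by split; [rewrite in_itv|apply: PN => /= Px; apply: H].
Qed.

Lemma Lfun_infty_bounded (phi : circle R -> R) :
  phi \in Lfun (circle_lebesgue R) +oo%E ->
  measurable_fun setT phi /\
  exists2 B : R, 0 <= B & {ae circle_lebesgue R, forall c, `|phi c| <= B}.
Proof.
move=> phiL; split.
  by have := sub_Lfun_mfun phiL; rewrite inE.
have := sub_Lfun_finLfun phiL; rewrite inE/= /finite_norm unlock.
have -> : (0 < circle_lebesgue R setT)%E by rewrite probability_setT.
set s := ess_sup_inf.ess_sup _ _ => soo.
have H := ess_sup_inf.ess_sup_ge (circle_lebesgue R) (abse \o (EFin \o phi)).
(* The maximum with 0 makes the bound finite and nonnegative without a discussion of [-oo]. *)
exists (fine (maxe s 0)); first by rewrite fine_ge0// le_max lexx orbT.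
apply: filterS H => c /= H; rewrite -lee_fin fineK; first by rewrite le_max H.
by rewrite ge0_fin_numE ?gt_max ?soo ?ltry// le_max lexx orbT.
Qed.

End circle_integral.

(** * The circle map and its lift to the line *)

Section circle_map.
Context {R : realType}.
Implicit Types (a x y s t B C K : R) (phi psi : circle R -> R).

(** Both the default value of [pt] and [pt (-1)] are [pt 1], so [pt] is unchanged by clamping.
    Functions of [pt x] are thereby controlled on the whole line, as in [holder_pt]. *)
Let clamp x := Num.max (-1) (Num.min 1 x).

Let clampE x : [\/ -1 <= x <= 1 /\ clamp x = x, 1 < x /\ clamp x = 1 | x < -1 /\ clamp x = -1].
Proof.
rewrite /clamp; have [x1|x1] := leP 1 x.
  have -> : Num.max (-1) 1 = 1 :> R by apply/max_idPr; lra.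
  by move: x1; rewrite le_eqVlt => /predU1P[<-|]; [constructor 1; lra|constructor 2].
have [xN|xN] := leP (-1) x; last by constructor 3.
by constructor 1; split => //; apply/andP; split => //; exact: ltW.
Qed.

Let clamp_itv x : -1 <= clamp x <= 1.
Proof. by have [[? ->]|[? ->]|[? ->]] := clampE x; lra. Qed.

Let clamp_le x y : x <= y -> 0 <= clamp y - clamp x <= y - x.
Proof.
by move=> xy; have [[? ->]|[? ->]|[? ->]] := clampE x;
  have [[? ->]|[? ->]|[? ->]] := clampE y; lra.
Qed.

Lemma pt_clamp x : pt (clamp x) = pt x.
Proof.
have [[? ->]//|[x1 ->]|[x1 ->]] := clampE x; [|rewrite ptN1];
  by rewrite (@pt_out _ x)//; apply/negP; lra.
Qed.

Lemma measurable_circle (F : circle R -> R) :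
  measurable_fun setT (fun x : R => F (pt x)) -> measurable_fun setT F.
Proof.
move=> mF _ A mA; rewrite setTI.
change (measurable (`[(-1), 1] `&` ((fun x : R => F (pt x)) @^-1` A))).
by apply: measurableI => //; have := mF measurableT A mA; rewrite setTI.
Qed.

Lemma holder_pt psi : circle_holder psi -> exists a C : R,
  [/\ 0 < a <= 1, 0 <= C &
    forall x y, x <= y -> `|psi (pt y) - psi (pt x)| <= C * (y - x) `^ a].
Proof.
move=> [a [C [a01 psiC]]]; exists a, `|C|; split => // x y xy.
have /andP[a0 _] := a01.
rewrite -(pt_clamp x) -(pt_clamp y); apply: le_trans (psiC _ _) _.
rewrite circle_dist_pt//; set d := Num.min _ _.
have d0 : 0 <= d.
  rewrite /d le_min normr_ge0/= subr_ge0 ler_norml.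
  by have := clamp_itv x; have := clamp_itv y; lra.
have dxy : d <= y - x.
  rewrite /d ge_min; apply/orP; left; have := clamp_le x y xy.
  by move=> /andP[c0 ?]; rewrite ger0_norm.
apply: (@le_trans _ _ (`|C| * d `^ a)).
  by apply: ler_wpM2r; [exact: powR_ge0|exact: ler_norm].
apply: ler_wpM2l => //; apply: ge0_ler_powR; rewrite ?nnegrE ?(ltW a0)// subr_ge0.
exact: xy.
Qed.

Lemma holder_measurable f a C : 0 < a -> 0 <= C ->
  (forall x y, x <= y -> `|f y - f x| <= C * (y - x) `^ a) ->
  measurable_fun setT (f : R -> R).
Proof.
move=> a0 C0 fC; apply: continuous_measurable_fun => x.
have fC' y : `|f x - f y| <= C * `|x - y| `^ a.
  have [xy|/ltW yx] := leP x y.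
    by rewrite distrC (distrC x) (@ger0_norm _ (y - x)) ?subr_ge0// fC.
  by rewrite (@ger0_norm _ (x - y)) ?subr_ge0// fC.
apply/cvgrPdist_lt => e e0.
pose del := (e / (C + 1)) `^ a^-1.
have C1 : 0 < C + 1 by lra.
have eC : 0 < e / (C + 1) by rewrite divr_gt0.
have del0 : 0 < del by rewrite powR_gt0.
exists del => //= y /= xy.
apply: le_lt_trans (fC' y) _.
have H : `|x - y| `^ a <= e / (C + 1).
  have -> : e / (C + 1) = del `^ a by rewrite -powRrM mulVf ?gt_eqF// powRr1 ?ltW.
  by apply: ge0_ler_powR; rewrite ?nnegrE ?(ltW a0) ?(ltW del0)// ltW.
apply: le_lt_trans (ler_wpM2l C0 H) _.
by rewrite mulrCA gtr_pMr// ltr_pdivrMr// mul1r; lra.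
Qed.

Variables (g : R) (T : circle R -> circle R).
Hypothesis g1 : 1 < g.
Hypothesis T_map : is_circle_map g T.

(** The defining equations at [hup g t] provide some [s] with [hup g s = hup g t]; injectivity gives
    [s = t]. *)
Lemma circle_map_hup t : -1 <= t <= 1 -> T (pt (hup g t)) = pt t.
Proof.
move=> t1; have [Tl Tu _] := T_map; have := hup_itv g g1 t t1.
have [t0|t0] := leP t 0 => ht.
- have [|s [s1 -> e]] := Tl (hup g t).
    have /andP[ht0 _] := ht; rewrite ht0 -(hup0 g).
    by apply: (hup_homo g g1); lra.
  congr pt; apply: (hup_inj g g1); [lra|lra|].
  by rewrite e /hup ifT//; case/andP: s1.
- have [|s [s1 -> e]] := Tu (hup g t).
    have /andP[_ ->] := ht; rewrite andbT -(hup0 g).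
    by apply: (hup_homo g g1); lra.
  congr pt; apply: (hup_inj g g1); [lra|lra|].
  by rewrite e hup_ge0E//; case/andP: s1.
Qed.

Lemma circle_map_hlow t : -1 <= t <= 1 -> T (pt (hlow g t)) = pt t.
Proof.
move=> t1; have Nt : -1 <= - t <= 1 by lra.
have [_ _ To] := T_map.
rewrite hlowE -circle_opp_pt; last exact: hup_itvW.
by rewrite To circle_map_hup// circle_opp_pt// opprK.
Qed.

(** Serves the measurability of the iterates: [tau] inverts [hup] on the nonnegative side, where it
    is monotone, and is continued by oddness. *)
Lemma circle_map_lift : exists2 tau : R -> R, measurable_fun setT tau &
  forall x, T (pt x) = pt (tau x).
Proof.
have [_ _ To] := T_map.
have c0 x : 0 <= x -> 0 <= clamp x <= 1.
  by move=> x0; have [[? ->]|[? ->]|[? ->]] := clampE x; lra.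
(* The argument is forced into [[0, 1]], so that the inverse is defined and nondecreasing on the
   whole line. *)
have inv_ex x : {s | -1 <= s <= 1 & hup g s = Num.max 0 (clamp x)}.
  apply/cid2; apply: (hup_surj g g1).
  rewrite le_max lexx ge_max ler01/=.
  by case/andP: (clamp_itv x).
pose inv x := s2val (inv_ex x).
have invT x : 0 <= x -> T (pt x) = pt (inv x).
  move=> x0; rewrite -(pt_clamp x) /inv; case: (inv_ex x) => s s1 /= hs.
  by rewrite -[RHS]circle_map_hup// hs; congr (T (pt _)); apply/esym/max_idPr;
     case/andP: (c0 x x0).
have mi : measurable_fun setT inv.
  apply: nondecreasing_measurable => // x y xy; rewrite /inv.
  case: (inv_ex x) => s /= s1 hs; case: (inv_ex y) => t /= t1 ht.
  rewrite leNgt; apply/negP => ts.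
  have /andP[cxy _] := clamp_le x y xy; rewrite subr_ge0 in cxy.
  have := hup_lt g g1 t s; rewrite hs ht => H.
  suff : Num.max 0 (clamp y) < Num.max 0 (clamp x).
    by move: (clamp x) (clamp y) cxy => u v uv; rewrite ltNge ge_max !le_max lexx uv orbT.
  by apply: H => //; [case/andP: t1|case/andP: s1].
exists (fun x => if x < 0 then - inv (- x) else inv x).
  apply: measurable_fun_ifT => //; first exact: measurable_fun_ltr.
  by apply: measurableT_comp => //; exact: measurableT_comp.
move=> x; case: ltP => x0; last exact: invT.
have Nx : 0 <= - x by lra.
have -> : pt x = circle_opp (pt (- x)).
  rewrite -(pt_clamp x) -(pt_clamp (- x)) circle_opp_pt//; congr pt.
  by have [[? ->]|[? ->]|[? ->]] := clampE x;
    have [[? ->]|[? ->]|[? ->]] := clampE (- x); lra.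
rewrite To invT// circle_opp_pt// /inv; by case: (inv_ex _).
Qed.

End circle_map.

Theorem proposition5 (R : realType) (g : R) (T : circle R -> circle R)
    (g_gt1 : 1 < g) (T_map : is_circle_map g T)
    (phi psi : circle R -> R)
    (phi_Linfty : phi \in Lfun (circle_lebesgue R) +oo%E)
    (psi_holder : circle_holder psi) :
  (fun n : nat =>
     `| \int[circle_lebesgue R]_x (phi (iter n T x) * psi x)
        - (\int[circle_lebesgue R]_x phi x)
          * (\int[circle_lebesgue R]_x psi x) | : R^o)
  =O_\oo (fun n : nat => 1 / n%:R `^ (1 / (g - 1)) : R^o).
Proof.
have [mphi [B B0 phiB]] := Lfun_infty_bounded phi phi_Linfty.
have [a [C [a01 C0 psiC]]] := holder_pt psi psi_holder.
have /andP[a0 _] := a01.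
have [tau mtau Ttau] := circle_map_lift g T g_gt1 T_map.
pose f x := psi (pt x); pose U n x := phi (iter n T (pt x)).
have mf : measurable_fun setT f by exact: holder_measurable a0 C0 psiC.
have mpsi : measurable_fun setT psi by exact: measurable_circle.
have itau n x : iter n T (pt x) = pt (iter n tau x).
  by elim: n => //= n ->.
have mitau n : measurable_fun setT (iter n tau).
  by elim: n => [|n IH]; [exact: measurable_id|exact: (measurableT_comp mtau IH)].
have mU n : measurable_fun setT (U n).
  rewrite (_ : U n = phi \o (@pt R \o iter n tau)).
    exact: measurableT_comp mphi (measurableT_comp measurable_pt (mitau n)).
  by apply/funext => x; rewrite /U itau.
have Uup n t : -1 <= t <= 1 -> U n.+1 (hup g t) = U n t.
  by move=> t1; rewrite /U iterSr (circle_map_hup g T g_gt1 T_map).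
have Ulow n t : -1 <= t <= 1 -> U n.+1 (hlow g t) = U n t.
  by move=> t1; rewrite /U iterSr (circle_map_hlow g T g_gt1 T_map).
have fC x y : -1 <= x -> x < y -> y <= 1 -> `|f y - f x| <= C * (y - x) `^ a.
  by move=> _ /ltW xy _; exact: psiC.
have UB := ae_circle (fun c => `|phi c| <= B) phiB.
have [K K0 decay] := interval_decorrelation g g_gt1 U f B a C mU Uup Ulow B0 UB mf a01 C0 fC.
have fF := holder_bounded f a C a0 C0 fC.
have Ui := observable_integrable g g_gt1 U mU (ae_bounded_integrable _ B B0 (mU 0%N) UB) Uup Ulow.
have fi : (@lebesgue_measure R).-integrable `[(-1), 1] (EFin \o f).
  exact: (@bounded_integrable_itv _ _ _ _ _ mf fF).
(* The constant must be positive, and [K] may be 0. *)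
apply/eqO_exP; exists (K + 1); first by rewrite ltr_wpDl.
near=> n.
have n1 : (1 < n)%N by near: n; exact: nbhs_infty_gt.
have mUf : measurable_fun setT (fun c => phi (iter n T c) * psi c).
  by apply: measurable_circle; exact: measurable_funM (mU n) mf.
rewrite (Rintegral_circle _ mUf); last first.
  exact: integrable_bounded_mul (mU n) mf (Ui n) fF.
rewrite (Rintegral_circle _ mphi (Ui 0%N)) (Rintegral_circle _ mpsi fi).
rewrite normr_id; apply: le_trans (decay n n1) _.
rewrite div1r powRN div1r (ger0_norm (_ : 0 <= (_ `^ _)^-1)) ?invr_ge0 ?powR_ge0//.
by rewrite ler_wpM2r ?invr_ge0 ?powR_ge0// lerDl.
Unshelve. all: by end_near.
Qed.
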